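(* Let $\mathbb L\in\{\mathbb R,\mathbb C\}$, $\mathbb K\in\{\mathbb R,\mathbb L\}$, $s\in\{\infty,\omega\}$, and $r\in\mathbb N_0\cup\{\infty,\omega\}$ with $r\le s$. Let $G$ be a $C^s_{\mathbb K}$-Lie group and $M$ be a $G$-manifold of class $C^r_{\mathbb K}$ with action $\alpha$. Let $E_1$ and $E_2$ be equivariant $\mathbb L$-vector bundles of class $C^r_{\mathbb K}$ over $M$, with $G$-actions $\beta_1,\beta_2$ and typical fibres $F_1,F_2$. If $F_1$ is finite dimensional, then $E_1\otimes E_2:=\bigcup_{x\in M}(E_1)_x\otimes_{\mathbb L}(E_2)_x$ (disjoint union), with the structure specified in the context, is an equivariant $\mathbb L$-vector bundle of class $C^r_{\mathbb K}$ over $M$, with typical fibre $F_1\otimes_{\mathbb L}F_2$. That is: there is a (unique) $\mathbb L$-vector bundle structure of class $C^r_{\mathbb K}$ on $E_1\otimes E_2\to M$ for which, for all local trivializations $\psi^1,\psi^2$ of $E_1,E_2$ over a common open set $U\subseteq M$, the map $$(E_1)_x\otimes_{\mathbb L}(E_2)_x\ni v\mapsto\bigl(x,((\mathrm{pr}_{F_1}\circ\psi^1|_{(E_1)_x})\otimes(\mathrm{pr}_{F_2}\circ\psi^2|_{(E_2)_x}))(v)\bigr)\in U\times(F_1\otimes_{\mathbb L}F_2)\quad(x\in U)$$ is a local trivialization; and the $G$-action $\beta(g,v):=(\beta_1(g,\cdot)|_{(E_1)_x}\otimes\beta_2(g,\cdot)|_{(E_2)_x})(v)$ for $g\in G$,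 $v\in(E_1)_x\otimes_{\mathbb L}(E_2)_x$, is $C^r_{\mathbb K}$ and makes it an equivariant $\mathbb L$-vector bundle of class $C^r_{\mathbb K}$.
   Context: All locally convex spaces are Hausdorff; manifolds and Lie groups are modeled on (possibly infinite-dimensional) locally convex $\mathbb K$-spaces. $n<\infty<\omega$ for $n\in\mathbb N_0$. Complex spaces are regarded as real ones when $\mathbb K=\mathbb R$. $C^r_{\mathbb K}$-maps (Keller's $C^r_c$-theory): for $r\in\mathbb N_0\cup\{\infty\}$, a map $f\colon U\to H$ from an open subset $U$ of a locally convex $\mathbb K$-space $X$ to a locally convex $\mathbb K$-space $H$ is $C^r_{\mathbb K}$ if it is continuous and for all $j\in\mathbb N$ with $j\le r$ the iterated directional derivatives $d^jf(x,y_1,\ldots,y_j)=(D_{y_j}\cdots D_{y_1}f)(x)$ (over $\mathbb K$) exist and define a continuous map $U\times X^j\to H$. $C^\omega_{\mathbb C}$ means complex analytic (continuous and locally a pointwise convergent series of continuous homogeneous complex polynomials; equivalent to $C^\infty_{\mathbb C}$); $C^\omega_{\mathbb R}$ means: extends to a complex analytic map to $H_{\mathbb C}$ on an open neighbourhood of $U$ in $X_{\mathbb C}$. Manifolds and Lie groups are defined as usual. An $\mathbb L$-vector bundle of class $C^r_{\mathbb K}$ over $M$ with typical fibre a locally convex $\mathbb L$-vector space $F$ is a $C^r_{\mathbb K}$-manifold $E$ with a surjective $C^r_{\mathbb K}$-map $\pi\colon E\to M$ and an $\mathbb L$-vector space structure on each fibre $E_x=\pi^{-1}(\{x\})$ such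 that each $x\in M$ has an open neighbourhood $U\subseteq M$ with a $C^r_{\mathbb K}$-diffeomorphism $\psi\colon\pi^{-1}(U)\to U\times F$ (a local trivialization) satisfying $\psi(E_y)=\{y\}\times F$ and $\mathrm{pr}_F\circ\psi|_{E_y}\colon E_y\to F$ $\mathbb L$-linear for all $y\in U$ ($\mathrm{pr}_F$ is the projection to $F$). A $G$-manifold of class $C^r_{\mathbb K}$ is a $C^r_{\mathbb K}$-manifold $M$ with a $C^r_{\mathbb K}$-action $\alpha\colon G\times M\to M$. An equivariant $\mathbb L$-vector bundle of class $C^r_{\mathbb K}$ over $(M,\alpha)$ is an $\mathbb L$-vector bundle $\pi\colon E\to M$ of class $C^r_{\mathbb K}$ with a $C^r_{\mathbb K}$-action $\beta\colon G\times E\to E$ such that $\beta(g,E_x)\subseteq E_{\alpha(g,x)}$ and $\beta(g,\cdot)|_{E_x}\colon E_x\to E_{\alpha(g,x)}$ is $\mathbb L$-linear for all $(g,x)\in G\times M$. If $F_1$ is finite dimensional with basis $e_1,\ldots,e_n$, then $F_1\otimes_{\mathbb L}F_2$ carries the locally convex topology making the linear bijection $(F_2)^n\to F_1\otimes_{\mathbb L}F_2$, $(y_1,\ldots,y_n)\mapsto\sum_{\tau=1}^n e_\tau\otimes y_\tau$ a homeomorphism (independent of the basis). The projection $E_1\otimes E_2\to M$ sends $v\in(E_1)_x\otimes_{\mathbb L}(E_2)_x$ to $x$. *)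

(* Defs.v *)
From HB Require Import structures.
From mathcomp Require Import all_boot all_order all_algebra.
From mathcomp Require Import monoid generic_quotient.
From mathcomp Require Import all_classical all_reals topology.
From mathcomp Require Import normedtype convex interval_inference.
From mathcomp Require Import complex.
Set Implicit Arguments.
Unset Strict Implicit.
Unset Printing Implicit Defensive.
Import Order.TTheory GRing.Theory Num.Theory.
Import numFieldTopology.Exports numFieldNormedType.Exports.
Local Open Scope classical_set_scope.
Local Open Scope ring_scope.

(* The scalar fields are R : realType and R[i]; a locally convex space over   *)
(* K is a (X : tvsType K) with hausdorff_space X.                             *)
Variant scalar := ScR | ScC.
Definition Fld (R : realType) (k : scalar) : numFieldType :=
  if k is ScR then (R : numFieldType) else (R[i] : numFieldType).

(* The admissible pairs (K, L): L in {R, C} and K in {R, L}. *)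
Variant scalars := RR | RC | CC.
Definition baseK c := if c is CC then ScC else ScR.
Definition fibK c := if c is RR then ScR else ScC.

Definition emb (R : realType) (c : scalars) :
    Fld R (baseK c) -> Fld R (fibK c) :=
  match c with RR => id | RC => fun a => (a%:C)%C | CC => id end.

Lemma emb_add R c : {morph @emb R c : a b / a + b}.
Proof. by case: c => //= a b; rewrite rmorphD. Qed.
Lemma emb_mul R c : {morph @emb R c : a b / a * b}.
Proof. by case: c => //= a b; rewrite rmorphM. Qed.
Lemma emb1 R c : @emb R c 1 = 1.
Proof. by case: c. Qed.
Lemma emb0 R c : @emb R c 0 = 0.
Proof. by case: c. Qed.
Lemma emb_le R c : {mono @emb R c : a b / a <= b}.
Proof. by case: c => //= a b; rewrite lecR. Qed.
Lemma emb_norm R c (a : Fld R (baseK c)) : `|emb a| = emb `|a|.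
Proof. by case: c a => //= a; rewrite normc_def /= expr0n addr0 sqrtr_sqr. Qed.

Lemma real_complex_continuous (R : realType) :
  continuous ((fun a : R => (a%:C)%C : R[i]) : R^o -> (R[i])^o).
Proof.
move=> x; apply/cvgrPdist_lt => -[e ei].
rewrite ltcE => /andP[/eqP /= -> e0]; near=> y.
rewrite -rmorphB (@emb_norm R RC) ltcR.
near: y; exact: cvgr_dist_lt.
Unshelve. all: by end_near. Qed.

(* An L-tvs regarded as a K-tvs: same topology, scalars restricted along emb. *)
Definition restr (R : realType) (c : scalars) (V : tvsType (Fld R (fibK c))) :
  Type := V.

Section restr.
Variables (R : realType) (c : scalars) (V : tvsType (Fld R (fibK c))).
Local Notation W := (restr V).
HB.instance Definition _ := Uniform.copy W V.
HB.instance Definition _ := GRing.Zmodule.copy W V.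
Let sc (a : Fld R (baseK c)) (v : W) : W := (emb a *: (v : V)).
Let scA a b v : sc a (sc b v) = sc (a * b) v.
Proof. by rewrite /sc scalerA emb_mul. Qed.
Let sc1 : left_id 1 sc.
Proof. by move=> v; rewrite /sc emb1 scale1r. Qed.
Let scDr : right_distributive sc +%R.
Proof. by move=> a u v; rewrite /sc scalerDr. Qed.
Let scDl v : {morph sc^~ v : a b / a + b}.
Proof. by move=> a b; rewrite /sc emb_add scalerDl. Qed.
HB.instance Definition _ :=
  GRing.Zmodule_isLmodule.Build (Fld R (baseK c)) W scA sc1 scDr scDl.

Lemma restr_scaleE (a : Fld R (baseK c)) (v : W) : a *: v = emb a *: (v : V).
Proof. by []. Qed.

Let addc : continuous (fun x : W * W => x.1 + x.2).
Proof. exact: (@add_continuous V). Qed.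

Let embc : continuous (@emb R c : (Fld R (baseK c))^o -> (Fld R (fibK c))^o).
Proof.
by case: c; [move=> x; exact: cvg_id|exact: real_complex_continuous|
  move=> x; exact: cvg_id].
Qed.

Let scalec : continuous (fun z : (Fld R (baseK c))^o * W => z.1 *: z.2).
Proof.
move=> [a v] U nU.
have [B [B1 B2] BU] := @scale_continuous _ V (emb a, v) U nU.
exists ((@emb R c) @^-1` B.1, B.2); first by split => //; exact: embc.
by move=> [b w] /= [Bb Bw]; exact: (BU (emb b, w)).
Qed.

Let convexW :
  exists2 B : set_system W, (forall b, b \in B -> convex_set b) & basis B.
Proof.
have [B Bc Bb] := @locally_convex _ V.
exists B => // b /Bc bc x y l xb yb.
have e0 : 0 <= emb l%:num :> Fld R (fibK c) by rewrite -(emb0 R c) emb_le.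
have e1 : emb l%:num <= 1 :> Fld R (fibK c) by rewrite -(emb1 R c) emb_le.
have := bc x y (Itv01 e0 e1) xb yb.
set u := conv _ _ _; set w := conv _ _ _; suff -> : u = w by [].
rewrite /u /w /conv /=; congr (_ + _).
congr (_ *: _).
move=> /=; apply: (addIr (emb l%:num)).
by rewrite /= -[X in _ = X]emb_add !subrK emb1.
Qed.

HB.instance Definition _ :=
  PreTopologicalNmodule_isTopologicalNmodule.Build W addc.
HB.instance Definition _ :=
  TopologicalNmodule_isTopologicalLmodule.Build (Fld R (baseK c)) W scalec.
HB.instance Definition _ := Uniform_isTvs.Build (Fld R (baseK c)) W convexW.
End restr.

(* X_C = X + iX, with (x, y) standing for x + iy. *)
Definition cplx (R : realType) (X : tvsType R) : Type := (X * X)%type.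

Section cplx.
Variables (R : realType) (X : tvsType R).
Local Notation W := (cplx X).
HB.instance Definition _ := Uniform.copy W (X * X)%type.
HB.instance Definition _ := GRing.Zmodule.copy W (X * X)%type.
Let sc (a : R[i]) (v : W) : W :=
  (complex.Re a *: v.1 - complex.Im a *: v.2,
   complex.Re a *: v.2 + complex.Im a *: v.1).
Let scA a b v : sc a (sc b v) = sc (a * b) v.
Proof.
case: a b v => [a a'] [b b'] [x y]; rewrite /sc /=.
rewrite !scalerBr !scalerDr !scalerA !scalerDl !scaleNr !opprD -!addrA.
by congr pair; congr (_ + _); rewrite addrA addrC.
Qed.
Let sc1 : left_id 1 sc.
Proof. by move=> [x y]; rewrite /sc /= !scale1r !scale0r subr0 addr0. Qed.
Let scDr : right_distributive sc +%R.
Proof.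
move=> a [x y] [x' y']; rewrite /sc /=; congr pair; rewrite /= !scalerDr.
  by rewrite opprD addrACA.
by rewrite addrACA.
Qed.
Let scDl v : {morph sc^~ v : a b / a + b}.
Proof.
move=> [a a'] [b b']; rewrite /sc /=; congr pair; rewrite /= !scalerDl.
  by rewrite opprD addrACA.
by rewrite addrACA.
Qed.
HB.instance Definition _ :=
  GRing.Zmodule_isLmodule.Build R[i] W scA sc1 scDr scDl.

Let addc : continuous (fun x : W * W => x.1 + x.2).
Proof. exact: (@add_continuous (X * X)%type). Qed.

Let Re_cont : continuous (@complex.Re R : (R[i])^o -> R^o).
Proof.
move=> x U [e /= e0 eU].
exists (e%:C)%C => [|y /= xy]; first by rewrite /= ltcR.
apply: eU => /=.
by rewrite -raddfB -ltcR; exact: le_lt_trans (normc_ge_Re _) xy.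
Qed.

Let Im_cont : continuous (@complex.Im R : (R[i])^o -> R^o).
Proof.
move=> x U [e /= e0 eU].
exists (e%:C)%C => [|y /= xy]; first by rewrite /= ltcR.
apply: eU => /=.
have -> : complex.Im x - complex.Im y = - complex.Re ((x - y) * 'i%C).
  by case: x y {xy} => [a b] [c d] /=; rewrite mulr0 mulr1 sub0r opprK.
rewrite normrN -ltcR; apply: le_lt_trans (normc_ge_Re _) _.
rewrite normrM (_ : `|'i%C| = 1 :> R[i]) ?mulr1 //.
by rewrite normc_def /= expr0n add0r expr1n sqrtr1.
Qed.

Let scalec : continuous (fun z : (R[i])^o * W => z.1 *: z.2).
Proof.
have h (g : (R[i])^o -> R^o) (f : W -> X) : continuous g -> continuous f ->
    continuous (fun z : (R[i])^o * W => g z.1 *: f z.2).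
  move=> gc fc [a v] U nU.
  have [B [B1 B2] BU] := @scale_continuous _ X (g a, f v) U nU.
  exists (g @^-1` B.1, f @^-1` B.2); first by split; [exact: gc|exact: fc].
  by move=> [b w] /= [Bb Bw]; exact: (BU (g b, f w)).
have hD (f g : (R[i])^o * W -> X) : continuous f -> continuous g ->
    continuous (fun z => f z + g z).
  move=> fc gc z U nU.
  have [B [B1 B2] BU] := @add_continuous X (f z, g z) U nU.
  apply: (@filterS _ (nbhs z) _ (f @^-1` B.1 `&` g @^-1` B.2)).
    by move=> w [Bf Bg]; exact: (BU (f w, g w)).
  by apply: filterI; [exact: fc|exact: gc].
have c1 : continuous (fst : W -> X) by move=> z; exact: cvg_fst.
have c2 : continuous (snd : W -> X) by move=> z; exact: cvg_snd.
move=> z; apply: cvg_pair; last by apply: hD; exact: h.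
apply: hD; first exact: h.
under [X in continuous X]funext do rewrite -scalerN.
apply: (h _ (fun v => - v.2)) => // v.
exact: (cvg_comp _ _ (@c2 v) (@opp_continuous X _)).
Qed.

Let convexW :
  exists2 B : set_system W, (forall b, b \in B -> convex_set b) & basis B.
Proof.
have [B Bc Bb] := @locally_convex _ (X * X)%type.
exists B => // b /Bc bc x y l xb yb.
have : 0 <= l%:num :> R[i] by [].
rewrite lecE => /andP[/eqP l0 l0'].
have : l%:num <= 1 :> R[i] by [].
rewrite lecE => /andP[_ l1'].
have := bc x y (Itv01 l0' l1') xb yb.
set u := conv _ _ _; set w := conv _ _ _; suff -> : u = w by [].
rewrite /u /w /conv /=.
have E (a : R[i]) (v : W) : complex.Im a = 0 ->
    a *: v = complex.Re a *: (v : X * X).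
  by move=> a0; rewrite /GRing.scale /= /sc a0 !scale0r subr0 addr0.
by rewrite !E ?raddfB ?l0 /= ?subr0 // l0 subr0.
Qed.

HB.instance Definition _ :=
  PreTopologicalNmodule_isTopologicalNmodule.Build W addc.
HB.instance Definition _ :=
  TopologicalNmodule_isTopologicalLmodule.Build R[i] W scalec.
HB.instance Definition _ := Uniform_isTvs.Build R[i] W convexW.

Definition cplx_incl (x : X) : W := (x, 0).
End cplx.

Local Open Scope quotient_scope.

Section tensor.
Variables (L : fieldType) (V W : lmodType L).

(* A sequence of pairs (v, w) stands for the sum of the v (x) w; tens_rel is  *)
(* the congruence generated by bilinearity, and tensor is the quotient.       *)
Inductive tens_rel : seq (V * W) -> seq (V * W) -> Prop :=
| tens_refl s : tens_rel s s
| tens_sym s t : tens_rel s t -> tens_rel t s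
| tens_trans s t u : tens_rel s t -> tens_rel t u -> tens_rel s u
| tens_cat s s' t t' :
    tens_rel s s' -> tens_rel t t' -> tens_rel (s ++ t) (s' ++ t')
| tens_comm s t : tens_rel (s ++ t) (t ++ s)
| tens_Dl v v' w : tens_rel [:: (v + v', w)] [:: (v, w); (v', w)]
| tens_Dr v w w' : tens_rel [:: (v, w + w')] [:: (v, w); (v, w')]
| tens_Z a v w : tens_rel [:: (a *: v, w)] [:: (v, a *: w)]
| tens_0 w : tens_rel [:: (0, w)] [::].

Let eqv : rel (seq (V * W)) := fun s t => `[< tens_rel s t >].
Let eqvR : reflexive eqv. Proof. by move=> s; apply/asboolP/tens_refl. Qed.
Let eqvS : symmetric eqv.
Proof. by move=> s t; apply/asboolP/asboolP; exact: tens_sym. Qed.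
Let eqvT : transitive eqv.
Proof.
by move=> t s u /asboolP st /asboolP tu; apply/asboolP/(tens_trans st tu).
Qed.
Definition tens_equiv := EquivRel eqv eqvR eqvS eqvT.

Definition tensor := {eq_quot tens_equiv}.
HB.instance Definition _ := Choice.on tensor.
HB.instance Definition _ := EqQuotient.on tensor.

Lemma tensP s t : reflect (tens_rel s t) (s == t %[mod tensor]).
Proof. by rewrite eqmodE; exact: asboolP. Qed.

Let pi s : tensor := \pi s.
Let piP s t : tens_rel s t -> pi s = pi t.
Proof. by move=> st; apply/eqP/tensP. Qed.
Let reprP s : tens_rel (repr (pi s)) s.
Proof. by apply/tensP; rewrite reprK. Qed.
Let piK (x : tensor) : pi (repr x) = x.
Proof. exact: reprK. Qed.

Let add (x y : tensor) := pi (repr x ++ repr y).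
Let zer := pi [::].
Definition tens_scale (a : L) (s : seq (V * W)) :=
  [seq (a *: p.1, p.2) | p <- s].
Let opp (x : tensor) := pi (tens_scale (-1) (repr x)).
Let sc a (x : tensor) := pi (tens_scale a (repr x)).

Let scale_rel a s t :
  tens_rel s t -> tens_rel (tens_scale a s) (tens_scale a t).
Proof.
elim => {s t} /=; rewrite ?scaler0.
- by move=> s; exact: tens_refl.
- by move=> s t _; exact: tens_sym.
- by move=> s t u _ h1 _ h2; exact: tens_trans h1 h2.
- by move=> s s' t t' _ h1 _ h2; rewrite /tens_scale !map_cat; exact: tens_cat.
- by move=> s t; rewrite /tens_scale !map_cat; exact: tens_comm.
- by move=> v v' w; rewrite scalerDr; exact: tens_Dl.
- by move=> v w w'; exact: tens_Dr.
- by move=> b v w; rewrite scalerA mulrC -scalerA; exact: tens_Z.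
- by move=> w; exact: tens_0.
Qed.

Let addE s t : add (pi s) (pi t) = pi (s ++ t).
Proof. by apply: piP; apply: tens_cat; exact: reprP. Qed.
Let scE a s : sc a (pi s) = pi (tens_scale a s).
Proof. by apply: piP; apply: scale_rel; exact: reprP. Qed.

Let scale0 s : tens_rel (tens_scale 0 s) [::].
Proof.
elim: s => [|p s IH]; first exact: tens_refl.
rewrite -[tens_scale _ _]/([:: (0 *: p.1, p.2)] ++ tens_scale 0 s).
by rewrite -[[::]]/([::] ++ [::]); apply: tens_cat => //; rewrite scale0r;
  exact: tens_0.
Qed.
Let scaleD a b s :
  tens_rel (tens_scale (a + b) s) (tens_scale a s ++ tens_scale b s).
Proof.
elim: s => [|p s IH]; first exact: tens_refl.
pose A := [:: (a *: p.1, p.2)]; pose B := [:: (b *: p.1, p.2)].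
pose Sa := tens_scale a s; pose Sb := tens_scale b s.
have h1 : tens_rel ([:: ((a + b) *: p.1, p.2)] ++ tens_scale (a + b) s)
    ((A ++ B) ++ (Sa ++ Sb)).
  by apply: tens_cat => //; rewrite scalerDl; exact: tens_Dl.
apply: tens_trans h1 _; suff : tens_rel ((A ++ B) ++ (Sa ++ Sb))
  ((A ++ Sa) ++ (B ++ Sb)) by [].
rewrite -!catA; apply: tens_cat; first exact: tens_refl.
by rewrite !catA; apply: tens_cat; [exact: tens_comm|exact: tens_refl].
Qed.

Let addA : associative add.
Proof.
by move=> x y z; rewrite -[x]piK -[y]piK -[z]piK !addE catA.
Qed.
Let addC : commutative add.
Proof. by move=> x y; apply: piP; exact: tens_comm. Qed.
Let add0 : left_id zer add.
Proof. by move=> x; rewrite -[x]piK addE. Qed.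
Let addN : left_inverse zer opp add.
Proof.
move=> x; rewrite -[x]piK -[opp _]/(sc (-1) _) scE addE; apply: piP.
rewrite -[X in _ ++ X](_ : tens_scale 1 (repr x) = _); last first.
  rewrite /tens_scale -[RHS]map_id; apply: eq_map => -[v w] /=.
  by rewrite scale1r.
apply: tens_trans (tens_sym (scaleD _ _ _)) _.
by rewrite addNr; exact: scale0.
Qed.
HB.instance Definition _ :=
  GRing.isZmodule.Build tensor addA addC add0 addN.

Let scA a b x : sc a (sc b x) = sc (a * b) x.
Proof.
rewrite -[x]piK !scE /tens_scale -map_comp; congr pi.
by apply: eq_map => p /=; rewrite scalerA.
Qed.
Let sc1 : left_id 1 sc.
Proof.
move=> x; rewrite -[x]piK scE; congr pi; rewrite /tens_scale -[RHS]map_id.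
by apply: eq_map => -[v w] /=; rewrite scale1r.
Qed.
Let scDr : right_distributive sc +%R.
Proof.
move=> a x y; rewrite -[x]piK -[y]piK.
by rewrite -![_ + _]/(add _ _) !(addE, scE) /tens_scale map_cat.
Qed.
Let scDl x : {morph sc^~ x : a b / a + b}.
Proof.
move=> a b; rewrite -[x]piK.
by rewrite -![_ + _ in RHS]/(add _ _) !(addE, scE); apply: piP; exact: scaleD.
Qed.
HB.instance Definition _ :=
  GRing.Zmodule_isLmodule.Build L tensor scA sc1 scDr scDl.

Definition tens (v : V) (w : W) : tensor := \pi [:: (v, w)].

Lemma tens_sum (x : tensor) : x = \sum_(p <- repr x) tens p.1 p.2.
Proof.
rewrite -{1}[x]piK; elim: (repr x) => [|p s IH]; first by rewrite big_nil.
by rewrite big_cons -IH -[RHS]/(add _ _) addE /= -surjective_pairing.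
Qed.

Lemma tens_is_Dl w : {morph tens^~ w : v v' / v + v'}.
Proof.
by move=> v v'; rewrite -[RHS]/(add _ _) addE; apply: piP; exact: tens_Dl.
Qed.
Lemma tens_is_Dr v : {morph tens v : w w' / w + w'}.
Proof.
by move=> w w'; rewrite -[RHS]/(add _ _) addE; apply: piP; exact: tens_Dr.
Qed.
Lemma tens_is_Zl w a v : tens (a *: v) w = a *: tens v w.
Proof. by rewrite -[RHS]/(sc _ _) scE. Qed.
Lemma tens_is_Zr v a w : tens v (a *: w) = a *: tens v w.
Proof. by rewrite -tens_is_Zl; apply/esym/piP; exact: tens_Z. Qed.

Variable Z : lmodType L.
Definition tens_lift (f : V -> W -> Z) (x : tensor) : Z :=
  \sum_(p <- repr x) f p.1 p.2.
Variable f : V -> W -> Z.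
Hypothesis fl : forall w, linear (f^~ w).
Hypothesis fr : forall v, linear (f v).

Let ffl w : {linear V -> Z} :=
  HB.pack (f^~ w) (GRing.isLinear.Build _ _ _ _ _ (fl w)).
Let ffr v : {linear W -> Z} :=
  HB.pack (f v) (GRing.isLinear.Build _ _ _ _ _ (fr v)).

Let fZl a v w : f (a *: v) w = a *: f v w.
Proof. exact: (linearZ_LR (ffl w)). Qed.
Let fZr v a w : f v (a *: w) = a *: f v w.
Proof. exact: (linearZ_LR (ffr v)). Qed.

Let lift_rel s t : tens_rel s t ->
  \sum_(p <- s) f p.1 p.2 = \sum_(p <- t) f p.1 p.2.
Proof.
elim => {s t} //=.
- by move=> s t u _ -> _ ->.
- by move=> s s' t t' _ h1 _ h2; rewrite !big_cat /= h1 h2.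
- by move=> s t; rewrite !big_cat /= addrC.
- move=> v v' w; rewrite !big_cons !big_nil /= !addr0.
  exact: (raddfD (ffl w)).
- move=> v w w'; rewrite !big_cons !big_nil /= !addr0.
  exact: (raddfD (ffr v)).
- move=> a v w; rewrite !big_cons !big_nil /= !addr0.
  by rewrite fZl fZr.
- move=> w; rewrite !big_cons !big_nil /= !addr0.
  exact: (raddf0 (ffl w)).
Qed.

Lemma tens_liftE v w : tens_lift f (tens v w) = f v w.
Proof.
by rewrite /tens_lift (lift_rel (reprP _)) big_cons big_nil addr0.
Qed.

Lemma tens_lift_linear : linear (tens_lift f).
Proof.
move=> a x y; rewrite -[x]piK -[y]piK.
rewrite -[a *: _]/(sc _ _) -[_ + _]/(add _ _) scE addE.
rewrite /tens_lift !(lift_rel (reprP _)) big_cat /=; congr (_ + _).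
rewrite big_map scaler_sumr; apply: eq_bigr => p _ /=.
by rewrite fZl.
Qed.
End tensor.

Lemma tens_ext (L : fieldType) (V W Z : lmodType L) (f g : tensor V W -> Z) :
  linear f -> linear g -> (forall v w, f (tens v w) = g (tens v w)) -> f =1 g.
Proof.
move=> fl gl fg x.
pose F : {linear _ -> _} := HB.pack f (GRing.isLinear.Build _ _ _ _ _ fl).
pose G : {linear _ -> _} := HB.pack g (GRing.isLinear.Build _ _ _ _ _ gl).
rewrite (tens_sum x); transitivity (\sum_(p <- repr x) f (tens p.1 p.2)).
  exact: (raddf_sum F).
rewrite (eq_bigr _ (fun p _ => fg p.1 p.2)).
exact/esym/(raddf_sum G).
Qed.

Definition tens_map (L : fieldType) (V V' W W' : lmodType L)
    (f : V -> V') (g : W -> W') : tensor V W -> tensor V' W' :=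
  tens_lift (fun v w => tens (f v) (g w)).

Definition is_basis (L : fieldType) (V : lmodType L) (n : nat)
    (e : 'I_n -> V) :=
  forall v, exists! a : {ffun 'I_n -> L}, v = \sum_i a i *: e i.

Section basis.
Variables (L : fieldType) (V : lmodType L) (n : nat) (e : 'I_n -> V).
Hypothesis he : is_basis e.

Definition basis_coord (v : V) : {ffun 'I_n -> L} := sval (cid (he v)).

Lemma basis_coordE v : v = \sum_i basis_coord v i *: e i.
Proof. exact: (proj1 (svalP (cid (he v)))). Qed.

Lemma basis_coord_unique v (a : {ffun 'I_n -> L}) :
  v = \sum_i a i *: e i -> basis_coord v = a.
Proof. exact: (proj2 (svalP (cid (he v))) a). Qed.

Lemma basis_coord_linear i : linear (fun v => basis_coord v i : L^o).
Proof.
move=> c u v /=.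
rewrite (@basis_coord_unique _
  [ffun i => c * basis_coord u i + basis_coord v i]).
  by rewrite ffunE.
rewrite [in LHS](basis_coordE u) [in LHS](basis_coordE v) scaler_sumr.
rewrite -big_split /=; apply: eq_bigr => j _.
by rewrite ffunE scalerDl scalerA.
Qed.

Variable W : lmodType L.
Definition tens_coord (x : tensor V W) (i : 'I_n) : W :=
  tens_lift (fun v w => basis_coord v i *: w) x.

Let bl i (w : W) : linear (fun v => basis_coord v i *: w).
Proof. by move=> c u v; rewrite basis_coord_linear scalerDl -scalerA. Qed.
Let br i (v : V) : linear (fun w : W => basis_coord v i *: w).
Proof. by move=> c u w; rewrite scalerDr !scalerA mulrC. Qed.

Lemma tens_coordE v w i : tens_coord (tens v w) i = basis_coord v i *: w.
Proof. by rewrite /tens_coord tens_liftE. Qed.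

Lemma tens_coord_linear i : linear (tens_coord ^~ i).
Proof. exact: tens_lift_linear. Qed.

Definition tens_sumb (y : 'I_n -> W) : tensor V W := \sum_i tens (e i) (y i).

Lemma tens_sumbK y : tens_coord (tens_sumb y) = y.
Proof.
apply/funext => i.
pose F : {linear _ -> _} :=
  HB.pack (tens_coord ^~ i)
    (GRing.isLinear.Build _ _ _ _ _ (tens_coord_linear i)).
transitivity (\sum_j tens_coord (tens (e j) (y j)) i).
  exact: (raddf_sum F).
rewrite (bigD1 i) //= big1 ?addr0 => [|j ji]; rewrite tens_coordE.
  rewrite (@basis_coord_unique _ [ffun k => (k == i)%:R]) ?ffunE ?eqxx
    ?scale1r//.
  rewrite (bigD1 i) //= ffunE eqxx scale1r big1 ?addr0// => k ki.
  by rewrite ffunE (negbTE ki) scale0r.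
rewrite (@basis_coord_unique _ [ffun k => (k == j)%:R]).
  by rewrite ffunE eq_sym (negbTE ji) scale0r.
rewrite (bigD1 j) //= ffunE eqxx scale1r big1 ?addr0// => k ki.
by rewrite ffunE (negbTE ki) scale0r.
Qed.

Lemma tens_coordK x : tens_sumb (tens_coord x) = x.
Proof.
apply: (@tens_ext _ _ _ _ (fun x => tens_sumb (tens_coord x)) id) => //.
  move=> c u v; rewrite /tens_sumb scaler_sumr -big_split /=.
  by apply: eq_bigr => i _; rewrite tens_coord_linear tens_is_Dr tens_is_Zr.
move=> v w; rewrite [in RHS](basis_coordE v) /tens_sumb.
under eq_bigr do rewrite tens_coordE tens_is_Zr -tens_is_Zl.
elim/big_rec2: _ => [|i x1 x2 _ ->]; last by rewrite tens_is_Dl.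
by rewrite -(scale0r (0 : V)) tens_is_Zl scale0r.
Qed.
End basis.
Arguments tens_coord {L V n e} he {W} x i.
Arguments tens_sumb {L V n} e {W} y.

Section topology.
Variables (L : numFieldType) (V : lmodType L) (n : nat) (e : 'I_n -> V).
Variables (he : is_basis e) (W : tvsType L).

(* The topology for which tens_sumb e : W^n -> tensor V W is a homeomorphism, *)
(* see tensorT_homeo.                                                         *)
Definition tensorT : Type :=
  initial_topology (tens_coord he : tensor V W -> {ptws 'I_n -> W}).
HB.instance Definition _ := Uniform.on tensorT.
HB.instance Definition _ := GRing.Lmodule.copy tensorT (tensor V W).

Let coordc i : continuous (fun x : tensorT => tens_coord he x i).
Proof.
move=> x U nU.
exact: (@initial_continuous _ _
  (tens_coord he : tensor V W -> {ptws 'I_n -> W}) x _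
  (@proj_continuous _ (fun=> W) i (tens_coord he x) U nU)).
Qed.

Let to_tensor (T : topologicalType) (f : T -> tensorT) :
  (forall i, continuous (fun t => tens_coord he (f t) i)) -> continuous f.
Proof.
move=> fc; apply: continuous_comp_initial.
move=> t; apply/cvg_sup => i D /=.
rewrite (@nbhsE (initial_topology (fun g : 'I_n -> W => g i))).
move=> -[B [[C oC <-] Cp] BV].
have := fc i t C (open_nbhs_nbhs (conj oC Cp)).
suff h : (fun z => tens_coord he (f z) i) @^-1` C `<=`
    (fun z => tens_coord he (f z)) @^-1` D by move/(filterS h).
by move=> z Cz; exact: BV.
Qed.

Let coordD i : {morph (fun x : tensorT => tens_coord he x i) : x y / x + y}.
Proof.
by move=> x y; have := tens_coord_linear he i 1 x y; rewrite !scale1r.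
Qed.

Let coordZ i a (x : tensorT) :
  tens_coord he (a *: x) i = a *: tens_coord he x i.
Proof.
have c0 : tens_coord he 0 i = 0 :> W.
  by have := tens_coord_linear he (W := W) i (-1) 0 0; rewrite !scaleN1r !addNr.
by have := tens_coord_linear he i a x 0; rewrite c0 !addr0.
Qed.

Let addc : continuous (fun x : tensorT * tensorT => x.1 + x.2).
Proof.
apply: to_tensor => i; under [X in continuous X]funext do rewrite coordD.
move=> [x y] U nU.
have [B [B1 B2] BU] :=
  @add_continuous W (tens_coord he x i, tens_coord he y i) U nU.
exists ((fun z : tensorT => tens_coord he z i) @^-1` B.1,
        (fun z : tensorT => tens_coord he z i) @^-1` B.2).
  by split; exact: coordc.
by move=> [b w] /= [Bb Bw]; exact: (BU (_, _)).
Qed.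

Let scalec : continuous (fun z : L^o * tensorT => z.1 *: z.2).
Proof.
apply: to_tensor => i; under [X in continuous X]funext do rewrite coordZ.
move=> [a x] U nU.
have [B [B1 B2] BU] := @scale_continuous _ W (a, tens_coord he x i) U nU.
exists (B.1, (fun z : tensorT => tens_coord he z i) @^-1` B.2).
  by split => //; exact: coordc.
by move=> [b w] /= [Bb Bw]; exact: (BU (_, _)).
Qed.

Let ptws_box (p : {ptws 'I_n -> W}) (U : set {ptws 'I_n -> W}) : nbhs p U ->
  exists A : 'I_n -> set W, (forall i, nbhs (p i : W) (A i)) /\
    (forall y, (forall i, A i (y i)) -> U y).
Proof.
pose F : set_system {ptws 'I_n -> W} := fun U =>
  exists A : 'I_n -> set W, (forall i, nbhs (p i : W) (A i)) /\
    (forall y, (forall i, A i (y i)) -> U y).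
have FF : Filter F.
  split.
  - by exists (fun=> setT); split => // i; exact: filterT.
  - move=> P Q [A [Ap AP]] [B [Bp BQ]]; exists (fun i => A i `&` B i); split.
      by move=> i; exact: filterI.
    by move=> y ABy; split; [apply: AP|apply: BQ] => i; case: (ABy i).
  - by move=> P Q PQ [A [Ap AP]]; exists A; split => // y /AP /PQ.
suff : F --> p by apply.
apply/cvg_sup => i D /=.
rewrite (@nbhsE (initial_topology (fun g : 'I_n -> W => g i))).
move=> -[B [[C oC <-] Cp] BV].
exists (dfwith (fun=> setT) i C); split => [j|y yA].
  have [<-|ij] := eqVneq i j.
    by rewrite dfwithin; exact: (open_nbhs_nbhs (conj oC Cp)).
  by rewrite dfwithout //; exact: filterT.
by apply: BV; have := yA i; rewrite dfwithin.
Qed.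

Let convexW : exists2 B : set_system tensorT,
  (forall b, b \in B -> convex_set b) & basis B.
Proof.
have [B Bc [Bo Bb]] := @locally_convex _ W.
exists [set b | open b /\ convex_set (b : set (convex_lmodType tensorT))].
  by move=> b /[!inE] -[].
split; first by move=> b [].
move=> x U; rewrite nbhsE => -[O [[C oC <-] Cx] OU].
have [A [Ax AC]] := @ptws_box _ _ (open_nbhs_nbhs (conj oC Cx)).
have /choice[D DP] i :
    exists D : set W, [/\ B D, D (tens_coord he x i) & D `<=` A i].
  by have [D [BD Dx] DA] := Bb _ _ (Ax i); exists D.
exists [set y | forall i, D i (tens_coord he y i)]; last first.
  by move=> y /= yD; apply/OU/AC => i; have [_ _] := DP i; apply; exact: yD.
split=> /=; last by move=> i; have [] := DP i.
split.
  rewrite openE => y yD.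
  have h i : nbhs (y : tensorT)
      ((fun x : tensorT => tens_coord he x i) @^-1` D i).
    apply: coordc.
    by apply: open_nbhs_nbhs; split; [have [/Bo] := DP i|exact: yD].
  exact: (@filter_forall _ _ _ (nbhs (y : tensorT)) _ h).
move=> y z l /[!inE] yD zD i.
have [BD _ _] := DP i; have /Bc bc : D i \in B by rewrite inE.
have := bc (tens_coord he y i) (tens_coord he z i) l
  (mem_set (yD i)) (mem_set (zD i)).
rewrite inE /conv /= => h.
by rewrite /= coordD !coordZ.
Qed.

HB.instance Definition _ :=
  PreTopologicalNmodule_isTopologicalNmodule.Build tensorT addc.
HB.instance Definition _ :=
  TopologicalNmodule_isTopologicalLmodule.Build L tensorT scalec.
HB.instance Definition _ := Uniform_isTvs.Build L tensorT convexW.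

Lemma tensorT_homeo :
  [/\ continuous (tens_sumb e : {ptws 'I_n -> W} -> tensorT),
      continuous (tens_coord he : tensorT -> {ptws 'I_n -> W}),
      cancel (tens_sumb e) (tens_coord he : tensorT -> {ptws 'I_n -> W})
    & cancel (tens_coord he : tensorT -> {ptws 'I_n -> W}) (tens_sumb e)].
Proof.
split; last 2 first.
- exact: tens_sumbK.
- exact: tens_coordK.
- apply: to_tensor => i; under [X in continuous X]funext do rewrite tens_sumbK.
  exact: proj_continuous.
- exact: initial_continuous.
Qed.
End topology.

Section calculus.
Variables (K : numFieldType) (X H : tvsType K).
Implicit Types (f : X -> H) (U : set X).

Definition is_dirder f (x y : X) (l : H) :=
  (t^-1 *: (f (x + t *: y) - f x) @[t --> (0 : K)^']) --> l.

Definition dirder (y : X) f (x : X) : H := xget 0 [set l | is_dirder f x y l].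

(* iterD f [:: y1; ...; yj] = D_yj (... (D_y1 f)). *)
Definition iterD f (ys : seq X) : X -> H := foldl (fun g y => dirder y g) f ys.

Definition Cfin (n : nat) U f :=
  [/\ open U,
      {within U, continuous f},
      (forall ys y x, (size ys < n)%N -> U x ->
        exists l, is_dirder (iterD f ys) x y l)
    & forall j, (0 < j <= n)%N -> {within U `*` setT, continuous
        (fun p : X * {ptws 'I_j -> X} =>
           iterD f [seq p.2 i | i <- enum 'I_j] p.1)}].

Definition multilinear (n : nat) (b : ('I_n -> X) -> H) :=
  forall (y : 'I_n -> X) (i : 'I_n) (a : K) (u v : X),
    b (dfwith y i (a *: u + v)) = a *: b (dfwith y i u) + b (dfwith y i v).

Definition homogeneous_polynomial (n : nat) (p : X -> H) :=
  exists2 b : ('I_n -> X) -> H, multilinear b & forall x, p x = b (fun=> x).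

Definition analytic_series U f :=
  [/\ open U,
      {within U, continuous f}
    & forall x, U x -> exists (p : nat -> X -> H) (V : set X),
        [/\ forall k, continuous (p k) /\ homogeneous_polynomial k (p k),
            nbhs 0 V
          & forall y, V y -> U (x + y) /\
              (\sum_(k < N) p k y @[N --> \oo]) --> f (x + y)]].

End calculus.

Definition real_analytic (R : realType) (X H : tvsType R) (U : set X)
    (f : X -> H) :=
  open U /\ exists (V : set (cplx X)) (g : cplx X -> cplx H),
    [/\ forall x, U x -> V (cplx_incl x),
        analytic_series V g
      & forall x, U x -> g (cplx_incl x) = cplx_incl (f x)].

Variant smoothness := Fin of nat | Infty | Omega.

Definition smooth_le (r s : smoothness) : bool :=
  match r, s with
  | Fin m, Fin n => (m <= n)%N
  | Fin _, _ => true
  | Infty, Fin _ => false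
  | Infty, _ => true
  | Omega, Omega => true
  | Omega, _ => false
  end.

(* f is a C^r_K-map on the open set U; the values of f outside U are          *)
(* irrelevant. Note that openness of U is part of the predicate.              *)
Definition Cr (R : realType) (k : scalar) (r : smoothness) :
    forall X H : tvsType (Fld R k), set X -> (X -> H) -> Prop :=
  match r with
  | Fin n => fun X H U f => Cfin n U f
  | Infty => fun X H U f => forall n, Cfin n U f
  | Omega =>
      match k return forall X H : tvsType (Fld R k),
          set X -> (X -> H) -> Prop with
      | ScR => fun X H U f => @real_analytic R X H U f
      | ScC => fun X H U f => @analytic_series R[i] X H U f
      end
  end.

(* A chart is a bijection from cdom c onto an open subset of X; cinv c is its *)
(* inverse, with arbitrary values outside cfun c @` cdom c.                   *)
Record chart (T X : Type) := Chart {
  cdom : set T;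
  cfun : T -> X;
  cinv : X -> T }.

Record atlas (R : realType) (k : scalar) (T : Type) := Atlas {
  model : tvsType (Fld R k);
  charts : set (chart T model) }.
Arguments charts {R k T} a _.

Section manifold.
Variables (R : realType) (k : scalar).
Local Notation atlas := (atlas R k).

(* The topology of a manifold is the one determined by its atlas. *)
Definition atlas_open (T : Type) (A : atlas T) (O : set T) :=
  forall c, charts A c -> open (cfun c @` (cdom c `&` O)).

Definition is_manifold (r : smoothness) (T : Type) (A : atlas T) :=
  [/\ hausdorff_space (model A),
      (forall p, exists2 c, charts A c & cdom c p),
      (forall c p, charts A c -> cdom c p -> cinv c (cfun c p) = p),
      (forall c d, charts A c -> charts A d ->
        Cr r (cfun c @` (cdom c `&` cdom d)) (cfun d \o cinv c))
    & forall p q, p <> q -> exists O O',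
        [/\ atlas_open A O, atlas_open A O', O p, O' q & O `&` O' = set0]].

(* f is C^r on the open set O. As Cr includes the openness of the domain,     *)
(* continuity of f is included too.                                           *)
Definition Crmap (r : smoothness) (T T' : Type) (A : atlas T) (B : atlas T')
    (O : set T) (f : T -> T') :=
  forall c d, charts A c -> charts B d ->
    Cr r (cfun c @` (cdom c `&` O `&` f @^-1` cdom d))
      (cfun d \o f \o cinv c).

Definition Crdiffeo (r : smoothness) (T T' : Type) (A : atlas T) (B : atlas T')
    (O : set T) (O' : set T') (f : T -> T') :=
  exists g : T' -> T,
    [/\ (forall p, O p -> O' (f p) /\ g (f p) = p),
        (forall q, O' q -> O (g q) /\ f (g q) = q),
        Crmap r A B O f
      & Crmap r B A O' g].

Definition prod_chart (T T' X X' : Type) (c : chart T X) (d : chart T' X') :=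
  Chart (cdom c `*` cdom d) (fun p => (cfun c p.1, cfun d p.2))
    (fun z => (cinv c z.1, cinv d z.2)).

Definition prod_atlas (T T' : Type) (A : atlas T) (B : atlas T') :
    atlas (T * T') :=
  @Atlas R k (T * T') (model A * model B)%type
    [set e | exists c d,
      [/\ charts A c, charts B d & e = prod_chart c d]].

Definition lcs_atlas (X : tvsType (Fld R k)) : atlas X :=
  @Atlas R k X X [set Chart setT id id].

Definition lie_group (s : smoothness) (G : groupType) (A : atlas G) :=
  [/\ is_manifold s A,
      Crmap s (prod_atlas A A) A setT (fun p => p.1 * p.2)%g
    & Crmap s A A setT (fun g => g^-1)%g].

Definition is_left_action (G : groupType) (T : Type) (a : G -> T -> T) :=
  (forall x, a 1%g x = x) /\ (forall g h x, a (g * h)%g x = a g (a h x)).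

Definition G_manifold (r : smoothness) (G : groupType) (aG : atlas G)
    (M : Type) (aM : atlas M) (alpha : G -> M -> M) :=
  [/\ is_manifold r aM, is_left_action alpha
    & Crmap r (prod_atlas aG aM) aM setT (fun p => alpha p.1 p.2)].

End manifold.

(* A bundle over M is given by its fibres E x, x : M; the underlying set is   *)
(* their disjoint union and the projection is tag.                            *)
Definition total_space (L : numFieldType) (M : Type)
    (E : M -> lmodType L) : Type :=
  {x : M & E x}.

Section bundle.
Variables (R : realType) (c : scalars).
Local Notation K := (baseK c).
Local Notation L := (Fld R (fibK c)).
Variables (r : smoothness) (M : Type) (aM : atlas R K M).
Variables (F : tvsType L) (E : M -> lmodType L).
Variable aE : atlas R K (total_space E).

Definition local_triv (U : set M) (psi : total_space E -> M * F) :=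
  [/\ atlas_open aM U,
      Crdiffeo r aE (prod_atlas aM (lcs_atlas (restr F)))
        (@tag M E @^-1` U) (U `*` setT) psi,
      (forall y, U y -> psi @` (@tag M E @^-1` [set y]) = [set y] `*` setT)
    & forall y, U y -> linear (fun v : E y => (psi (Tagged E v)).2)].

Definition vector_bundle :=
  [/\ hausdorff_space F,
      is_manifold r aE,
      range (@tag M E) = setT,
      Crmap r aE aM setT (@tag M E)
    & forall x, exists U psi, U x /\ local_triv U psi].

Variables (G : groupType) (aG : atlas R K G) (alpha : G -> M -> M).

(* The family beta of maps E x -> E (alpha g x) encodes a map G * E -> E that *)
(* sends E x into E (alpha g x).                                              *)
Definition total_action (beta : forall g x, E x -> E (alpha g x)) (g : G)
    (v : total_space E) : total_space E := Tagged E (beta g (tag v) (tagged v)).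

Definition equivariant_bundle (beta : forall g x, E x -> E (alpha g x)) :=
  [/\ vector_bundle,
      is_left_action (total_action beta),
      Crmap r (prod_atlas aG aE) aE setT (fun p => total_action beta p.1 p.2)
    & forall g x, linear (beta g x)].

End bundle.

Section tensor_bundle.
Variables (L : numFieldType) (M : Type) (E1 E2 : M -> lmodType L).

Definition tens_fibre (x : M) : lmodType L := tensor (E1 x) (E2 x).

Definition tens_triv (F1 F2 : tvsType L) (n : nat) (e : 'I_n -> F1)
    (he : is_basis e)
    (psi1 : total_space E1 -> M * F1) (psi2 : total_space E2 -> M * F2)
    (v : total_space tens_fibre) : M * tensorT he F2 :=
  (tag v, tens_map (fun a => (psi1 (Tagged E1 a)).2)
                   (fun b => (psi2 (Tagged E2 b)).2) (tagged v)).

Definition tens_action (G : Type) (alpha : G -> M -> M)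
    (beta1 : forall g x, E1 x -> E1 (alpha g x))
    (beta2 : forall g x, E2 x -> E2 (alpha g x)) (g : G) (x : M) :
    tens_fibre x -> tens_fibre (alpha g x) :=
  tens_map (beta1 g x) (beta2 g x).

End tensor_bundle.

(* Main.v *)
Require Import Defs.
From HB Require Import structures.
From mathcomp Require Import all_boot all_order all_algebra.
From mathcomp Require Import monoid generic_quotient.
From mathcomp Require Import all_classical all_reals topology.
From mathcomp Require Import normedtype convex interval_inference.
From mathcomp Require Import ssrAC sequences complex ring lra.
Set Implicit Arguments.
Unset Strict Implicit.
Unset Printing Implicit Defensive.
Import Order.TTheory GRing.Theory Num.Theory.
Import numFieldTopology.Exports numFieldNormedType.Exports.
Local Open Scope classical_set_scope.
Local Open Scope ring_scope.

(** In local trivializations every structure map of the tensor product bundle has the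
form (p, w) |-> (B1 p (x) B2 p) w with B1, B2 linear in the second variable and such
that (p, v) |-> B_i p v is C^r. On the basis e this is the sum over i of
B1 p e_i (x) B2 p w_i, where the w_i are the coordinates of w, and both the coordinates
and (x) are continuous (multi)linear because the coordinate functionals of a
finite-dimensional Hausdorff space are continuous. With p = x this gives the atlas and
its compatibility with all trivializations, with p = (g, x) the action.

This needs C^r-maps to be stable under composition, pairing, continuous bilinear maps
and gluing. For finite r one passes from Keller's iterated directional derivatives to
the recursive form "df is C^(r-1)". Over C, analytic maps are the same as C^infinity
maps; in both directions Cauchy's integrals are replaced by averages over roots of
unity, which require no integration in spaces that need not be complete. Real analytic
maps are handled through their complex extensions, which glue because they are
determined by their values at real points. *)

(** * Scalars and continuous seminorms *)

(** An average over the powers of a primitive root of unity w is not exactly a Cauchy integral. What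
    it shares with one is that multiplication by w permutes the sample points: averaging a Taylor
    expansion between z and w z cancels the terms of order 0, and the quadratic remainder, divided
    by w - 1, leaves an error of size |w - 1|. Hence the need for roots of unity arbitrarily close
    to 1. In the opposite direction, from power series to derivatives, the averages are exact,
    because n-th roots of unity extract the coefficients of a polynomial of degree less than n
    without error. All estimates concern finite sums and one continuous seminorm at a time. On the
    geometric side, a fibre carries no topology of its own, and the action maps one fibre to
    another. Smoothness can therefore be tested only after trivializing at the source and at the
    target, over open sets that differ; this forces a pointwise notion of C^r-map that is
    independent of charts. *)

Section scalars.
Variables (R : realType) (k : Defs.scalar).
Local Notation K := (Fld R k).

Definition ofR : {rmorphism R -> K} :=
  match k return {rmorphism R -> Fld R k} with
  | ScR => idfun : {rmorphism R -> R}
  | ScC => real_complex R : {rmorphism R -> R[i]}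
  end.

(* Norms in R[i] are themselves complex numbers; nrm is the absolute value as an
   element of R, where all estimates take place. *)
Definition nrm : K -> R :=
  match k return Fld R k -> R with
  | ScR => fun a => `|a|
  | ScC => fun a => complex.Re `|a|
  end.

Lemma nrmE (a : K) : `|a| = ofR (nrm a).
Proof. by rewrite /nrm /ofR; case: k a. Qed.

Lemma ofR_le : {mono ofR : a b / a <= b}.
Proof. by rewrite /ofR; case: k => //= a b; rewrite lecR. Qed.

Lemma ofR_lt : {mono ofR : a b / a < b}.
Proof. by rewrite /ofR; case: k => //= a b; rewrite ltcR. Qed.

Lemma ofR_inj : injective ofR.
Proof. exact: fmorph_inj. Qed.

Lemma nrm_ge0 a : 0 <= nrm a.
Proof. by rewrite -ofR_le rmorph0 -nrmE. Qed.

Lemma nrmM a b : nrm (a * b) = nrm a * nrm b.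
Proof. by apply: ofR_inj; rewrite rmorphM -!nrmE normrM. Qed.

Lemma nrm1 : nrm 1 = 1.
Proof. by apply: ofR_inj; rewrite -nrmE normr1 rmorph1. Qed.

Lemma nrm0 : nrm 0 = 0.
Proof. by apply: ofR_inj; rewrite -nrmE normr0 rmorph0. Qed.

Lemma nrmN a : nrm (- a) = nrm a.
Proof. by apply: ofR_inj; rewrite -!nrmE normrN. Qed.

Lemma nrmB a b : nrm (a - b) = nrm (b - a).
Proof. by rewrite -nrmN opprB. Qed.

Lemma nrmV a : nrm a^-1 = (nrm a)^-1.
Proof. by apply: ofR_inj; rewrite fmorphV -!nrmE normfV. Qed.

Lemma nrmX a n : nrm (a ^+ n) = nrm a ^+ n.
Proof. by apply: ofR_inj; rewrite rmorphXn -!nrmE normrX. Qed.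

Lemma nrmD a b : nrm (a + b) <= nrm a + nrm b.
Proof. by rewrite -ofR_le rmorphD -!nrmE ler_normD. Qed.

Lemma nrm_eq0 a : (nrm a == 0) = (a == 0).
Proof. by rewrite -(inj_eq ofR_inj) -nrmE rmorph0 normr_eq0. Qed.

Lemma nrm_gt0 a : (0 < nrm a) = (a != 0).
Proof. by rewrite lt_def nrm_ge0 andbT nrm_eq0. Qed.

Lemma nrm_ofR t : nrm (ofR t) = `|t|.
Proof.
apply: ofR_inj; rewrite -nrmE; case: (leP 0 t) => t0.
  by rewrite !ger0_norm // -(rmorph0 ofR) ofR_le.
by rewrite !ltr0_norm ?rmorphN // -(rmorph0 ofR) ofR_lt.
Qed.

Lemma nrm_nat n : nrm n%:R = n%:R.
Proof. by rewrite -(rmorph_nat ofR) nrm_ofR ger0_norm. Qed.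

Lemma nbhs_nrm (x : K) (U : set K) :
  nbhs x U <-> exists2 e : R, 0 < e & forall y, nrm (y - x) < e -> U y.
Proof.
split=> [[e /= e0 eU]|[e e0 eU]]; last first.
  exists (ofR e) => /=; first by rewrite -(rmorph0 ofR) ofR_lt.
  by move=> y /=; rewrite nrmE ofR_lt nrmB; exact: eU.
exists (nrm e); first by rewrite nrm_gt0 gt_eqF.
move=> y yx; apply: eU => /=.
by rewrite distrC nrmE -(gtr0_norm e0) nrmE ofR_lt.
Qed.

Lemma near_nrm (e : R) : 0 < e -> \forall t \near (0 : K), nrm t < e.
Proof. by move=> e0; apply/nbhs_nrm; exists e => // y; rewrite subr0. Qed.

Lemma ofR_continuous : continuous ofR.
Proof.
move=> x U /nbhs_nrm[e e0 eU]; exists e => //= y yx.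
by apply: eU; rewrite -rmorphB nrm_ofR distrC.
Qed.

Lemma nrm_continuous : continuous nrm.
Proof.
move=> x; apply/(@cvgrPdist_lt _ _ _ (nbhs x) (nbhs_filter x)) => e e0.
apply/nbhs_nrm; exists e => // y yx.
apply: le_lt_trans yx; rewrite ler_norml; apply/andP; split.
  by rewrite lerBrDl lerBlDr; apply: le_trans (nrmD _ _); rewrite addrC subrK.
by rewrite lerBlDr nrmB; apply: le_trans (nrmD _ _); rewrite subrK.
Qed.

End scalars.
Arguments ofR {R k}.

Section seminorms.
Variables (R : realType) (k : Defs.scalar).
Local Notation K := (Fld R k).

(** Values are taken in R for both fields, so that estimates are real arithmetic. The third
    condition is continuity at 0; the other two spread it to every point ([csemi_continuous]). *)
Definition csemi (V : tvsType K) (q : V -> R) :=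
  [/\ forall x y, q (x + y) <= q x + q y,
      forall a x, q (a *: x) = nrm a * q x
    & nbhs 0 [set x | q x < 1]].

Section csemi_theory.
Variables (V : tvsType K) (q : V -> R).
Hypothesis hq : csemi q.

Lemma csemiD x y : q (x + y) <= q x + q y. Proof. by case: hq. Qed.
Lemma csemiZ a x : q (a *: x) = nrm a * q x. Proof. by case: hq. Qed.
Lemma csemi0 : q 0 = 0.
Proof. by rewrite -(scale0r 0) csemiZ nrm0 mul0r. Qed.
Lemma csemiN x : q (- x) = q x.
Proof. by rewrite -scaleN1r csemiZ nrmN nrm1 mul1r. Qed.
Lemma csemiB x y : q (x - y) = q (y - x).
Proof. by rewrite -csemiN opprB. Qed.
Lemma csemi_ge0 x : 0 <= q x.
Proof.
have := csemiD x (- x); rewrite subrr csemi0 csemiN; lra.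
Qed.
Lemma csemi_sum (I : Type) (r : seq I) (P : pred I) (f : I -> V) :
  q (\sum_(i <- r | P i) f i) <= \sum_(i <- r | P i) q (f i).
Proof.
elim/big_rec2: _ => [|i y x _ xy]; first by rewrite csemi0.
by apply: le_trans (csemiD _ _) _; rewrite lerD2l.
Qed.
Lemma csemi_dist x y z : q (x - z) <= q (x - y) + q (y - z).
Proof. by apply: le_trans (csemiD _ _); rewrite addrA subrK. Qed.
Lemma csemi_lip x y : `|q x - q y| <= q (x - y).
Proof.
have := csemiD (x - y) y; have := csemiD (y - x) x.
by rewrite !subrK csemiB ler_norml; lra.
Qed.

Lemma csemi_nbhs0 e : 0 < e -> nbhs 0 [set x | q x < e].
Proof.
move=> e0; have [_ _ q1] := hq.
have e0' : (ofR e : K) != 0 by rewrite fmorph_eq0 gt_eqF.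
have := nbhs0Z e0' q1.
apply: filterS => _ [y /= y1 <-].
by rewrite csemiZ nrm_ofR gtr0_norm // -[ltRHS]mulr1 ltr_pM2l.
Qed.

Lemma csemi_nbhs e x : 0 < e -> nbhs x [set y | q (y - x) < e].
Proof.
move=> e0; have := nbhsT x (csemi_nbhs0 e0).
by apply: filterS => _ [z /= zq <-]; rewrite addrAC subrr add0r.
Qed.

Lemma csemi_continuous : continuous q.
Proof.
move=> x; apply/cvgrPdist_lt => e e0.
have := csemi_nbhs x e0; apply: filterS => y /= yx.
by rewrite distrC; apply: le_lt_trans yx; exact: csemi_lip.
Qed.
End csemi_theory.

Variable V : tvsType K.

Lemma csemi_add (p q : V -> R) : csemi p -> csemi q -> csemi (fun x => p x + q x).
Proof.
move=> hp hq; split=> [x y|a x|].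
- by rewrite addrACA lerD // csemiD.
- by rewrite !csemiZ // mulrDr.
- have h2 : (0 : R) < 2^-1 by rewrite invr_gt0.
  apply: filterS2 (csemi_nbhs0 hp h2) (csemi_nbhs0 hq h2) => x /= px qx.
  lra.
Qed.

Lemma balanced_convex_nbhd (U : set V) : nbhs 0 U ->
  exists B : set V, [/\ nbhs 0 B, B `<=` U,
    forall a x, nrm a <= 1 -> B x -> B (a *: x)
  & forall (s t : R) x y, 0 <= s -> 0 <= t -> s + t = 1 ->
      B x -> B y -> B (ofR s *: x + ofR t *: y)].
Proof.
move=> U0; have [Bs Bc [Bo Bb]] := @locally_convex _ V.
have [B0 [BsB B00] BU] := Bb _ _ U0.
have nB0 : nbhs 0 B0 by apply: open_nbhs_nbhs; split => //; exact: Bo.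
have B0c s t x y : 0 <= s -> 0 <= t -> s + t = 1 ->
    B0 x -> B0 y -> B0 (ofR s *: x + ofR t *: y).
  move=> s0 t0 st Bx By; have : B0 \in Bs by rewrite inE.
  move=> /Bc bc.
  have i0 : 0 <= (ofR s : K) by rewrite -(rmorph0 ofR) ofR_le.
  have i1 : (ofR s : K) <= 1 by rewrite -(rmorph1 ofR) ofR_le -st lerDl.
  have := bc x y (Itv01 i0 i1) (mem_set Bx) (mem_set By).
  rewrite inE /conv /=.
  by rewrite [unstable.onem _](_ : _ = ofR t) // /unstable.onem -(rmorph1 ofR) -rmorphB -st addrAC subrr add0r.
(* Balanced by construction, convex because [B0] is, and a neighbourhood of 0 by continuity of
   scalar multiplication at (0, 0). *)
exists [set x | forall a, nrm a <= 1 -> B0 (a *: x)]; split.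
- have nB00 : nbhs ((0 : K) *: (0 : V)) B0 by rewrite scaler0.
  have [[A1 A2] /= [nA1 nA2] AB] := @scale_continuous _ V (0, 0) B0 nB00.
  have /nbhs_nrm[e e0 eA] := nA1.
  have e2 : (ofR (e / 2) : K) != 0 by rewrite fmorph_eq0 mulf_neq0 ?gt_eqF // invr_neq0.
  have := nbhs0Z e2 nA2; apply: filterS => _ [y Ay <-] a a1.
  rewrite scalerA; apply: (AB (a * ofR (e / 2), y)); split=> //=; apply: eA.
  rewrite subr0 nrmM nrm_ofR gtr0_norm ?divr_gt0 //.
  apply: (@le_lt_trans _ _ (e / 2)); last by rewrite ltr_pdivrMr // ltr_pMr // ltr1n.
  by rewrite ler_piMl // divr_ge0 // ltW.
- by move=> x /(_ 1); rewrite nrm1 scale1r => /(_ (lexx _)) /BU.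
- move=> a x a1 Bx b b1; rewrite scalerA; apply: Bx.
  by rewrite nrmM mulr_ile1 // nrm_ge0.
- move=> s t x y s0 t0 st Bx By a a1.
  by rewrite scalerDr !scalerA ![a * _]mulrC -!scalerA; apply: B0c => //; [exact: Bx|exact: By].
Qed.

Let gauge (B : set V) (x : V) : R :=
  inf [set t : R | 0 < t /\ B ((ofR t)^-1 *: x)].

(** The seminorm is the Minkowski functional of a balanced convex neighbourhood of 0 inside [U]:
    balancedness gives homogeneity, convexity the triangle inequality, and the neighbourhood
    property makes it finite and continuous at 0. *)
Lemma csemi_ex0 (U : set V) : nbhs 0 U ->
  exists q, csemi q /\ forall y, q y < 1 -> U y.
Proof.
move=> /balanced_convex_nbhd[B [nB BU Bb Bc]].
pose S x := [set t : R | 0 < t /\ B ((ofR t)^-1 *: x)].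
have S0 x : S x !=set0.
  have nB0 : nbhs ((0 : K) *: x) B by rewrite scale0r.
  have [[A1 A2] /= [nA1 nA2] AB] := @scale_continuous _ V (0, x) B nB0.
  have /nbhs_nrm[e e0 eA] := nA1.
  exists (e / 2)^-1; split; first by rewrite invr_gt0 divr_gt0.
  rewrite fmorphV invrK; apply: (AB (_, x)); split=> /=; last exact: nbhs_singleton.
  by apply: eA; rewrite subr0 nrm_ofR gtr0_norm ?divr_gt0 // ltr_pdivrMr // ltr_pMr // ltr1n.
have Slb x : has_lbound (S x) by exists 0 => t [/ltW].
have Sinf x : has_inf (S x) by split.
have SS x t t' : S x t -> t <= t' -> S x t'.
  move=> [t0 Bt] tt'; have t'0 : 0 < t' by exact: lt_le_trans tt'.
  split=> //; rewrite -[x in _ *: x](scale1r x).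
  rewrite -(@mulfV _ (ofR t : K)) ?fmorph_eq0 ?gt_eqF // -scalerA scalerA.
  apply: Bb => //; rewrite -fmorphV -rmorphM nrm_ofR ger0_norm; last first.
    by rewrite mulr_ge0 // ?invr_ge0 ltW.
  by rewrite mulrC ler_pdivrMr ?mul1r.
have glt x e : gauge B x < e -> S x e.
  move=> ge; have e0 : 0 < e - gauge B x by rewrite subr_gt0.
  have [t tS te] := inf_adherent e0 (Sinf x).
  by apply: SS tS _; apply: ltW; rewrite -[ltRHS](subrK (gauge B x)) addrC.
have gle x e : S x e -> gauge B x <= e by move=> Se; exact: (ge_inf (Slb x)).
have g0 x : 0 <= gauge B x by apply: lb_le_inf; [exact: S0|move=> t [/ltW]].
exists (gauge B); split; last first.
  by move=> y /glt [_]; rewrite rmorph1 invr1 scale1r => /BU.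
have gZ a x : gauge B (a *: x) <= nrm a * gauge B x.
  apply/ler_addgt0Pr => e e0.
  pose d := e / (nrm a + 1).
  have a1 : 0 < nrm a + 1 by rewrite ltr_wpDl // nrm_ge0.
  have d0 : 0 < d by rewrite divr_gt0.
  have [t0 Bt] : S x (gauge B x + d) by apply: glt; rewrite ltrDl.
  set t := gauge B x + d in t0 Bt.
  have [->|an] := eqVneq a 0.
    rewrite nrm0 mul0r add0r; apply: gle; split => //.
    by rewrite scale0r scaler0; exact: nbhs_singleton.
  apply: (@le_trans _ _ (nrm a * t)).
    apply: gle; split; first by rewrite mulr_gt0 // nrm_gt0.
    rewrite scalerA rmorphM invfM mulrAC.
    rewrite -scalerA; apply: Bb => //.
    by rewrite nrmM nrmV nrm_ofR ger0_norm ?nrm_ge0 // mulVf // nrm_eq0.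
  rewrite /t mulrDr lerD2l /d mulrCA; apply: ler_piMr; first exact: ltW.
  by rewrite ler_pdivrMr // mul1r lerDl.
split.
- move=> x y; apply/ler_addgt0Pr => e e0.
  have e20 : 0 < e / 2 by rewrite divr_gt0.
  have [t0 Bt] : S x (gauge B x + e / 2) by apply: glt; rewrite ltrDl.
  have [u0 Bu] : S y (gauge B y + e / 2) by apply: glt; rewrite ltrDl.
  set t := _ + _ in t0 Bt; set u := _ + _ in u0 Bu.
  have -> : gauge B x + gauge B y + e = t + u by rewrite [e]splitr /t /u addrACA.
  have tu0 : 0 < t + u by rewrite addr_gt0.
  apply: gle; split => //.
  have := Bc (t / (t + u)) (u / (t + u)) _ _ _ _ _ Bt Bu.
  rewrite !scalerA !rmorphM /= !fmorphV.
  rewrite ![ofR _ / _]mulrC -!mulrA !mulfV ?fmorph_eq0 ?gt_eqF // !mulr1 -scalerDr.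
  by apply; rewrite ?divr_ge0 ?ltW // -mulrDl mulfV // gt_eqF.
- move=> a x; apply/eqP; rewrite eq_le gZ /=.
  have [->|an] := eqVneq a 0; first by rewrite nrm0 mul0r.
  have := gZ a^-1 (a *: x).
  rewrite scalerA mulVf // scale1r nrmV mulrC ler_pdivlMr ?nrm_gt0 //.
  by rewrite mulrC.
- have e20 : (2^-1 : R) < 1 by rewrite invf_lt1 // ltr1n.
  have n2 : (ofR 2^-1 : K) != 0 by rewrite fmorph_eq0 invr_neq0.
  have := nbhs0Z n2 nB; apply: filterS => _ [y By <-].
  apply: le_lt_trans e20; apply: gle; split=> //.
  by rewrite scalerA mulVf // scale1r.
Qed.

Lemma csemi_ex (x : V) (U : set V) : nbhs x U ->
  exists q, csemi q /\ forall y, q (y - x) < 1 -> U y.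
Proof.
move=> Ux; have := nbhsB (- x) Ux; rewrite addNr => /csemi_ex0[q [hq qU]].
exists q; split => // y /qU[z Uz]; rewrite addrC => /(congr1 (+%R^~ x)).
by rewrite !subrK => <-.
Qed.

Lemma cvg_csemi (T : Type) (F : set_system T) {FF : Filter F} (f : T -> V) l :
  f @ F --> l <->
  forall q, csemi q -> forall e, 0 < e -> \forall t \near F, q (f t - l) < e.
Proof.
split=> [fl q hq e e0|h U /csemi_ex[q [hq qU]]].
  exact: fl (csemi_nbhs hq l e0).
by have := h q hq 1 ltr01; apply: filterS => t /qU.
Qed.

Lemma hausdorff_csemi : hausdorff_space V ->
  forall x, (forall q : V -> R, csemi q -> q x = 0) -> x = 0.
Proof.
move=> hV x h; apply: hV => A B /csemi_ex[q [hq qA]] /csemi_ex[p [hp pB]].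
exists 0; split; first by apply: qA; rewrite sub0r csemiN // h.
by apply: pB; rewrite subrr csemi0.
Qed.

End seminorms.

(** * A mean value inequality for seminorms of curves *)

Section mean_value.
Variables (R : realType) (k : Defs.scalar) (V : tvsType (Fld R k)).

(** The s in [0, 1] with [q (c s - c 0) <= (M + e) * s] have a supremum; it satisfies the bound too,
    and it could be passed if it were less than 1. Only the local slopes of [c] with respect to q
    enter. *)
Lemma csemi_mvt (q : V -> R) (hq : csemi q) (c : R -> V) (M : R) :
  (forall s, 0 <= s <= 1 -> forall e, 0 < e -> exists2 d, 0 < d &
    forall t, 0 <= t <= 1 -> `|t - s| < d ->
      q (c t - c s) <= (M + e) * `|t - s|) ->
  q (c 1 - c 0) <= M.
Proof.
move=> hc; apply/ler_addgt0Pr => e e0.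
pose S := [set s : R | 0 <= s <= 1 /\ q (c s - c 0) <= (M + e) * s].
have S0 : S 0 by split; rewrite ?lexx ?ler01 // subrr csemi0 // mulr0.
have supS : has_sup S by split; [exists 0|exists 1 => s [/andP[]]].
have s01 : 0 <= sup S <= 1.
  apply/andP; split; first exact: sup_upper_bound.
  by apply: ge_sup; [exists 0|move=> s [/andP[]]].
have [d d0 hd] := hc _ s01 _ e0.
have Ss : S (sup S).
  split=> //; have [s Ss sd] := sup_adherent d0 supS.
  have ss : s <= sup S by exact: sup_upper_bound.
  have dss : `|s - sup S| < d by rewrite distrC ger0_norm ?subr_ge0 //; lra.
  have [s1 s2] := Ss.
  apply: le_trans (csemi_dist hq _ (c s) _) _.
  have := hd s s1 dss; rewrite csemiB // distrC ger0_norm ?subr_ge0 //; lra.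
have [s1|s1] := leP 1 (sup S).
  have e1 : sup S = 1 by apply/eqP; rewrite eq_le s1 andbT; case/andP: s01.
  by case: Ss => _; rewrite e1 mulr1.
(* A point beyond [sup S] at distance less than [d], to which the slope bound extends the estimate:
   a contradiction. *)
pose t := Num.min (sup S + d / 2) 1.
have ts : sup S < t by rewrite lt_min s1 andbT ltrDl divr_gt0.
suff St : S t by have := sup_upper_bound supS St; rewrite leNgt ts.
have t1 : 0 <= t <= 1.
  by rewrite ge_min lexx orbT andbT (le_trans _ (ltW ts)) //; case/andP: s01.
split=> //; apply: le_trans (csemi_dist hq _ (c (sup S)) _) _.
have td : t - sup S <= d / 2 by rewrite lerBlDl /t ge_min lexx.
have dt : `|t - sup S| < d by rewrite ger0_norm ?subr_ge0 ?ltW //; lra.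
have [_ h2] := Ss.
have := hd t t1 dt; rewrite ger0_norm ?subr_ge0 ?(ltW ts) //; lra.
Qed.
End mean_value.

Section compactness.
Variables (R : realType) (k : Defs.scalar).
Local Notation K := (Fld R k).

Lemma compact_bound (T : topologicalType) (A : set T) (f : T -> R) :
  compact A -> (forall x, A x -> {for x, continuous f}) ->
  exists2 M, 0 < M & forall x, A x -> f x <= M.
Proof.
move=> /compact_near_coveringP cA cf.
have : \forall N \near \oo, A `<=` [set x | f x <= N%:R].
  apply: cA => x Ax; exists ([set y | f y < f x + 1], [set n | f x + 1 <= n%:R]).
    split; last exact: nbhs_infty_ger.
    have := cf x Ax; move=> /cvgrPdist_lt /(_ 1 ltr01).
    by apply: filterS => y; rewrite distrC ltr_norml => /andP[_]; rewrite ltrBlDl.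
  by move=> [y n] /= [/ltW h1 h2]; exact: le_trans h2.
case=> N _ /(_ N (leqnn _)) h; exists N.+1%:R => // x /h /= /le_trans -> //.
by rewrite ler_nat.
Qed.

Lemma compact_disc (r : R) : compact [set z : K | nrm z <= r].
Proof.
have cl : closed [set z : K | nrm z <= r].
  apply: (@closed_comp _ _ _ [set x | x <= r]); last exact: closed_le.
  by move=> x _; exact: nrm_continuous.
case: k cl => cl.
  apply: (subclosed_compact cl (@segment_compact R (- r) r)) => z /=.
  by rewrite in_itv /= ler_norml.
(* The complex disc is a closed subset of the image under [g] of the square with side [-r, r]. *)
pose g (p : R^o * R^o) : Fld R ScC := Complex p.1 p.2.
have gc : continuous g.
  move=> [a b] U /nbhs_nrm[e e0 eU].
  have e2 : 0 < e / 2 by rewrite divr_gt0.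
  exists ([set x | `|x - a| < e / 2], [set y | `|y - b| < e / 2]).
    by split; exists (e / 2) => // y /=; rewrite distrC.
  move=> [x y] /= [xa yb]; apply: eU.
  pose i : Fld R ScC := Complex 0 1.
  have -> : g (x, y) - g (a, b) = ofR (x - a) + ofR (y - b) * i.
    by rewrite /g /ofR /=; simpc.
  apply: (le_lt_trans (nrmD _ _)).
  have -> : nrm (ofR (y - b) * i) = `|y - b|.
    by rewrite nrmM nrm_ofR /nrm normc_def /= expr0n add0r expr1n sqrtr1 mulr1.
  by rewrite nrm_ofR; lra.
have cK : compact (g @` (`[- r, r] `*` `[- r, r])).
  apply: continuous_compact; last by apply: compact_setX; exact: segment_compact.
  exact: continuous_subspaceT.
apply: (subclosed_compact cl cK) => -[a b] /=.
move=> h; have r0 : 0 <= r by exact: le_trans h.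
have hs : a ^+ 2 + b ^+ 2 <= r ^+ 2.
  by rewrite -(sqr_sqrtr (a := a ^+ 2 + b ^+ 2)) ?addr_ge0 ?sqr_ge0 // ler_sqr ?nnegrE // sqrtr_ge0.
exists (a, b) => //=; split => /=; rewrite in_itv /= -ler_norml -[leRHS](ger0_norm r0) -ler_sqr ?nnegrE //.
  by rewrite !real_normK ?num_real //; have := sqr_ge0 b; lra.
by rewrite !real_normK ?num_real //; have := sqr_ge0 a; lra.
Qed.
End compactness.

(** * Directional derivatives and C^n-maps *)

Section tvs_limits.
Variables (K : numFieldType) (T : Type) (F : set_system T).
Context {FF : Filter F}.
Variable V : tvsType K.

Lemma tvs_cvgD (f g : T -> V) (a b : V) :
  f @ F --> a -> g @ F --> b -> (fun t => f t + g t) @ F --> a + b.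
Proof.
move=> fa gb; exact: (cvg_comp2 fa gb (@add_continuous V (a, b))).
Qed.

Lemma tvs_cvgZ (s : T -> K) (f : T -> V) (a : K) (b : V) :
  s @ F --> a -> f @ F --> b -> (fun t => s t *: f t) @ F --> a *: b.
Proof.
move=> sa fb; exact: (cvg_comp2 sa fb (@scale_continuous _ V (a, b))).
Qed.

Lemma tvs_cvgN (f : T -> V) (a : V) :
  f @ F --> a -> (fun t => - f t) @ F --> - a.
Proof. move=> fa; exact: (cvg_comp _ _ fa (@opp_continuous V a)). Qed.
End tvs_limits.

(* Unifying [@ F] with [@ x] unfolds [nbhs x] and then instance resolution    *)
(* fails, so the limits at a point have their own lemmas.                     *)
Section limits_at_point.
Variables (K : numFieldType) (T : topologicalType) (x : T) (V W : tvsType K).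

Lemma at_cst (Y : topologicalType) (a : Y) : (fun=> a) @ x --> a.
Proof. exact: (@cvg_cst _ a T (nbhs x) _). Qed.

Lemma at_comp (Y Z : topologicalType) (f : T -> Y) (g : Y -> Z) :
  f @ x --> f x -> g @ f x --> g (f x) -> (fun z => g (f z)) @ x --> g (f x).
Proof. by move=> fx gx; exact: (cvg_comp _ _ fx gx). Qed.

Lemma at_pair (Y Z : topologicalType) (f : T -> Y) (g : T -> Z) (a : Y) (b : Z) :
  f @ x --> a -> g @ x --> b -> (fun z => (f z, g z)) @ x --> (a, b).
Proof. by move=> fa gb; exact: (@cvg_pair _ _ _ (nbhs x)). Qed.

Lemma at_D (f g : T -> V) (a b : V) :
  f @ x --> a -> g @ x --> b -> (fun t => f t + g t) @ x --> a + b.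
Proof. exact: (@tvs_cvgD _ _ (nbhs x)). Qed.

Lemma at_Z (s : T -> K) (f : T -> V) (a : K) (b : V) :
  s @ x --> a -> f @ x --> b -> (fun t => s t *: f t) @ x --> a *: b.
Proof. exact: (@tvs_cvgZ _ _ (nbhs x)). Qed.

Lemma at_N (f : T -> V) (a : V) : f @ x --> a -> (fun t => - f t) @ x --> - a.
Proof. exact: (@tvs_cvgN _ _ (nbhs x)). Qed.

Lemma at_B (f g : T -> V) (a b : V) :
  f @ x --> a -> g @ x --> b -> (fun t => f t - g t) @ x --> a - b.
Proof. by move=> fa gb; apply: at_D => //; exact: at_N. Qed.

Lemma at_sum (I : Type) (r : seq I) (P : pred I) (f : I -> T -> V) (a : I -> V) :
  (forall i, P i -> f i @ x --> a i) ->
  (fun t => \sum_(i <- r | P i) f i t) @ x --> \sum_(i <- r | P i) a i.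
Proof.
move=> fa; elim: r => [|i r IH].
  by under eq_fun do rewrite big_nil; rewrite big_nil; exact: at_cst.
under eq_fun do rewrite big_cons; rewrite big_cons.
by case: ifP => // Pi; apply: at_D => //; exact: fa.
Qed.
End limits_at_point.

Lemma at_id (T : topologicalType) (x : T) : id @ x --> x. Proof. exact: cvg_id. Qed.

Lemma at_fst (T T' : topologicalType) (x : T * T') : fst @ x --> x.1.
Proof. by case: x => a b; exact: cvg_fst. Qed.

Lemma at_snd (T T' : topologicalType) (x : T * T') : snd @ x --> x.2.
Proof. by case: x => a b; exact: cvg_snd. Qed.

Lemma at_fst_comp (T T1 T2 : topologicalType) (f : T -> T1 * T2) (x : T) (a : T1 * T2) :
  f @ x --> a -> (fun z => (f z).1) @ x --> a.1.
Proof. by move=> fa; exact: (cvg_comp _ _ fa (@at_fst _ _ a)). Qed.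

Lemma at_snd_comp (T T1 T2 : topologicalType) (f : T -> T1 * T2) (x : T) (a : T1 * T2) :
  f @ x --> a -> (fun z => (f z).2) @ x --> a.2.
Proof. by move=> fa; exact: (cvg_comp _ _ fa (@at_snd _ _ a)). Qed.

Definition cont_on (X Y : topologicalType) (U : set X) (f : X -> Y) :=
  forall x, U x -> f @ x --> f x.

Lemma cont_onP (X Y : topologicalType) (U : set X) (f : X -> Y) : open U ->
  {within U, continuous f} <-> cont_on U f.
Proof.
move=> oU; rewrite continuous_open_subspace //; split=> h x.
  by move=> Ux; apply: h; rewrite inE.
by rewrite inE; exact: h.
Qed.

Section ck.
Variables (R : realType) (k : Defs.scalar).
Local Notation K := (Fld R k).

Section dirder.
Variables X H : tvsType K.
Implicit Types (f : X -> H) (x y : X) (l : H).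

(** Cleared of the division by t, the condition also holds at t = 0, so full neighbourhoods of 0
    replace punctured ones. *)
Lemma is_dirderP f x y l : is_dirder f x y l <->
  forall q, csemi q -> forall e, 0 < e ->
    \forall t \near (0 : K), q (f (x + t *: y) - f x - t *: l) <= e * nrm t.
Proof.
have E q t : csemi q -> t != 0 ->
    q (t^-1 *: (f (x + t *: y) - f x) - l) * nrm t =
    q (f (x + t *: y) - f x - t *: l).
  move=> hq t0; rewrite mulrC -csemiZ // scalerBr scalerA mulfV // scale1r //.
rewrite /is_dirder cvg_csemi; split=> h q hq e e0.
  have := h q hq e e0; rewrite near_withinE; apply: filterS => t ht.
  have [->|t0] := eqVneq t 0.
    by rewrite !scale0r addr0 !subr0 subrr csemi0 // nrm0 mulr0.
  by rewrite -E // ler_pM2r ?nrm_gt0 // ltW // ht.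
have e2 : 0 < e / 2 by rewrite divr_gt0.
rewrite near_withinE; have := h q hq _ e2; apply: filterS => t ht t0.
move: ht; rewrite -E // ler_pM2r ?nrm_gt0 // => /le_lt_trans; apply.
by rewrite ltr_pdivrMr // ltr_pMr // ltr1n.
Qed.

Lemma is_dirder_unique f x y l l' : hausdorff_space H ->
  is_dirder f x y l -> is_dirder f x y l' -> l = l'.
Proof. by move=> hH hl hl'; exact: (cvg_unique hH hl hl'). Qed.

Lemma is_dirder_ext f g x y l : (\forall z \near x, f z = g z) ->
  is_dirder f x y l -> is_dirder g x y l.
Proof.
move=> fg /is_dirderP h; apply/is_dirderP => q hq e e0.
have hx : (fun t : K => x + t *: y) @ (0 : K) --> x.
  rewrite -[X in _ --> X]addr0 -(scale0r y).
  by apply: at_D; [exact: at_cst|apply: at_Z; [exact: at_id|exact: at_cst]].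
apply: filterS2 (h q hq e e0) (hx _ fg) => t /= + <-.
by rewrite (nbhs_singleton fg).
Qed.

Lemma is_dirderD f g x y l m : is_dirder f x y l -> is_dirder g x y m ->
  is_dirder (fun z => f z + g z) x y (l + m).
Proof.
move=> hf hg; rewrite /is_dirder.
under eq_fun do rewrite opprD addrACA scalerDr.
exact: (@tvs_cvgD _ _ ((0 : K)^') _ H).
Qed.

Lemma is_dirderZ f x y l a : is_dirder f x y l ->
  is_dirder (fun z => a *: f z) x y (a *: l).
Proof.
move=> hf; rewrite /is_dirder.
under eq_fun do rewrite -scalerBr scalerA mulrC -scalerA.
by apply: (@tvs_cvgZ _ _ ((0 : K)^') _ H (fun=> a)) => //; exact: (@cvg_cst _ a _ ((0 : K)^')).
Qed.

Lemma is_dirderZd f x y l a : is_dirder f x y l -> is_dirder f x (a *: y) (a *: l).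
Proof.
move=> /is_dirderP h; apply/is_dirderP => q hq e e0.
have a0 : 0 < nrm a + 1 by rewrite ltr_wpDl // nrm_ge0.
have e1 : 0 < e / (nrm a + 1) by rewrite divr_gt0.
have ha : (fun t : K => t * a) @ (0 : K) --> (0 : K).
  rewrite -[X in _ --> X](mul0r a); apply: (@at_Z _ _ _ (K^o) id (fun=> a)).
    exact: at_id.
  exact: at_cst.
apply: (@filterS _ (nbhs (0 : K)) _ _ _ _ (ha _ (h q hq _ e1))) => t /=; rewrite !scalerA => /le_trans; apply.
rewrite nrmM [nrm t * _]mulrC mulrA ler_wpM2r ?nrm_ge0 // mulrAC.
by rewrite ler_pdivrMr // ler_wpM2l ?(ltW e0) // lerDl.
Qed.

Lemma is_dirder_cst (a : H) x y : is_dirder (fun=> a) x y 0.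
Proof.
rewrite /is_dirder; under eq_fun do rewrite subrr scaler0; exact: cvg_cst.
Qed.

Definition der_on (U : set X) f (F : X * X -> H) :=
  forall x y, U x -> is_dirder f x y (F (x, y)).

(** Mean value inequality for s -> f (z.1 + s t z.2) - s t F (x, y), whose derivative t (F (w, z.2)
    - F (x, y)) is small by continuity of F. The uniformity in base point and direction is what the
    chain rule and the additivity of the derivative rest on. *)
Lemma dirder_unif (U : set X) f F x y : open U -> der_on U f F -> U x ->
  F @ (x, y) --> F (x, y) -> forall q, csemi q -> forall e, 0 < e ->
  \forall z \near (x, y) & t \near (0 : K),
    q (f (z.1 + t *: z.2) - f z.1 - t *: F (x, y)) <= e * nrm t.
Proof.
move=> oU fF Ux cF q hq e e0.
pose m (p : (X * X) * K) : X * X := (p.1.1 + p.2 *: p.1.2, p.1.2).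
have m0 : m @ ((x, y), (0 : K)) --> (x, y).
  apply: at_pair; last exact: (at_snd_comp (@at_fst _ _ (x, y, 0 : K))).
  rewrite -[X in _ --> X]addr0 -(scale0r y); apply: at_D.
    exact: (at_fst_comp (@at_fst _ _ (x, y, 0 : K))).
  by apply: at_Z; [exact: at_snd|exact: (at_snd_comp (@at_fst _ _ (x, y, 0 : K)))].
pose N := [set z : X * X | U z.1 /\ q (F z - F (x, y)) < e].
have NN : nbhs (x, y) N.
  apply: filterI; last exact: (cF _ (csemi_nbhs hq (F (x, y)) e0)).
  exact: (@at_fst _ _ (x, y) U (open_nbhs_nbhs (conj oU Ux))).
have [[A B] /= [nA nB] AB] := m0 _ NN.
have /nbhs_nrm[d d0 dB] := nB.
exists (A, [set t | nrm t < d]) => /=; first by split=> //; exact: near_nrm.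
move=> [z t] /= [Az td].
have Nst s : 0 <= s <= 1 -> N (z.1 + (ofR s * t) *: z.2, z.2).
  move=> /andP[s0 s1]; apply: (AB (z, ofR s * t)); split => //=.
  apply: dB; rewrite subr0; apply: le_lt_trans td.
  by rewrite nrmM nrm_ofR ger0_norm // ler_piMl // nrm_ge0.
pose c s := f (z.1 + (ofR s * t) *: z.2) - (ofR s * t) *: F (x, y).
suff : q (c 1 - c 0) <= e * nrm t.
  rewrite /c rmorph1 rmorph0 mul1r mul0r !scale0r addr0 subr0.
  by rewrite addrAC.
apply: csemi_mvt => // s s01 e' e'0.
have [Uw wF] := Nst s s01; set w := z.1 + _ in Uw wF.
have t1 : 0 < nrm t + 1 by rewrite ltr_wpDl // nrm_ge0.
have e1 : 0 < e' / (nrm t + 1) by rewrite divr_gt0.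
have /is_dirderP /(_ q hq _ e1) /nbhs_nrm[eta eta0 heta] := fF w z.2 Uw.
exists (eta / (nrm t + 1)); first by rewrite divr_gt0.
move=> s' s'01 ss'; pose h := ofR (s' - s) * t.
have hh : nrm h = `|s' - s| * nrm t by rewrite nrmM nrm_ofR.
have -> : c s' - c s = (f (w + h *: z.2) - f w - h *: F (w, z.2)) +
    h *: (F (w, z.2) - F (x, y)).
  have -> : w + h *: z.2 = z.1 + (ofR s' * t) *: z.2.
    by rewrite /w /h rmorphB mulrBl -addrA -scalerDl addrC [X in X *: _]addrC subrK addrC.
  rewrite scalerBr addrA subrK /c /h rmorphB mulrBl scalerBl !opprB addrACA.
  by rewrite [RHS]addrACA; congr (_ + _); exact: addrC.
apply: le_trans (csemiD hq _ _) _; rewrite csemiZ //.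
have h1 : q (f (w + h *: z.2) - f w - h *: F (w, z.2)) <= e' * `|s' - s|.
  apply: le_trans (heta h _) _.
    rewrite subr0 hh; have [t00|t0] := eqVneq (nrm t) 0; first by rewrite t00 mulr0.
    apply: (@lt_le_trans _ _ (eta / (nrm t + 1) * nrm t)).
      by rewrite ltr_pM2r // lt_def t0 nrm_ge0.
    by rewrite mulrAC -mulrA ler_piMr ?(ltW eta0) // ler_pdivrMr // mul1r lerDl.
  rewrite hh mulrCA mulrC ler_wpM2r //.
  by rewrite mulrAC -mulrA ler_piMr ?(ltW e'0) // ler_pdivrMr // mul1r lerDl.
have h2 : nrm h * q (F (w, z.2) - F (x, y)) <= e * nrm t * `|s' - s|.
  by rewrite hh [leRHS]mulrC [e * _]mulrC mulrA ler_wpM2l ?mulr_ge0 ?nrm_ge0 // ltW.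
by rewrite mulrDl [leRHS]addrC; exact: lerD.
Qed.
End dirder.
End ck.

Lemma open_X (X Y : topologicalType) (U : set X) (V : set Y) :
  open U -> open V -> open (U `*` V).
Proof.
move=> oU oV; rewrite openE => -[x y] [/= Ux Vy].
by exists (U, V); first by split; exact: open_nbhs_nbhs.
Qed.

Lemma open_XT (X Y : topologicalType) (U : set X) : open U -> open (U `*` [set: Y]).
Proof. by move=> oU; apply: open_X => //; exact: openT. Qed.

Section ck.
Variables (R : realType) (k : Defs.scalar).
Local Notation K := (Fld R k).

Lemma near0_dnbhs (P : K -> Prop) : P 0 ->
  (\forall t \near (0 : K)^', P t) -> \forall t \near (0 : K), P t.
Proof.
move=> P0; rewrite near_withinE; apply: filterS => t h.
by have [->|/h] := eqVneq t 0.
Qed.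

Lemma near_dnbhs (P : K -> Prop) :
  (\forall t \near (0 : K), P t) -> \forall t \near (0 : K)^', P t.
Proof. by rewrite near_withinE; apply: filterS. Qed.

(** If u is the difference quotient of f, then f (x + t y) = f x + t u, so g is expanded at the
    fixed point f x in a direction u that tends to l but varies with t; [dirder_unif] covers such
    directions. *)
Lemma is_dirder_comp (X Y H : tvsType K) (f : X -> Y) (g : Y -> H) (V : set Y)
    (G : Y * Y -> H) x y l :
  open V -> der_on V g G -> V (f x) -> G @ (f x, l) --> G (f x, l) ->
  is_dirder f x y l -> is_dirder (g \o f) x y (G (f x, l)).
Proof.
move=> oV gG Vfx cG fl; apply/is_dirderP => q hq e e0.
apply: near0_dnbhs.
  by rewrite /= !scale0r addr0 subr0 subrr csemi0 // nrm0 mulr0.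
have [[A B] /= [nA nB] AB] := dirder_unif oV gG Vfx cG hq e0.
have c1 : (fun t : K => (f x, t^-1 *: (f (x + t *: y) - f x))) @ (0 : K)^' --> (f x, l).
  apply: (@cvg_pair _ _ _ ((0 : K)^')) => //.
  exact: (@cvg_cst _ _ _ ((0 : K)^')).
have c2 := c1 _ nA.
have c3 := near_dnbhs nB.
have c4 : \forall t \near (0 : K)^', t != 0 by rewrite near_withinE; exact: filterE.
apply: (@filterS3 _ ((0 : K)^') _ _ _ _ _ _ c2 c3 c4) => t At Bt t0.
have := AB (_, t) (conj At Bt).
by rewrite /= scalerA mulfV // scale1r [f x + _]addrC subrK.
Qed.

Lemma is_dirder_pair (X Y H : tvsType K) (f : X -> Y) (g : X -> H) x y l m :
  is_dirder f x y l -> is_dirder g x y m ->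
  is_dirder (fun z => (f z, g z) : (Y * H)%type) x y (l, m).
Proof. by move=> fl gm; exact: (@cvg_pair _ _ _ ((0 : K)^')). Qed.

Section C1.
Variables (X H : tvsType K) (U : set X) (f : X -> H) (F : X * X -> H).
Hypotheses (hH : hausdorff_space H) (oU : open U) (fF : der_on U f F).
Hypothesis cF : cont_on (U `*` setT) F.

(** The step from x to x + t (a y + y') is taken through x + t a y. Its second half starts at a
    moving base point, where [dirder_unif] and thus the joint continuity of F come in. *)
Lemma der_linear x (a : K) y y' : U x ->
  F (x, a *: y + y') = a *: F (x, y) + F (x, y').
Proof.
move=> Ux; apply: (is_dirder_unique hH (@fF x _ Ux)).
apply/is_dirderP => q hq e e0.
have e2 : 0 < e / 2 by rewrite divr_gt0.
have /is_dirderP /(_ q hq _ e2) h1 : is_dirder f x (a *: y) (a *: F (x, y)).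
  by apply: is_dirderZd; exact: fF.
have [[A B] /= [nA nB] AB] := dirder_unif oU fF Ux (cF (conj Ux I : (U `*` setT) (x, y'))) hq e2.
have c1 : (fun t : K => (x + t *: (a *: y), y')) @ (0 : K) --> (x, y').
  apply: at_pair; last exact: at_cst.
  rewrite -[X in _ --> X]addr0 -(scale0r (a *: y)).
  by apply: at_D; [exact: at_cst|apply: at_Z; [exact: at_id|exact: at_cst]].
have h2 := c1 _ nA.
apply: (@filterS3 _ (nbhs (0 : K)) _ _ _ _ _ _ h1 h2 nB) => t t1 t2 t3.
have := AB (_, t) (conj t2 t3); rewrite /= => t4.
have -> : f (x + t *: (a *: y + y')) - f x - t *: (a *: F (x, y) + F (x, y')) =
    (f (x + t *: (a *: y)) - f x - t *: (a *: F (x, y))) +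
    (f (x + t *: (a *: y) + t *: y') - f (x + t *: (a *: y)) - t *: F (x, y')).
  rewrite !scalerDr addrA opprD.
  set p := f (x + _ + _); set r := f (x + _ *: _).
  rewrite [RHS]addrC [RHS]addrACA !addrA subrK.
  by rewrite -!addrA; congr (_ + (_ + _)); exact: addrC.
have := csemiD hq (f (x + t *: (a *: y)) - f x - t *: (a *: F (x, y)))
  (f (x + t *: (a *: y) + t *: y') - f (x + t *: (a *: y)) - t *: F (x, y')).
lra.
Qed.
End C1.

(* f is of class C^(n+1) if it is continuous and (x, y) |-> D_y f(x) is of class C^n;
   in this form the chain rule is a plain induction. *)
Fixpoint CK (n : nat) (H : tvsType K) {struct n} :
    forall X : tvsType K, set X -> (X -> H) -> Prop :=
  match n with
  | 0 => fun X U f => open U /\ cont_on U f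
  | n.+1 => fun X U f => [/\ open U, cont_on U f &
      exists2 F : (X * X)%type -> H, der_on U f F & @CK n H (X * X)%type (U `*` setT) F]
  end.
Arguments CK n {H X} U f.

Lemma CK_open n (X H : tvsType K) (U : set X) (f : X -> H) : CK n U f -> open U.
Proof. by case: n => [[]|n []]. Qed.

Lemma CK_cont n (X H : tvsType K) (U : set X) (f : X -> H) : CK n U f -> cont_on U f.
Proof. by case: n => [[]|n []]. Qed.

Lemma CK_S n (H X : tvsType K) (U : set X) (f : X -> H) : CK n.+1 U f -> CK n U f.
Proof.
elim: n X U f => [|n IH] X U f /= [oU cf [F fF cF]]; first by [].
by split=> //; exists F => //; exact: IH.
Qed.

Lemma CK_le m n (H X : tvsType K) (U : set X) (f : X -> H) : (m <= n)%N ->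
  CK n U f -> CK m U f.
Proof.
move=> /subnK <-; elim: (n - m)%N => // d IH; rewrite addSn => /CK_S; exact: IH.
Qed.

Lemma cont_on_ext (X Y : topologicalType) (U : set X) (f g : X -> Y) : open U ->
  (forall x, U x -> f x = g x) -> cont_on U f -> cont_on U g.
Proof.
move=> oU fg cf x Ux; rewrite -fg // => A /(cf x Ux).
have nU : nbhs x U by exact: open_nbhs_nbhs.
by apply: filterS2 nU => y Uy; rewrite /= fg.
Qed.

Lemma CK_ext n (H X : tvsType K) (U : set X) (f g : X -> H) :
  (forall x, U x -> f x = g x) -> CK n U f -> CK n U g.
Proof.
move=> fg; case: n => [|n] /= [oU cf].
  by split => //; exact: cont_on_ext fg cf.
move=> [F fF cF]; split => //; first exact: cont_on_ext fg cf.
exists F => // x y Ux; apply: is_dirder_ext (fF _ _ Ux).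
by have nU : nbhs x U by [exact: open_nbhs_nbhs]; apply: filterS nU.
Qed.

Lemma CK_sub n (H X : tvsType K) (U W : set X) (f : X -> H) : open W ->
  W `<=` U -> CK n U f -> CK n W f.
Proof.
elim: n X U W f => [|n IH] X U W f oW WU /= [oU cf].
  by split=> // x /WU; exact: cf.
move=> [F fF cF]; split=> //; first by move=> x /WU; exact: cf.
exists F; first by move=> x y /WU; exact: fF.
apply: IH cF; first exact: open_XT.
by move=> [x y] /= [/WU].
Qed.

(** Limits in H being unique, all local derivatives are restrictions of [dirder], to which the
    induction hypothesis then applies. *)
Lemma CK_local n (H X : tvsType K) (U : set X) (f : X -> H) :
  hausdorff_space H ->
  (forall x, U x -> exists W, [/\ W x, W `<=` U & CK n W f]) -> CK n U f.
Proof.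
move=> hH; elim: n X U f => [|n IH] X U f hU.
  split; last by move=> x /hU[W [Wx _ [_ cf]]]; exact: cf.
  rewrite openE => x /hU[W [Wx WU [oW _]]].
  by apply: filterS WU _; exact: open_nbhs_nbhs.
have oU : open U.
  rewrite openE => x /hU[W [Wx WU [oW _ _]]].
  by apply: filterS WU _; exact: open_nbhs_nbhs.
have dU x y W : W x -> CK n.+1 W f -> forall F, der_on W f F ->
    F (x, y) = dirder y f x.
  move=> Wx cW F fF; apply: (is_dirder_unique hH (fF _ _ Wx)).
  exact: (xgetI _ (fF _ _ Wx)).
split=> //; first by move=> x /hU[W [Wx _ [_ cf _]]]; exact: cf.
exists (fun p => dirder p.2 f p.1).
  move=> x y /hU[W [Wx _ /= cW]]; have [oW _ [F fF _]] := cW.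
  by have := fF x y Wx; rewrite (dU x y W).
apply: IH => -[x y] /= [/hU[W [Wx WU cW]] _].
exists (W `*` setT); split=> //; first by move=> [x' y'] /= [/WU].
have [oW _ [F fF cF]] := cW.
by apply: CK_ext cF => -[x' y'] /= [Wx' _]; exact: (dU _ _ W).
Qed.

Definition clin (X H : tvsType K) (f : X -> H) := linear f /\ continuous f.

Section clin_theory.
Variables (X H : tvsType K) (f : X -> H).
Hypothesis hf : clin f.

Lemma clinP a x y : f (a *: x + y) = a *: f x + f y. Proof. by case: hf => h _; exact: h. Qed.
Lemma clinD x y : f (x + y) = f x + f y.
Proof. by have := clinP 1 x y; rewrite !scale1r. Qed.
Lemma clin0 : f 0 = 0.
Proof. by apply: (addrI (f 0)); rewrite -clinD !addr0. Qed.
Lemma clinZ a x : f (a *: x) = a *: f x.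
Proof. by have := clinP a x 0; rewrite !addr0 clin0 addr0. Qed.
Lemma is_dirder_clin x y : is_dirder f x y (f y).
Proof.
apply/is_dirderP => q hq e e0; apply: filterE => t.
by rewrite clinD clinZ [f x + _]addrC addrK subrr csemi0 // mulr_ge0 ?nrm_ge0 ?ltW.
Qed.
End clin_theory.

Lemma clin_comp (X Y H : tvsType K) (f : X -> Y) (g : Y -> H) :
  clin f -> clin g -> clin (g \o f).
Proof.
move=> hf hg; split=> [a x y|x] /=; first by rewrite clinP // clinP.
exact: (at_comp (hf.2 x) (hg.2 _)).
Qed.

Lemma clin_id (X : tvsType K) : clin (fun x : X => x).
Proof. by split=> [a x y|x] //; exact: at_id. Qed.

Lemma clin_fst (X Y : tvsType K) : clin (fst : (X * Y)%type -> X).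
Proof. by split=> [a x y|x] //; exact: at_fst. Qed.

Lemma clin_snd (X Y : tvsType K) : clin (snd : (X * Y)%type -> Y).
Proof. by split=> [a x y|x] //; exact: at_snd. Qed.

Lemma clin_pair (X Y H : tvsType K) (f : X -> Y) (g : X -> H) :
  clin f -> clin g -> clin (fun x => (f x, g x) : (Y * H)%type).
Proof.
move=> hf hg; split=> [a x y|x]; first by rewrite (clinP hf) (clinP hg).
exact: (at_pair (hf.2 x) (hg.2 x)).
Qed.

Lemma clin_add (X : tvsType K) : clin (fun z : (X * X)%type => z.1 + z.2).
Proof.
split=> [a x y|x]; last exact: add_continuous.
by rewrite /= scalerDr addrACA.
Qed.

Lemma CK_clin n (X H : tvsType K) (U : set X) (f : X -> H) :
  clin f -> open U -> CK n U f.
Proof.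
elim: n X U f => [|n IH] X U f hf oU.
  by split=> // x _; exact: hf.2.
split=> //; first by move=> x _; exact: hf.2.
exists (f \o snd); first by move=> x y _; exact: is_dirder_clin.
apply: IH; last exact: open_XT.
by apply: clin_comp => //; exact: clin_snd.
Qed.

Lemma CK_pair n (X Y H : tvsType K) (U : set X) (f : X -> Y) (g : X -> H) :
  CK n U f -> CK n U g -> CK n U (fun x => (f x, g x) : (Y * H)%type).
Proof.
elim: n X U f g => [|n IH] X U f g /= [oU cf].
  by move=> [_ cg]; split=> // x Ux; apply: (at_pair (cf x Ux) (cg x Ux)).
move=> [F fF cF] [_ cg [G gG cG]]; split => //.
  by move=> x Ux; apply: (at_pair (cf x Ux) (cg x Ux)).
exists (fun p => (F p, G p)); last exact: IH.
by move=> x y Ux; apply: is_dirder_pair; [exact: fF|exact: gG].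
Qed.

(** The derivative (x, y) -> G (f x, F (x, y)) is again a composition. Its inner map involves f,
    which must be lowered to class C^n by [CK_S]; the induction hypothesis serves once for f after
    [fst] and once for G. *)
Lemma CK_comp n (X Y H : tvsType K) (U : set X) (V : set Y) (f : X -> Y)
    (g : Y -> H) :
  CK n U f -> CK n V g -> (forall x, U x -> V (f x)) -> CK n U (g \o f).
Proof.
elim: n X Y H U V f g => [|n IH] X Y H U V f g Cf Cg UV.
  have [[oU cf] [oV cg]] := (Cf, Cg).
  by split=> // x Ux; apply: (at_comp (cf x Ux) (cg _ (UV x Ux))).
have Cf' := CK_S Cf.
have [[oU cf [F fF cF]] [oV cg [G gG cG]]] := (Cf, Cg); split=> //.
  by move=> x Ux; apply: (at_comp (cf x Ux) (cg _ (UV x Ux))).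
exists (G \o (fun p => (f p.1, F p))).
  move=> x y Ux; apply: (is_dirder_comp oV gG (UV _ Ux)).
    by apply: (CK_cont cG); split=> //; exact: UV.
  exact: fF.
have oUT : open (U `*` [set: X]) by exact: open_XT.
have C1 : CK n (U `*` setT) (fun p : X * X => f p.1) :=
  IH _ _ _ _ _ _ _ (CK_clin n (clin_fst _ _) oUT) Cf' (fun p h => h.1).
exact: (IH _ _ _ _ _ _ _ (CK_pair C1 cF) cG (fun p h => conj (UV _ h.1) I)).
Qed.

Definition cbil (X Y H : tvsType K) (b : X * Y -> H) :=
  [/\ forall y, linear (fun x => b (x, y)), forall x, linear (fun y => b (x, y))
    & continuous b].

Lemma cbilDl (X Y H : tvsType K) (b : X * Y -> H) : cbil b ->
  forall x x' y, b (x + x', y) = b (x, y) + b (x', y).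
Proof. by move=> [h _ _] x x' y; have := h y 1 x x'; rewrite !scale1r. Qed.

Lemma cbilDr (X Y H : tvsType K) (b : X * Y -> H) : cbil b ->
  forall x y y', b (x, y + y') = b (x, y) + b (x, y').
Proof. by move=> [_ h _] x y y'; have := h x 1 y y'; rewrite !scale1r. Qed.

(** By the product rule the derivative is a sum of two copies of b, each preceded by a continuous
    linear map, so the induction closes. *)
Lemma CK_cbil n (X Y H : tvsType K) (U : set (X * Y)) (b : X * Y -> H) :
  cbil b -> open U -> CK n U b.
Proof.
move=> hb; have [b1 b2 bc] := hb.
elim: n U => [|n IH] U oU.
  by split=> // x _; exact: bc.
split=> //; first by move=> x _; exact: bc.
have b0l y : b (0, y) = 0.
  by have /eqP := cbilDl hb 0 0 y; rewrite addr0 -subr_eq0 opprD addrA subrr sub0r oppr_eq0 => /eqP.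
have b0r x : b (x, 0) = 0.
  by have /eqP := cbilDr hb x 0 0; rewrite addr0 -subr_eq0 opprD addrA subrr sub0r oppr_eq0 => /eqP.
have bZl a x y : b (a *: x, y) = a *: b (x, y).
  by have := b1 y a x 0; rewrite !addr0 b0l addr0.
have bZr a x y : b (x, a *: y) = a *: b (x, y).
  by have := b2 x a y 0; rewrite !addr0 b0r addr0.
exists (fun p => b (p.2.1, p.1.2) + b (p.1.1, p.2.2)).
  move=> [x y] [u v] _ /=; rewrite /is_dirder.
  have E t : t != 0 -> b (x, y + t *: v) - b (x, y) = t *: b (x, v).
    by move=> _; rewrite cbilDr // addrAC subrr add0r bZr.
  have c1 : (fun t : K => b (u, y + t *: v) + b (x, v)) @ (0 : K)^' --> b (u, y) + b (x, v).
    apply: (@tvs_cvgD _ _ ((0 : K)^') _ H (fun t => b (u, y + t *: v)) (fun=> b (x, v))); last first.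
      exact: (@cvg_cst _ _ _ ((0 : K)^')).
    apply: (@cvg_trans _ ((fun t => b (u, y + t *: v)) @ (0 : K))).
      by move=> A; exact: near_dnbhs.
    rewrite -[X in b (u, X)]addr0 -[X in _ + X](scale0r v).
    have c0 : (fun t : K => (u, y + t *: v)) @ (0 : K) --> (u, y + 0 *: v).
      apply: at_pair; first exact: at_cst.
      by apply: at_D; [exact: at_cst|apply: at_Z; [exact: at_id|exact: at_cst]].
    exact: (at_comp c0 (bc _)).
  apply: cvg_trans c1; apply: near_eq_cvg.
  rewrite near_withinE; apply: filterE => t t0 /=.
  rewrite [(x, y) + _](_ : _ = (x + t *: u, y + t *: v)) // cbilDl // addrAC E // bZl.
  by rewrite -scalerDr scalerA mulVf // scale1r addrC.
have oUT : open (U `*` [set: (X * Y)%type]) by exact: open_XT.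
pose L1 (p : (X * Y) * (X * Y)) : X * Y := (p.2.1, p.1.2).
pose L2 (p : (X * Y) * (X * Y)) : X * Y := (p.1.1, p.2.2).
have cL1 : clin L1.
  by apply: clin_pair; apply: clin_comp;
    [exact: clin_snd|exact: clin_fst|exact: clin_fst|exact: clin_snd].
have cL2 : clin L2.
  by apply: clin_pair; apply: clin_comp;
    [exact: clin_fst|exact: clin_fst|exact: clin_snd|exact: clin_snd].
have Cb := IH setT openT.
have C1 : CK n (U `*` setT) (b \o L1) by apply: CK_comp Cb _ => //; exact: CK_clin.
have C2 : CK n (U `*` setT) (b \o L2) by apply: CK_comp Cb _ => //; exact: CK_clin.
have C12 := CK_pair C1 C2.
by apply: (CK_comp C12 (CK_clin n (clin_add H) openT)).
Qed.

Lemma CK_D n (X H : tvsType K) (U : set X) (f g : X -> H) :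
  CK n U f -> CK n U g -> CK n U (fun x => f x + g x).
Proof.
move=> Cf Cg.
by apply: (CK_comp (CK_pair Cf Cg) (CK_clin n (clin_add H) openT)).
Qed.

Lemma CK_cst n (X H : tvsType K) (U : set X) (a : H) : open U -> CK n U (fun=> a).
Proof.
elim: n X U a => [|n IH] X U a oU; first by split=> // x _; exact: at_cst.
split=> //; first by move=> x _; exact: at_cst.
exists (fun=> 0); last by apply: IH; exact: open_XT.
by move=> x y _; exact: is_dirder_cst.
Qed.
End ck.
Arguments CK {R k} n {H X} U f.

Local Notation iterD := Defs.iterD.

Lemma map_nth_enum (T : Type) (x0 : T) (s : seq T) :
  [seq nth x0 s (val i) | i <- enum 'I_(size s)] = s.
Proof.
by rewrite (map_comp (nth x0 s) val) val_enum_ord map_nth_iota0 ?take_size.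
Qed.

Lemma size_filter_neq m (i : 'I_m) :
  (size [seq j <- iota 0 m | j != i :> nat] < m)%N.
Proof.
rewrite size_filter -[ltnRHS](size_iota 0 m) -(count_predC (pred1 (i : nat))).
by rewrite -[ltnLHS]add0n ltn_add2r -has_count has_pred1 mem_iota ltn_ord.
Qed.

Lemma ptws_at (T : topologicalType) (I : Type) (Y : topologicalType)
    (f : T -> {ptws I -> Y}) (t : T) :
  (forall i, (fun z => f z i) @ t --> f t i) -> f @ t --> f t.
Proof.
move=> fc; apply/cvg_sup => i D /=.
rewrite (@nbhsE (initial_topology (fun g : I -> Y => g i))).
move=> -[B [[C oC <-] Cp] BV].
apply: (@filterS _ (nbhs t) _ _ _ _ (fc i C (open_nbhs_nbhs (conj oC Cp)))).
by move=> z Cz; exact: BV.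
Qed.

(** * Iterated derivatives with variable directions *)

Section iterD.
Variables (R : realType) (k : Defs.scalar).
Local Notation K := (Fld R k).
Variables (X H : tvsType K).
Hypothesis hH : hausdorff_space H.
Implicit Types (f g : X -> H) (U : set X).

Lemma dirderE f x y l : is_dirder f x y l -> dirder y f x = l.
Proof. by move=> fl; apply: (is_dirder_unique hH _ fl); exact: (xgetI _ fl). Qed.

Lemma dirderP f x y : (exists l, is_dirder f x y l) -> is_dirder f x y (dirder y f x).
Proof. by move=> [l fl]; rewrite (dirderE fl). Qed.

Lemma dirder_ext f g U y : open U -> (forall x, U x -> f x = g x) ->
  forall x, U x -> dirder y f x = dirder y g x.
Proof.
move=> oU fg x Ux; rewrite /dirder; congr xget; apply/seteqP.
have nU : nbhs x U by exact: open_nbhs_nbhs.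
split=> l /=; apply: is_dirder_ext; apply: filterS nU => z Uz; by rewrite fg.
Qed.

Lemma iterD_rcons f ys y : iterD f (rcons ys y) = dirder y (iterD f ys).
Proof. by rewrite /iterD foldl_rcons. Qed.

Lemma iterD_ext f g U ys : open U -> (forall x, U x -> f x = g x) ->
  forall x, U x -> iterD f ys x = iterD g ys x.
Proof.
move=> oU fg; elim/last_ind: ys => [//|ys y IH] x Ux.
by rewrite !iterD_rcons; apply: (dirder_ext _ oU IH).
Qed.

Definition derivs n U f := forall ys y x, (size ys < n)%N -> U x ->
  exists l, is_dirder (iterD f ys) x y l.

Lemma iterD_lin n f g U a ys : open U -> derivs n U f -> derivs n U g ->
  (size ys <= n)%N -> forall x, U x ->
  iterD (fun x => a *: f x + g x) ys x = a *: iterD f ys x + iterD g ys x.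
Proof.
move=> oU df dg; elim/last_ind: ys => [//|ys y IH]; rewrite size_rcons => sy x Ux.
rewrite !iterD_rcons (dirder_ext _ oU (IH (ltnW sy))) //; apply: dirderE.
by apply: is_dirderD; [apply: is_dirderZ|]; apply: dirderP; [exact: df|exact: dg].
Qed.

(** [Cfin] expresses joint continuity on functions from an ordinal. Here the base point and a list
    of directions are arbitrary continuous functions of a parameter, as needed when they come from
    different places. The empty list is the continuity of f itself. *)
Lemma Cfin_cont_list n U f : Cfin n U f ->
  forall (T : topologicalType) (t : T) (x0 : T -> X) (ls : seq (T -> X))
      (us : T -> seq X),
    (forall z, us z = [seq l z | l <- ls]) ->
    x0 @ t --> x0 t -> U (x0 t) -> (size ls <= n)%N ->
    (forall i, (i < size ls)%N -> nth (fun=> 0) ls i @ t --> nth (fun=> 0) ls i t) ->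
  (fun z => iterD f (us z) (x0 z)) @ t --> iterD f (us t) (x0 t).
Proof.
move=> [oU cf _ cD] T t x0 ls us Eus cx Ux sl lc.
have {Eus us}-> : us = fun z => [seq l z | l <- ls] by apply/funext.
move/(cont_onP f oU) in cf.
have [s0|s0] := posnP (size ls).
  by move/size0nil: s0 => ->; exact: (at_comp cx (cf _ Ux)).
have := cD (size ls); rewrite s0 sl => /(_ isT).
have oUT : open (U `*` [set: {ptws 'I_(size ls) -> X}]) by exact: open_XT.
move=> /(cont_onP _ oUT) cj.
pose m z : X * {ptws 'I_(size ls) -> X} :=
  (x0 z, fun i : 'I_(size ls) => nth (fun=> 0) ls i z).
have cm : m @ t --> m t.
  apply: at_pair => //; apply: ptws_at => i; exact: lc.
have E z : [seq (m z).2 i | i <- enum 'I_(size ls)] = [seq l z | l <- ls].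
  by rewrite -[in RHS](map_nth_enum (fun=> 0) ls) -[RHS]map_comp.
have := at_comp cm (cj (m t) (conj Ux I)); rewrite /= E.
by under eq_fun do rewrite E.
Qed.
End iterD.

Section Cfin_CK.
Variables (R : realType) (k : Defs.scalar).
Local Notation K := (Fld R k).

Lemma is_dirder_slice (X Y H : tvsType K) (F : X * Y -> H) x y z l :
  is_dirder F (x, y) (z, 0) l = is_dirder (fun x => F (x, y)) x z l.
Proof.
suff E : (fun t : K => t^-1 *: (F ((x, y) + t *: (z, 0)) - F (x, y))) =
    (fun t => t^-1 *: (F (x + t *: z, y) - F (x, y))) by rewrite /is_dirder E.
apply/funext => t; congr (_ *: (F _ - _)).
by rewrite -[LHS]/(x + t *: z, y + t *: 0) scaler0 addr0.
Qed.

Lemma iterD_slice (X Y H : tvsType K) (F : X * Y -> H) (y : Y) ys x :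
  iterD (fun x => F (x, y)) ys x = iterD F [seq (z, 0) | z <- ys] (x, y).
Proof.
elim: ys F x => [//|z ys IH] F x.
rewrite -[LHS]/(iterD (dirder z (fun x => F (x, y))) ys x).
rewrite -[RHS]/(iterD (dirder (z, 0) F) [seq (z, 0) | z <- ys] (x, y)) -IH.
congr iterD; apply/funext => w; rewrite /dirder; congr xget.
by apply/seteqP; split => l /=; rewrite is_dirder_slice.
Qed.

(** On U, the derivative of f in the directions y1, ..., yj is that of F at (x, y1) in the
    directions (y2, 0), ..., (yj, 0), so existence and joint continuity come from the induction
    hypothesis for F. *)
Lemma CK_Cfin n (X H : tvsType K) (U : set X) (f : X -> H) : hausdorff_space H ->
  CK n U f -> Cfin n U f.
Proof.
move=> hH; elim: n X U f => [|n IH] X U f.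
  move=> [oU cf]; split => //; first exact/cont_onP.
  by case.
move=> [oU cf [F fF cF]]; have CF := IH _ _ _ cF.
have E ys x y : U x -> iterD f (y :: ys) x = iterD F [seq (z, 0) | z <- ys] (x, y).
  move=> Ux; rewrite -iterD_slice.
  apply: (@iterD_ext _ _ _ _ (dirder y f) _ U) => // w Uw.
  by apply: dirderE => //; exact: fF.
split=> //; first exact/cont_onP.
  move=> [|y ys] z x; first by exists (F (x, z)); exact: fF.
  rewrite ltnS => sy Ux; have [_ _ dF _] := CF.
  have [|l hl] := dF [seq (z, 0) | z <- ys] (z, 0) (x, y) _ (conj Ux I).
    by rewrite size_map.
  exists l; have nU : nbhs x U by exact: open_nbhs_nbhs.
  apply: (@is_dirder_ext _ _ _ _ (fun x => iterD F [seq (z, 0) | z <- ys] (x, y))).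
    by apply: filterS nU => w Uw; rewrite E.
  by rewrite -is_dirder_slice.
case=> [//|j] /= jn.
have oUT : open (U `*` [set: {ptws 'I_j.+1 -> X}]) by exact: open_XT.
apply/(cont_onP _ oUT).
pose ls : seq (X * {ptws 'I_j.+1 -> X} -> X * X) :=
  [seq (fun p : X * {ptws 'I_j.+1 -> X} => (p.2 (lift ord0 i), 0)) | i <- enum 'I_j].
have El (p : X * {ptws 'I_j.+1 -> X}) :
    iterD F [seq l p | l <- ls] (p.1, p.2 ord0) =
    iterD F [seq (z, 0) | z <- [seq p.2 (lift ord0 i) | i <- enum 'I_j]] (p.1, p.2 ord0).
  by rewrite /ls -!map_comp.
apply: (@cont_on_ext _ _ _ (fun p => iterD F [seq l p | l <- ls] (p.1, p.2 ord0))) => //.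
  move=> p [Up _]; rewrite El -E // enum_ordSl /=.
  by rewrite -map_comp.
have ev i (p : X * {ptws 'I_j.+1 -> X}) : (fun p : X * {ptws 'I_j.+1 -> X} => p.2 i) @ p --> p.2 i.
  exact: (at_comp (@at_snd _ _ p) (@proj_continuous _ (fun=> X) i _)).
move=> p [Up _]; apply: (Cfin_cont_list CF (t := p) (x0 := fun p => (p.1, p.2 ord0)) (ls := ls)
  (us := fun z => [seq l z | l <- ls])) => //.
- by apply: at_pair; [exact: at_fst|exact: ev].
- by rewrite size_map size_enum_ord.
- move=> i; rewrite size_map size_enum_ord => ij.
  rewrite (nth_map (Ordinal ij)) ?size_enum_ord //.
  by apply: at_pair; [exact: ev|exact: at_cst].
Qed.

(** * From iterated derivatives of f to those of df *)

Section prolong.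
Variables (X H : tvsType K) (U : set X) (f : X -> H) (n : nat).
Hypothesis hH : hausdorff_space H.
Hypothesis Cf : Cfin n.+1 U f.

Let oU : open U. Proof. by case: Cf. Qed.
Let F (p : X * X) := dirder p.2 f p.1.

Let fF : der_on U f F.
Proof. by move=> x y Ux; apply: dirderP => //; have [_ _ h _] := Cf; exact: (h [::]). Qed.

Let cF : cont_on (U `*` setT) F.
Proof.
move=> p [Up _].
apply: (Cfin_cont_list Cf (x0 := fst) (ls := [:: snd])
  (us := fun z => [:: z.2])) => //; first exact: at_fst.
by case=> //= _; exact: at_snd.
Qed.

Let dirder_derivs y : derivs n U (dirder y f).
Proof.
move=> ys z x sy Ux; have [_ _ h _] := Cf.
exact: (h (y :: ys) z x _ Ux).
Qed.

(** Linearity in the first direction is [der_linear]; it survives the further derivatives because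
    these exist for both [dirder y f] and [dirder y' f]. *)
Lemma iterD_hd a y y' us x : (size us <= n)%N -> U x ->
  iterD f (a *: y + y' :: us) x = a *: iterD f (y :: us) x + iterD f (y' :: us) x.
Proof.
move=> su Ux.
rewrite -[iterD f (y :: us)]/(iterD (dirder y f) us).
rewrite -[iterD f (y' :: us)]/(iterD (dirder y' f) us).
rewrite -(iterD_lin hH a oU (@dirder_derivs y) (@dirder_derivs y') su Ux).
rewrite -[LHS]/(iterD (dirder (a *: y + y') f) us x).
apply: (iterD_ext _ oU _ Ux) => z Uz.
exact: (der_linear hH oU fF cF).
Qed.

(* The derivative of (x, y) |-> D_y f(x) at p in the directions ws, each a pair: as the
   map is linear in y, at most one of the directions may hit y. *)
Let Phi (ws : seq (X * X)) (p : X * X) : H :=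
  iterD f (p.2 :: [seq w.1 | w <- ws]) p.1 +
  \sum_(i < size ws) iterD f ((nth 0 ws i).2 ::
    [seq (nth 0 ws j).1 | j <- iota 0 (size ws) & j != i :> nat]) p.1.

Let size_omit (ws : seq (X * X)) (i : 'I_(size ws)) :
  (size [seq (nth 0%R ws j).1 | j <- iota 0 (size ws) & j != i :> nat] < size ws)%N.
Proof.
rewrite size_map; exact: size_filter_neq.
Qed.

Let Phi_rcons ws w p : Phi (rcons ws w) p =
  iterD f (p.2 :: rcons [seq w.1 | w <- ws] w.1) p.1 + (\sum_(i < size ws)
    iterD f ((nth 0 ws i).2 :: rcons
      [seq (nth 0 ws j).1 | j <- iota 0 (size ws) & j != i :> nat] w.1) p.1 +
    iterD f (w.2 :: [seq w.1 | w <- ws]) p.1).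
Proof.
have nthr j : (j < size ws)%N -> nth 0 (rcons ws w) j = nth 0 ws j.
  by move=> js; rewrite nth_rcons js.
have mapr a : [seq (nth 0 (rcons ws w) j).1 | j <- iota 0 (size ws) & a j] =
    [seq (nth 0 ws j).1 | j <- iota 0 (size ws) & a j].
  apply/eq_in_map => j; rewrite mem_filter mem_iota add0n => /andP[_ /andP[_ js]].
  by rewrite nthr.
rewrite /Phi size_rcons map_rcons; congr (_ + _).
have iotaS m : iota 0 m.+1 = rcons (iota 0 m) m by rewrite -addn1 iotaD cats1.
rewrite big_ord_recr iotaS; congr (_ + _).
  apply: eq_bigr => i _; rewrite nthr //= filter_rcons.
  have -> : (size ws != i) by rewrite neq_ltn ltn_ord orbT.
  by rewrite map_rcons mapr nth_rcons ltnn eqxx.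
rewrite /= nth_rcons ltnn eqxx filter_rcons eqxx /= mapr.
have -> : [seq j <- iota 0 (size ws) | j != size ws] = iota 0 (size ws).
  apply/all_filterP/allP => j; rewrite mem_iota add0n => /andP[_ js].
  by rewrite neq_ltn js.
by rewrite (map_comp fst (nth 0 ws)) map_nth_iota0 // take_size.
Qed.

Let is_dirder_sum (Z : tvsType K) m (g : 'I_m -> Z -> H) (x y : Z) (l : 'I_m -> H) :
  (forall i, is_dirder (g i) x y (l i)) ->
  is_dirder (fun z => \sum_(i < m) g i z) x y (\sum_(i < m) l i).
Proof.
move=> hg; elim: (index_enum _) => [|i r IH].
  rewrite big_nil [X in is_dirder X](_ : _ = fun=> 0); first exact: is_dirder_cst.
  by apply/funext => z; rewrite big_nil.
rewrite big_cons [X in is_dirder X](_ : _ = fun z => g i z + \sum_(j <- r) g j z).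
  exact: is_dirderD.
by apply/funext => z; rewrite big_cons.
Qed.

Let cont_iterD us x : (size us <= n.+1)%N -> U x -> iterD f us @ x --> iterD f us x.
Proof.
move=> su Ux.
apply: (Cfin_cont_list Cf (x0 := id) (ls := [seq (fun=> u) | u <- us])
  (us := fun=> us)) => //.
- by move=> z; rewrite -map_comp map_id_in.
- by rewrite size_map.
- by move=> i; rewrite size_map => iu; rewrite (nth_map 0) //; exact: at_cst.
Qed.

Let Phi_dirder ws p w : (size ws < n)%N -> U p.1 ->
  is_dirder (Phi ws) p w (Phi (rcons ws w) p).
Proof.
case: p w => [x y] [u v] sw Ux; have [_ _ hf _] := Cf.
have fst_dirder (g : X -> H) l : is_dirder g x u l ->
  is_dirder (fun p : X * X => g p.1) (x, y) (u, v) l by [].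
have dus us : (size us < n.+1)%N -> is_dirder (iterD f us) x u (iterD f (rcons us u) x).
  by move=> su; rewrite iterD_rcons; apply: dirderP => //; exact: hf.
rewrite Phi_rcons [X in _ + X]addrC addrA; apply: is_dirderD; last first.
  apply: is_dirder_sum => i; apply: fst_dirder; apply: (dus (_ :: _)).
  by rewrite /= ltnS (leq_trans (size_omit i)) // ltnW.
rewrite addrC /=; set us := [seq w.1 | w <- ws].
have sus : (size us < n)%N by rewrite size_map.
(* In the remaining term both the base point and the direction y move. Linearity in the first slot
   splits its quotient into g (x + t u), which converges by continuity, and the quotient of h. *)
pose g := iterD f (v :: us); pose h := iterD f (y :: us).
have c1 : (fun t : K => g (x + t *: u) + t^-1 *: (h (x + t *: u) - h x)) @ (0 : K)^'
    --> g x + iterD f (y :: rcons us u) x.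
  apply: (@tvs_cvgD _ _ ((0 : K)^') _ H (fun t => g (x + t *: u))); last first.
    by apply: (dus (y :: us)); rewrite /= ltnS.
  apply: (@cvg_trans _ ((fun t => g (x + t *: u)) @ (0 : K))).
    by move=> A; exact: near_dnbhs.
  have c0 : (fun t : K => x + t *: u) @ (0 : K) --> x + 0 *: u.
    by apply: at_D; [exact: at_cst|apply: at_Z; [exact: at_id|exact: at_cst]].
  have cg : g @ (x + 0 *: u) --> g (x + 0 *: u).
    by apply: cont_iterD; rewrite ?scale0r ?addr0 //= ltnW.
  by have := at_comp c0 cg; rewrite !(scale0r, addr0).
apply: cvg_trans c1; apply: near_eq_cvg.
have c0 : (fun t : K => x + t *: u) @ (0 : K) --> x.
  rewrite -[X in _ --> X](addr0 x) -(scale0r u).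
  by apply: at_D; [exact: at_cst|apply: at_Z; [exact: at_id|exact: at_cst]].
have nU := c0 _ (open_nbhs_nbhs (conj oU Ux)).
rewrite near_withinE; apply: (@filterS _ (nbhs (0 : K)) _ _ _ _ nU) => t Ut t0.
transitivity (t^-1 *: (iterD f (y + t *: v :: us) (x + t *: u) - h x)) => //.
rewrite [y + _]addrC iterD_hd //; last exact: ltnW.
by rewrite -[X in _ = _ *: X]addrA [RHS]scalerDr [X in _ = X + _]scalerA mulVf // scale1r.
Qed.

Let iterD_Phi ws : (size ws <= n)%N -> forall p, U p.1 -> iterD F ws p = Phi ws p.
Proof.
have oUT : open (U `*` [set: X]) by exact: open_XT.
elim/last_ind: ws => [_ p Up|ws w IH]; first by rewrite /Phi big_ord0 addr0.
rewrite size_rcons => sw p Up; rewrite iterD_rcons.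
rewrite (@dirder_ext _ _ _ _ _ (Phi ws) (U `*` setT)) //; last first.
  by move=> z [Uz _]; exact: (IH (ltnW sw)).
by apply: dirderE => //; exact: Phi_dirder.
Qed.

Lemma Cfin_prolong : Cfin n (U `*` setT) F.
Proof.
have oUT : open (U `*` [set: X]) by exact: open_XT.
split=> //; first exact/cont_onP.
  move=> ws w p sw [Up _]; exists (Phi (rcons ws w) p).
  apply: (@is_dirder_ext _ _ _ _ (Phi ws)); last exact: Phi_dirder.
  have nU : nbhs p (U `*` setT) by exact: open_nbhs_nbhs.
  by apply: filterS nU => z [Uz _]; rewrite iterD_Phi // ltnW.
move=> j /andP[_ jn].
have oUTT : open ((U `*` [set: X]) `*` [set: {ptws 'I_j -> (X * X)%type}]) by exact: open_XT.
apply/(cont_onP _ oUTT).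
pose T := ((X * X) * {ptws 'I_j -> (X * X)%type})%type.
pose ws (z : T) := [seq z.2 i | i <- enum 'I_j].
have sws z : size (ws z) = j by rewrite size_map size_enum_ord.
have ev i (z : T) : (fun z : T => nth 0 (ws z) i) @ z --> nth 0 (ws z) i.
  have [ij|ij] := ltnP i j; last first.
    rewrite nth_default ?sws //; under eq_fun do rewrite nth_default ?sws //.
    exact: at_cst.
  have E z' : nth 0 (ws z') i = z'.2 (Ordinal ij).
    rewrite (nth_map (Ordinal ij)) ?size_enum_ord //; congr (z'.2 _).
    by apply: val_inj; rewrite /= nth_enum_ord.
  rewrite E; under eq_fun do rewrite E.
  exact: (at_comp (@at_snd _ _ z) (@proj_continuous _ (fun=> (X * X)%type) _ _)).
have fst0 (z : T) : (fun z : T => z.1.1) @ z --> z.1.1.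
  exact: (at_fst_comp (@at_fst _ _ z)).
pose om (i : 'I_j) := [seq m <- iota 0 j | m != i :> nat].
have som i : (size (om i) < j)%N.
  exact: size_filter_neq.
apply: (@cont_on_ext _ _ _ (fun z : T => iterD f (z.1.2 :: [seq (nth 0 (ws z) m).1 | m <- iota 0 j]) z.1.1
  + \sum_(i < j) iterD f ((nth 0 (ws z) i).2 :: [seq (nth 0 (ws z) m).1 | m <- om i]) z.1.1)) => //.
  move=> z [[Uz _] _]; rewrite -/(ws z) iterD_Phi ?sws // /Phi sws; congr (_ + _).
  by rewrite (map_comp fst (nth 0 (ws z))) map_nth_iota0 ?sws // take_oversize ?sws.
move=> z [[Uz _] _]; apply: at_D.
  apply: (Cfin_cont_list Cf (t := z) (x0 := fun z : T => z.1.1)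
    (ls := (fun z : T => z.1.2) :: [seq (fun z : T => (nth 0 (ws z) m).1) | m <- iota 0 j])
    (us := fun z : T => z.1.2 :: [seq (nth 0 (ws z) m).1 | m <- iota 0 j])) => //.
  - by move=> z' /=; rewrite -map_comp.
  - by rewrite /= size_map size_iota ltnS.
  - case=> [_|i] /=; first exact: (at_snd_comp (@at_fst _ _ z)).
    rewrite ltnS size_map size_iota => ij.
    by rewrite (nth_map 0%N) ?size_iota //; exact: (at_fst_comp (ev _ z)).
apply: at_sum => i _.
apply: (Cfin_cont_list Cf (t := z) (x0 := fun z : T => z.1.1)
  (ls := (fun z : T => (nth 0 (ws z) i).2) :: [seq (fun z : T => (nth 0 (ws z) m).1) | m <- om i])
  (us := fun z : T => (nth 0 (ws z) i).2 :: [seq (nth 0 (ws z) m).1 | m <- om i])) => //.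
- by move=> z' /=; rewrite -map_comp.
- by rewrite /= size_map ltnS (leq_trans (ltnW (som i))).
- case=> [_|m] /=; first exact: (at_snd_comp (ev _ z)).
  rewrite ltnS size_map => ij.
  by rewrite (nth_map 0%N) //; exact: (at_fst_comp (ev _ z)).
Qed.
End prolong.

Lemma Cfin_CK n (X H : tvsType K) (U : set X) (f : X -> H) : hausdorff_space H ->
  Cfin n U f <-> CK n U f.
Proof.
move=> hH; split; last exact: CK_Cfin.
elim: n X U f => [|n IH] X U f Cf; have [oU cf df _] := Cf;
  move/(cont_onP f oU) in cf; first by [].
split=> //; exists (fun p => dirder p.2 f p.1); last exact/IH/Cfin_prolong.
by move=> x y Ux; apply: dirderP => //; exact: (df [::]).
Qed.
End Cfin_CK.

(** * Cauchy estimates without integrals *)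

Section root_avg.
Variables (R : realType) (k : Defs.scalar).
Local Notation K := (Fld R k).

(** Primitive n-th roots of unity. *)
Definition unit_root (n : nat) (w : K) :=
  [/\ (0 < n)%N, nrm w = 1, w ^+ n = 1 & forall i, (0 < i < n)%N -> w ^+ i != 1].

Section unit_root.
Variables (n : nat) (w : K).
Hypothesis hw : unit_root n w.

Lemma unit_root_neq0 : w != 0.
Proof. by have [_ w1 _ _] := hw; rewrite -nrm_eq0 w1 oner_eq0. Qed.

Lemma unit_root_nrm i : nrm (w ^+ i) = 1.
Proof. by have [_ w1 _ _] := hw; rewrite nrmX w1 expr1n. Qed.

Lemma unit_root_n : (n%:R : K) != 0.
Proof. by have [n0 _ _ _] := hw; rewrite pnatr_eq0 -lt0n. Qed.

Lemma sum_unit_rootX (x : K) : x ^+ n = 1 -> x != 1 -> \sum_(j < n) x ^+ j = 0.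
Proof.
move=> xn x1; have := subrX1 x n; rewrite xn subrr => /esym /eqP.
by rewrite mulf_eq0 subr_eq0 (negbTE x1) => /eqP.
Qed.

Lemma sum_unit_rootV i : (i < n)%N ->
  \sum_(j < n) ((w ^+ j)^-1) ^+ i = (n * (i == 0%N))%:R :> K.
Proof.
move=> ni; case: i ni => [|i] ni.
  by rewrite muln1 -[in RHS](card_ord n) -sumr_const; apply: eq_bigr => j _; rewrite expr0.
rewrite muln0; have [_ _ wn wi] := hw.
under eq_bigr do rewrite -exprVn -exprM mulnC exprM.
apply: sum_unit_rootX; first by rewrite -exprM mulnC exprM exprVn wn invr1 expr1n.
by rewrite exprVn invr_eq1 wi.
Qed.

Lemma sum_rot (V : zmodType) (F : K -> V) :
  \sum_(j < n) F (w ^+ j.+1) = \sum_(j < n) F (w ^+ j).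
Proof.
have [n0 _ wn _] := hw; case: n n0 wn => // m _ wm.
by rewrite big_ord_recr [RHS]big_ord_recl /= wm expr0 addrC.
Qed.
End unit_root.

Variables (H : tvsType K).

Definition avg (n : nat) (F : 'I_n -> H) : H := n%:R^-1 *: \sum_(j < n) F j.

Lemma avg_le (q : H -> R) n (F : 'I_n -> H) M : csemi q -> (0 < n)%N ->
  (forall j, q (F j) <= M) -> q (avg F) <= M.
Proof.
move=> hq n0 FM; rewrite /avg csemiZ // nrmV nrm_nat ler_pdivrMl ?ltr0n //.
apply: le_trans (csemi_sum hq _ _ _) _; apply: le_trans (ler_sum _ (fun i _ => FM i)) _.
by rewrite sumr_const card_ord mulr_natl.
Qed.

Lemma avgD n (F G : 'I_n -> H) : avg (fun j => F j + G j) = avg F + avg G.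
Proof. by rewrite /avg big_split scalerDr. Qed.

Lemma avgZ n (F : 'I_n -> H) a : avg (fun j => a *: F j) = a *: avg F.
Proof. by rewrite /avg -scaler_sumr !scalerA mulrC. Qed.

Lemma avgN n (F : 'I_n -> H) : avg (fun j => - F j) = - avg F.
Proof. by rewrite /avg sumrN scalerN. Qed.

Lemma avgB n (F G : 'I_n -> H) : avg (fun j => F j - G j) = avg F - avg G.
Proof. by rewrite avgD avgN. Qed.

Lemma avg_sum n m (F : 'I_m -> 'I_n -> H) :
  avg (fun j => \sum_(i < m) F i j) = \sum_(i < m) avg (F i).
Proof. by rewrite /avg exchange_big /= -scaler_sumr. Qed.

Lemma avg_scalar n (a : 'I_n -> K) v :
  avg (fun j => a j *: v) = (n%:R^-1 * \sum_(j < n) a j) *: v.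
Proof. by rewrite /avg -scaler_suml scalerA. Qed.

Lemma avg_eq n (F G : 'I_n -> H) : F =1 G -> avg F = avg G.
Proof. by move=> FG; rewrite /avg (eq_bigr _ (fun i _ => FG i)). Qed.

End root_avg.

(** * Taylor's formula from averages over roots of unity *)

Section chain.
Variables (R : realType) (k : Defs.scalar).
Local Notation K := (Fld R k).
Variables (H : tvsType K) (q : H -> R).
Hypothesis hq : csemi q.

(** Differentiability is measured by the single seminorm q, since each estimate concerns one q at a
    time; v is thereby determined only up to vectors on which q vanishes. *)
Definition rder (c : R -> H) (s : R) (v : H) := forall e, 0 < e ->
  \forall h \near (0 : R), q (c (s + h) - c s - ofR h *: v) <= e * `|h|.

Definition cder (f g : K -> H) (z : K) := forall e, 0 < e ->
  \forall t \near (0 : K), q (f (z + t) - f z - t *: g z) <= e * nrm t.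

Lemma rder_mvt (c : R -> H) (M : R) :
  (forall s, 0 <= s <= 1 -> exists2 v, rder c s v & q v <= M) ->
  q (c 1 - c 0) <= M.
Proof.
move=> hc; apply: (csemi_mvt hq) => s s01 e e0; have [v cv vM] := hc s s01.
have /nbhs_ballP[d /= d0 hd] := cv e e0; exists d => // t _ td.
have := hd (t - s); rewrite /ball /= sub0r normrN => /(_ td).
rewrite [s + _]addrC subrK => h.
have -> : c t - c s = (c t - c s - ofR (t - s) *: v) + ofR (t - s) *: v by rewrite subrK.
apply: le_trans (csemiD hq _ _) _; rewrite csemiZ // nrm_ofR mulrDl [X in _ <= X]addrC.
by apply: lerD => //; rewrite mulrC ler_wpM2r.
Qed.

Lemma rder_affine f g z b s : cder f g (z + ofR s * b) ->
  rder (fun s => f (z + ofR s * b)) s (b *: g (z + ofR s * b)).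
Proof.
move=> fg e e0.
have b0 : 0 < nrm b + 1 by rewrite ltr_wpDl // nrm_ge0.
have e1 : 0 < e / (nrm b + 1) by rewrite divr_gt0.
have c0 : (fun h : R => ofR h * b) @ (0 : R) --> (0 : K).
  rewrite -[X in _ --> X](mul0r b) -(rmorph0 ofR).
  apply: (@at_Z K _ _ (K^o) ofR (fun=> b)); last exact: at_cst.
  exact: ofR_continuous.
apply: (@filterS _ (nbhs (0 : R)) _ _ _ _ (c0 _ (fg _ e1))) => h /=.
rewrite rmorphD mulrDl addrA scalerA => /le_trans; apply.
rewrite nrmM nrm_ofR (_ : _ * (_ * _) = e * `|h| * (nrm b / (nrm b + 1))); last by ring.
by rewrite ler_piMr ?mulr_ge0 ?(ltW e0) // ler_pdivrMr // mul1r lerDl.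
Qed.

Lemma rderZ c s v a : rder c s v -> rder (fun s => a *: c s) s (a *: v).
Proof.
move=> cv e e0; have a0 : 0 < nrm a + 1 by rewrite ltr_wpDl // nrm_ge0.
have e1 : 0 < e / (nrm a + 1) by rewrite divr_gt0.
have := cv _ e1; apply: filterS => h hh.
rewrite -!scalerBr scalerA [_ * a]mulrC -scalerA -scalerBr csemiZ //.
apply: le_trans (ler_wpM2l (nrm_ge0 _) hh) _.
rewrite (_ : _ * (_ * _) = e * `|h| * (nrm a / (nrm a + 1))); last by ring.
by rewrite ler_piMr ?mulr_ge0 ?(ltW e0) // ler_pdivrMr // mul1r lerDl.
Qed.

Lemma rderD c d s v w : rder c s v -> rder d s w -> rder (fun s => c s + d s) s (v + w).
Proof.
move=> cv dw e e0; have e2 : 0 < e / 2 by rewrite divr_gt0.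
apply: filterS2 (cv _ e2) (dw _ e2) => h h1 h2.
rewrite scalerDr !opprD [X in q (X + _)]addrACA [X in q X]addrACA.
apply: le_trans (csemiD hq _ _) _; rewrite [e in leRHS]splitr mulrDl; exact: lerD.
Qed.

Lemma rder_cst v s : rder (fun=> v) s 0.
Proof.
by move=> e e0; apply: filterE => h; rewrite scaler0 !subr0 subrr csemi0 // mulr_ge0 // ltW.
Qed.

Lemma rder_sum n (c : 'I_n -> R -> H) s v : (forall i, rder (c i) s (v i)) ->
  rder (fun s => \sum_(i < n) c i s) s (\sum_(i < n) v i).
Proof.
move=> hc; elim: (index_enum _) => [|i r IH].
  rewrite big_nil [X in rder X](_ : _ = fun=> 0); first exact: rder_cst.
  by apply/funext => z; rewrite big_nil.
rewrite big_cons [X in rder X](_ : _ = fun s => c i s + \sum_(j <- r) c j s).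
  exact: rderD.
by apply/funext => z; rewrite big_cons.
Qed.

Lemma disc_convex (r : R) (z z' : K) s : nrm z <= r -> nrm z' <= r -> 0 <= s <= 1 ->
  nrm (z + ofR s * (z' - z)) <= r.
Proof.
move=> zr zr' /andP[s0 s1].
have -> : z + ofR s * (z' - z) = ofR (1 - s) * z + ofR s * z'.
  by rewrite rmorphB rmorph1; ring.
apply: le_trans (nrmD _ _) _; rewrite !nrmM !nrm_ofR !ger0_norm ?subr_ge0 //.
have h1 : (1 - s) * nrm z <= (1 - s) * r by rewrite ler_wpM2l // subr_ge0.
have h2 : s * nrm z' <= s * r by rewrite ler_wpM2l.
lra.
Qed.

Lemma cder_mvt f g r M v z z' : (forall x, nrm x <= r -> cder f g x) ->
  nrm z <= r -> nrm z' <= r ->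
  (forall s, 0 <= s <= 1 -> q (g (z + ofR s * (z' - z)) - v) <= M) ->
  q (f z' - f z - (z' - z) *: v) <= M * nrm (z' - z).
Proof.
move=> fg zr zr' gM.
pose c s := f (z + ofR s * (z' - z)) + (- 1) *: (ofR s *: ((z' - z) *: v)).
have -> : f z' - f z - (z' - z) *: v = c 1 - c 0.
  rewrite /c rmorph0 rmorph1 mul0r addr0 scale0r scaler0 addr0 mul1r scale1r scaleN1r.
  by rewrite [z + _]addrC subrK addrAC.
apply: rder_mvt => s s01.
exists ((z' - z) *: g (z + ofR s * (z' - z)) + (-1) *: ((z' - z) *: v)).
  apply: rderD; first by apply/rder_affine/fg/disc_convex.
  apply: rderZ => e e0; apply: filterE => h.
  by rewrite rmorphD scalerDl [_ + ofR h *: _]addrC addrK subrr csemi0 // mulr_ge0 // ltW.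
rewrite scaleN1r -scalerBr csemiZ // mulrC ler_wpM2r ?nrm_ge0 //; exact: gM.
Qed.

Variables (phi : nat -> K -> H) (rho r : R).
(* The case of interest is phi i z = D_y^i f(x + z y). *)
Hypothesis chain : forall i z, nrm z < rho -> cder (phi i) (phi i.+1) z.
Hypotheses (r1 : 1 < r) (rrho : r < rho).

Let r0 : 0 < r. Proof. exact: lt_trans r1. Qed.

(** Having the q-derivative phi i.+1, the map phi i is q-continuous on the disc, which is
    compact. *)
Lemma chain_bound i : exists2 M, 0 < M & forall z, nrm z <= r -> q (phi i z) <= M.
Proof.
have [//|M M0 hM] := @compact_bound R K _ (fun z => q (phi i z)) (@compact_disc R k r).
  move=> z zr; have z1 : nrm z < rho by exact: le_lt_trans rrho.
  apply/(@cvgrPdist_lt _ _ _ (nbhs z) (nbhs_filter z)) => e e0.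
  pose A := q (phi i.+1 z) + 1.
  have A0 : 0 < A by rewrite ltr_wpDl // csemi_ge0.
  have /nbhs_nrm[d d0 hd] := chain i z1 ltr01.
  apply/nbhs_nrm; exists (Num.min d (e / A)); first by rewrite lt_min d0 divr_gt0.
  move=> y; rewrite lt_min => /andP[yd ye].
  have := hd (y - z); rewrite subr0 [z + _]addrC subrK mul1r => /(_ yd) h.
  rewrite distrC; apply: le_lt_trans (csemi_lip hq _ _) _.
  apply: (@le_lt_trans _ _ (A * nrm (y - z))); last by rewrite mulrC -ltr_pdivlMr.
  rewrite -[X in q X <= _](subrK ((y - z) *: phi i.+1 z)).
  apply: le_trans (csemiD hq _ _) _; rewrite csemiZ // /A mulrDl mul1r [leRHS]addrC.
  by apply: lerD => //; rewrite mulrC.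
by exists M.
Qed.

Lemma chain_lip i M z z' : (forall z, nrm z <= r -> q (phi i.+1 z) <= M) ->
  nrm z <= r -> nrm z' <= r -> q (phi i z' - phi i z) <= M * nrm (z' - z).
Proof.
move=> hM zr zr'.
have := @cder_mvt (phi i) (phi i.+1) r M 0 z z'; rewrite scaler0 subr0.
apply=> // [x xr|s s01].
  by apply: chain; exact: le_lt_trans rrho.
by rewrite subr0; apply: hM; exact: disc_convex.
Qed.

(** The mean value inequality is used for phi i.+1 and then for phi i; the factor 1/2 is given
    away. *)
Lemma chain_taylor i M z z' : (forall z, nrm z <= r -> q (phi i.+2 z) <= M) ->
  nrm z <= r -> nrm z' <= r ->
  q (phi i z' - phi i z - (z' - z) *: phi i.+1 z) <= M * nrm (z' - z) ^+ 2.
Proof.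
move=> hM zr zr'; rewrite expr2 mulrA.
apply: (@cder_mvt _ (phi i.+1) r) => // [x xr|s s01].
  by apply: chain; exact: le_lt_trans rrho.
have M0 : 0 <= M by apply: le_trans (hM z zr); exact: csemi_ge0.
apply: le_trans (chain_lip hM zr (disc_convex zr zr' s01)) _.
rewrite ler_wpM2l // [z + _ * _]addrC addrK nrmM nrm_ofR; case/andP: s01 => s0 s1.
by rewrite ger0_norm // ler_piMl // nrm_ge0.
Qed.

Section cauchy.
Variables (n : nat) (w : K).
Hypothesis hw : unit_root n w.

Let z (j : 'I_n) : K := ofR r * w ^+ j.
Let n0 : (0 < n)%N. Proof. by case: hw. Qed.

Let zr j : nrm (z j) = r.
Proof. by rewrite nrmM nrm_ofR (unit_root_nrm hw) mulr1 gtr0_norm. Qed.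

Let zr' j : nrm (z j) <= r. Proof. by rewrite zr. Qed.
Let zn0 j : z j != 0. Proof. by rewrite -nrm_eq0 zr gt_eqF. Qed.

(* The m-th Cauchy coefficient of phi i on the circle of radius r, up to an error that
   vanishes as w tends to 1. *)
Definition coef i m : H := avg (fun j => (z j)^-1 ^+ m *: phi i (z j)).

Let zw j : nrm (w * z j) <= r.
Proof. by rewrite nrmM zr; have [_ -> _ _] := hw; rewrite mul1r. Qed.

Lemma coef_le i m M : (forall z, nrm z <= r -> q (phi i z) <= M) ->
  q (coef i m) <= M * r^-1 ^+ m.
Proof.
move=> hM; apply: avg_le => // j.
by rewrite csemiZ // nrmX nrmV zr mulrC ler_wpM2r ?hM // exprn_ge0 // invr_ge0 ltW.
Qed.

Let wz (j : 'I_n) : w * z j = ofR r * w ^+ j.+1.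
Proof. by rewrite /z exprS; ring. Qed.

Let avg_rot (F : K -> H) : avg (fun j => F (w * z j)) = avg (fun j => F (z j)).
Proof.
rewrite /avg; congr (_ *: _); under eq_bigr do rewrite wz.
exact: (sum_rot hw (fun x => F (ofR r * x))).
Qed.

Let nrm_Xsub1 m : nrm (w ^+ m - 1) <= m%:R * nrm (w - 1).
Proof.
elim: m => [|m IH]; first by rewrite expr0 subrr nrm0 mul0r.
have -> : w ^+ m.+1 - 1 = w * (w ^+ m - 1) + (w - 1) by rewrite exprS; ring.
apply: le_trans (nrmD _ _) _; rewrite nrmM; have [_ -> _ _] := hw.
by rewrite mul1r -natr1 mulrDl mul1r lerD2r.
Qed.

(* Rotating the sample points by w does not change the average: this replaces the
   integration by parts that relates the coefficients of a function and its derivative. *)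
Lemma coef_rec i m M0 M2 : w != 1 -> 0 <= M0 ->
  (forall z, nrm z <= r -> q (phi i z) <= M0) ->
  (forall z, nrm z <= r -> q (phi i.+2 z) <= M2) ->
  q (coef i.+1 m - m.+1%:R *: coef i m.+1) <=
    (M2 * r ^+ 2 + m.+1%:R ^+ 2 * M0) * nrm (w - 1).
Proof.
move=> w1 M00 hM0 hM2; have wn0 := unit_root_neq0 hw.
have M20 : 0 <= M2 by apply: le_trans (hM2 0 _); rewrite ?csemi_ge0 // nrm0 ltW.
pose E j := phi i (w * z j) - phi i (z j) - (w * z j - z j) *: phi i.+1 (z j).
pose A := avg (fun j => (z j)^-1 ^+ m.+1 *: E j).
pose S := \sum_(l < m.+1) w ^+ l.
have d0 : 0 < nrm (w - 1) by rewrite nrm_gt0 subr_eq0.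
have ri : r^-1 ^+ m.+1 <= 1 by rewrite exprn_ile1 // ?invr_ge0 ?ltW // invf_lt1.
(* The factor w - 1 turns S into w^(m+1) - 1, and by rotation invariance w^(m+1) times the
   coefficient m + 1 is the average of z^-(m+1) phi i (w z). What remains is the averaged Taylor
   remainder. *)
have EA : (w - 1) *: (S *: coef i m.+1 - coef i.+1 m) = A.
  rewrite scalerBr scalerA -subrX1 scalerBl scale1r.
  have -> : w ^+ m.+1 *: coef i m.+1 = avg (fun j => (z j)^-1 ^+ m.+1 *: phi i (w * z j)).
    rewrite {1}/coef -(avg_rot (fun x => x^-1 ^+ m.+1 *: phi i x)) -avgZ.
    apply: avg_eq => j; rewrite scalerA invfM exprMn mulrA -exprMn mulfV // expr1n mul1r //.
  rewrite -avgB -avgZ -avgB; apply: avg_eq => j.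
  rewrite /E !scalerBr; congr (_ - _ - _); rewrite !scalerA; congr (_ *: _).
  rewrite exprSr -mulrA (_ : (z j)^-1 * _ = w - 1); first exact: mulrC.
  by rewrite -[X in _ * (_ - X)]mul1r -mulrBl mulrCA mulVf // mulr1.
have qA : q A <= M2 * r ^+ 2 * nrm (w - 1) ^+ 2.
  apply: avg_le => // j; rewrite csemiZ // nrmX nrmV zr.
  have hE : q (E j) <= M2 * r ^+ 2 * nrm (w - 1) ^+ 2.
    apply: le_trans (chain_taylor hM2 (zr' j) (zw j)) _.
    by rewrite -[X in w * z j - X]mul1r -mulrBl nrmM zr exprMn -mulrA [r ^+ 2 * _]mulrC.
  by apply: le_trans (ler_piMl _ ri) hE; exact: csemi_ge0.
have h1 : q (coef i.+1 m - S *: coef i m.+1) <= M2 * r ^+ 2 * nrm (w - 1).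
  rewrite csemiB // -(ler_pM2l d0) -csemiZ // EA; apply: le_trans qA _.
  by rewrite le_eqVlt; apply/orP; left; apply/eqP; ring.
(* Each of the m + 1 powers of w in S differs from 1 by at most (m + 1) |w - 1|. *)
have h2 : q ((S - m.+1%:R) *: coef i m.+1) <= m.+1%:R ^+ 2 * M0 * nrm (w - 1).
  rewrite csemiZ // mulrAC; apply: ler_pM; rewrite ?nrm_ge0 ?csemi_ge0 //; last first.
    by apply: le_trans (coef_le _ hM0) _; rewrite ler_piMr.
  have -> : S - m.+1%:R = \sum_(l < m.+1) (w ^+ l - 1).
    by rewrite sumrB sumr_const card_ord.
  apply: le_trans (_ : \sum_(l < m.+1) nrm (w ^+ l - 1) <= _).
    elim/big_rec2: _ => [|l x y _ xy]; first by rewrite nrm0.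
    by apply: le_trans (nrmD _ _) _; rewrite lerD2l.
  apply: (@le_trans _ _ (\sum_(l < m.+1) m.+1%:R * nrm (w - 1))).
    apply: ler_sum => l _; apply: le_trans (nrm_Xsub1 _) _.
    by rewrite ler_wpM2r ?nrm_ge0 // ler_nat ltnW.
  rewrite sumr_const card_ord -[_ *+ _]mulr_natl.
  by rewrite le_eqVlt; apply/orP; left; apply/eqP; ring.
have -> : coef i.+1 m - m.+1%:R *: coef i m.+1 =
    (coef i.+1 m - S *: coef i m.+1) + (S - m.+1%:R) *: coef i m.+1.
  by rewrite scalerBl addrA subrK.
by apply: le_trans (csemiD hq _ _) _; rewrite mulrDl; exact: lerD.
Qed.

(** A discrete homotopy from u to the circle. With k_j the sum of (u / z_j)^m over m < N, the
    average I s of k_j phi i (u + s (z_j - u)) is the partial sum at s = 1, and it is phi i u at s =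
    0, because the powers z_j^-m with 0 < m < n average to 0. In the derivative of I, the identity
    k_j (z_j - u) = z_j - (u / z_j)^N z_j separates a Cauchy term of size |w - 1| from the remainder
    of the geometric series. *)
Lemma cauchy_sum i (u : K) N M1 M2 : w != 1 -> (0 < N <= n)%N -> nrm u <= r ->
  (forall z, nrm z <= r -> q (phi i.+1 z) <= M1) ->
  (forall z, nrm z <= r -> q (phi i.+2 z) <= M2) ->
  q (\sum_(m < N) u ^+ m *: coef i m - phi i u) <=
    M2 * r ^+ 2 * nrm (w - 1) + M1 * r * (nrm u / r) ^+ N.
Proof.
move=> w1 /andP[N0 Nn] ur hM1 hM2.
have M20 : 0 <= M2 by apply: le_trans (hM2 0 _); rewrite ?csemi_ge0 // nrm0 ltW.
have d0 : 0 < nrm (w - 1) by rewrite nrm_gt0 subr_eq0.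
pose kj j := \sum_(m < N) (u * (z j)^-1) ^+ m.
pose I s := avg (fun j => kj j *: phi i (u + ofR s * (z j - u))).
have I1 : I 1 = \sum_(m < N) u ^+ m *: coef i m.
  transitivity (avg (fun j => \sum_(m < N) u ^+ m *: ((z j)^-1 ^+ m *: phi i (z j)))).
    apply: avg_eq => j; rewrite rmorph1 mul1r [u + _]addrC subrK scaler_suml.
    by apply: eq_bigr => m _; rewrite scalerA exprMn.
  by rewrite avg_sum; apply: eq_bigr => m _; rewrite avgZ.
have I0 : I 0 = phi i u.
  transitivity (avg (fun j => kj j *: phi i u)).
    by apply: avg_eq => j; rewrite rmorph0 mul0r addr0.
  rewrite avg_scalar exchange_big /=.
  have E (m : 'I_N) : \sum_(j < n) (u * (z j)^-1) ^+ m = (n * (m == 0%N :> nat))%:R.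
    under eq_bigr do rewrite exprMn /z invfM exprMn mulrA.
    rewrite -mulr_sumr (sum_unit_rootV hw); last exact: leq_trans Nn.
    by case: eqP => [->|_]; rewrite ?muln0 ?mulr0 // !expr0 !mul1r.
  under eq_bigr do rewrite E.
  case: N N0 {Nn kj I I1 E} => // N _; rewrite big_ord_recl /= muln1 big1.
    by rewrite addr0 mulVf ?scale1r // (unit_root_n hw).
  by move=> m _; rewrite muln0.
rewrite -I1 -I0; apply: rder_mvt => s s01.
pose xi j := u + ofR s * (z j - u).
have xir j : nrm (xi j) <= r by exact: disc_convex.
exists (avg (fun j => kj j *: ((z j - u) *: phi i.+1 (xi j)))).
  apply: (@rderZ (fun s => \sum_(j < n) kj j *: phi i (u + ofR s * (z j - u)))).
  apply: (@rder_sum n (fun j s => kj j *: phi i (u + ofR s * (z j - u)))) => j.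
  apply: (@rderZ (fun s => phi i (u + ofR s * (z j - u)))).
  apply: (@rder_affine (phi i) (phi i.+1)).
  by apply: chain; apply: le_lt_trans rrho; exact: xir.
have Ek j : kj j * (z j - u) = z j - (u * (z j)^-1) ^+ N * z j.
  have -> : z j - u = (1 - u * (z j)^-1) * z j by rewrite mulrBl mul1r divfK.
  rewrite mulrA (_ : kj j * _ = 1 - (u * (z j)^-1) ^+ N); first by rewrite mulrBl mul1r.
  by rewrite -[RHS]opprB subrX1 -[RHS]mulNr opprB mulrC.
have -> : avg (fun j => kj j *: ((z j - u) *: phi i.+1 (xi j))) =
    avg (fun j => z j *: phi i.+1 (xi j)) -
    avg (fun j => ((u * (z j)^-1) ^+ N * z j) *: phi i.+1 (xi j)).
  by rewrite -avgB; apply: avg_eq => j; rewrite scalerA Ek scalerBl.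
apply: le_trans (csemiD hq _ _) _; rewrite csemiN //; apply: lerD; last first.
  apply: avg_le => // j; rewrite csemiZ // nrmM nrmX nrmM nrmV zr.
  rewrite [leRHS](_ : _ = (nrm u / r) ^+ N * r * M1); last by ring.
  apply: ler_wpM2l; last exact: hM1.
  by rewrite mulr_ge0 ?exprn_ge0 ?divr_ge0 ?nrm_ge0 // ltW.
(* The rotation argument divides by s; for s = 0 the z_j average to 0 exactly. *)
have [s00|s0] := eqVneq s 0.
  rewrite (_ : avg _ = 0) ?csemi0 ?mulr_ge0 ?exprn_ge0 ?nrm_ge0 // ?(ltW r0) //.
  transitivity (avg (fun j => z j *: phi i.+1 u)).
    by apply: avg_eq => j; rewrite /xi s00 rmorph0 mul0r addr0.
  rewrite avg_scalar /z -mulr_sumr sum_unit_rootX ?mulr0 ?scale0r //.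
  by case: hw.
have s0' : 0 < s by rewrite lt_def s0; case/andP: s01.
pose xi' j := u + ofR s * (w * z j - u).
have xir' j : nrm (xi' j) <= r by exact: disc_convex.
have xixi j : xi' j - xi j = (ofR s * (w - 1)) * z j by rewrite /xi' /xi; ring.
pose E j := phi i (xi' j) - phi i (xi j) - (xi' j - xi j) *: phi i.+1 (xi j).
(* The averages of phi i over the points xi and over the rotated points xi' coincide, so that only
   linear terms and remainders survive. *)
have EA : (ofR s * (w - 1)) *: avg (fun j => z j *: phi i.+1 (xi j)) = - avg E.
  have : avg (fun j => phi i (xi' j)) - avg (fun j => phi i (xi j)) = 0.
    by rewrite (avg_rot (fun x => phi i (u + ofR s * (x - u)))) subrr.
  rewrite -avgB => h0; rewrite /E avgB h0 sub0r opprK -avgZ; apply: avg_eq => j.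
  by rewrite xixi scalerA.
have sd0 : 0 < nrm (ofR s * (w - 1)) by rewrite nrmM nrm_ofR gtr0_norm // mulr_gt0.
rewrite -(ler_pM2l sd0) -csemiZ // EA csemiN //.
apply: avg_le => // j; apply: le_trans (chain_taylor hM2 (xir j) (xir' j)) _.
have nsw : nrm (ofR s * (w - 1)) = s * nrm (w - 1) by rewrite nrmM nrm_ofR gtr0_norm.
rewrite xixi nrmM zr nsw; case/andP: s01 => _ s1.
have -> : M2 * (s * nrm (w - 1) * r) ^+ 2 = s * (M2 * (s * nrm (w - 1) ^+ 2 * r ^+ 2)) by ring.
rewrite -[X in _ <= X]mulrA ler_wpM2l ?(ltW s0') //.
have -> : M2 * (s * nrm (w - 1) ^+ 2 * r ^+ 2) = s * (nrm (w - 1) * (M2 * r ^+ 2 * nrm (w - 1))).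
  by ring.
by rewrite ler_piMl // !mulr_ge0 ?nrm_ge0 // ltW.
Qed.
End cauchy.

(** True over the complex numbers ([unit_roots]) and false over the reals: complex differentiability
    enters here. *)
Hypothesis roots : forall e N, 0 < e -> exists n w,
  [/\ (N < n)%N, unit_root n w, w != 1 & nrm (w - 1 : K) < e].

(** Induction on m: [coef_rec] trades the coefficient m + 1 of phi i for the coefficient m of phi
    i.+1, and m = 0 is [cauchy_sum] with u = 0 and a single term, where the geometric error
    vanishes. It matters that B does not depend on w. *)
Lemma coef_lim i m : exists2 B, 0 <= B & forall n w (hw : unit_root n w), w != 1 ->
  q (m`!%:R *: coef n w i m - phi (i + m)%N 0) <= B * nrm (w - 1).
Proof.
elim: m i => [|m IH] i.
  have [M2 M20 hM2] := chain_bound i.+2; have [M1 _ hM1] := chain_bound i.+1.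
  exists (M2 * r ^+ 2); first by rewrite mulr_ge0 ?exprn_ge0 // ltW.
  move=> n w hw w1; have [n0 _ _ _] := hw.
  have := @cauchy_sum n w hw i 0 1 M1 M2 w1; rewrite n0 nrm0 => /(_ isT (ltW r0) hM1 hM2).
  by rewrite big_ord1 expr0 addn0 scale1r mul0r expr1 mulr0 addr0.
have [B B0 hB] := IH i.+1.
have [M0 M00 hM0] := chain_bound i; have [M2 M20 hM2] := chain_bound i.+2.
exists (m`!%:R * (M2 * r ^+ 2 + m.+1%:R ^+ 2 * M0) + B).
  by rewrite addr_ge0 // mulr_ge0 // addr_ge0 // mulr_ge0 ?exprn_ge0 // ltW.
move=> n w hw w1; have h1 := hB n w hw w1.
have h2 := @coef_rec n w hw i m M0 M2 w1 (ltW M00) hM0 hM2.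
have -> : m.+1`!%:R *: coef n w i m.+1 - phi (i + m.+1)%N 0 =
   (m`!%:R *: coef n w i.+1 m - phi (i.+1 + m)%N 0) -
   m`!%:R *: (coef n w i.+1 m - m.+1%:R *: coef n w i m.+1).
  have -> : m.+1`!%:R *: coef n w i m.+1 = m`!%:R *: (m.+1%:R *: coef n w i m.+1).
    by rewrite scalerA -natrM mulnC.
  by rewrite scalerBr opprB [RHS]addrC addrA subrK addnS addSn.
apply: le_trans (csemiD hq _ _) _; rewrite csemiN // csemiZ // nrm_nat.
by rewrite mulrDl addrC; apply: lerD => //; rewrite -mulrA; exact: ler_wpM2l.
Qed.

(** For fixed N, roots w close to 1 replace the coefficients by phi m 0 / m! at arbitrarily small
    cost, leaving the geometric error M1 r r^-N. Only then does N tend to infinity, where 1 < r is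
    used. *)
Lemma chain_sum (e : R) : 0 < e -> \forall N \near \oo,
  q (\sum_(m < N) (m`!%:R)^-1 *: phi m 0 - phi 0%N 1) < e.
Proof.
move=> e0; have [M1 M10 hM1] := chain_bound 1; have [M2 M20 hM2] := chain_bound 2.
have hN N : (0 < N)%N ->
    q (\sum_(m < N) (m`!%:R)^-1 *: phi m 0 - phi 0%N 1) <= M1 * r * r^-1 ^+ N.
  move=> N0; apply/ler_addgt0Pr => d d0.
  have /choice[B hB] m : exists B, 0 <= B /\ forall n w (hw : unit_root n w), w != 1 ->
      q (m`!%:R *: coef n w 0 m - phi m 0) <= B * nrm (w - 1).
    by have [B B0 hB] := coef_lim 0 m; exists B.
  (* Total of the constants in front of |w - 1|: the N coefficient errors and the one of
     [cauchy_sum]. *)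
  pose T := \sum_(m < N) B m + M2 * r ^+ 2.
  have T0 : 0 <= T.
    rewrite addr_ge0 ?mulr_ge0 ?exprn_ge0 ?(ltW r0) ?(ltW M20) //.
    by apply: sumr_ge0 => m _; have [] := hB m.
  have dT : 0 < d / (T + 1) by rewrite divr_gt0 // ltr_wpDl.
  have [n [w [Nn hw w1 wd]]] := roots N dT.
  have := @cauchy_sum n w hw 0 1 N M1 M2 w1.
  rewrite N0 (ltnW Nn) nrm1 => /(_ isT (ltW r1) hM1 hM2).
  rewrite div1r => h1.
  have h2 : q (\sum_(m < N) ((m`!%:R)^-1 *: phi m 0 - coef n w 0 m)) <=
      \sum_(m < N) B m * nrm (w - 1).
    apply: le_trans (csemi_sum hq _ _ _) _; apply: ler_sum => m _.
    have mf0 : (m`!%:R : K) != 0 by rewrite pnatr_eq0 -lt0n fact_gt0.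
    have -> : (m`!%:R)^-1 *: phi m 0 - coef n w 0 m =
        (m`!%:R)^-1 *: (phi m 0 - m`!%:R *: coef n w 0 m).
      by rewrite scalerBr scalerA mulVf // scale1r.
    rewrite csemiZ // csemiB // nrmV nrm_nat; have [_ hBm] := hB m.
    apply: le_trans (hBm _ _ hw w1); rewrite ler_piMl ?csemi_ge0 //.
    by rewrite invf_le1 ?ltr0n ?fact_gt0 // ler1n fact_gt0.
  have -> : \sum_(m < N) (m`!%:R)^-1 *: phi m 0 - phi 0%N 1 =
      \sum_(m < N) ((m`!%:R)^-1 *: phi m 0 - coef n w 0 m) +
      (\sum_(m < N) 1 ^+ m *: coef n w 0 m - phi 0%N 1).
    rewrite sumrB addrA; congr (_ - _); under [X in _ - _ + X]eq_bigr do rewrite expr1n scale1r.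
    by rewrite subrK.
  apply: le_trans (csemiD hq _ _) _.
  rewrite -mulr_suml in h2.
  have h3 : T * nrm (w - 1) <= d.
    apply: (@le_trans _ _ (T * (d / (T + 1)))); first by rewrite ler_wpM2l // ltW.
    by rewrite mulrCA ler_piMr ?(ltW d0) // ler_pdivrMr ?mul1r ?lerDl // ltr_wpDl.
  move: h3; rewrite /T mulrDl; lra.
have A0 : 0 < M1 * r by rewrite mulr_gt0.
have : r^-1 ^+ N @[N --> \oo] --> (0 : R).
  by apply: cvg_expr; rewrite gtr0_norm ?invr_gt0 // invf_lt1.
move=> /cvgrPdist_lt /(_ (e / (M1 * r)) (divr_gt0 e0 A0)) h.
near=> N; apply: le_lt_trans (hN N _) _; first by near: N; exact: nbhs_infty_gt.
rewrite mulrC -ltr_pdivlMr //; near: N; move: h; apply: filterS => N.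
by rewrite sub0r normrN ger0_norm // exprn_ge0 // invr_ge0 ltW.
Unshelve. all: by end_near. Qed.
End chain.

(** * Roots of unity close to 1 *)

Section roots.
Variable R : realType.
Local Notation C := (Fld R ScC).

Lemma nrm_sqrC (z : R[i]) : nrm (z : C) ^+ 2 = complex.Re z ^+ 2 + complex.Im z ^+ 2.
Proof. by rewrite /nrm normc_def /= sqr_sqrtr // addr_ge0 // sqr_ge0. Qed.

(** Repeated square roots with nonnegative real part, starting from -1. If v^2 = u, then |v - 1| |v
    + 1| = |u - 1|, and |v + 1|^2 >= 2 since |v| = 1, so the squared distance to 1 is at least
    halved. *)
Lemma half_root m : exists u : C, u ^+ (2 ^ m) = -1 /\ nrm (u - 1) ^+ 2 <= 4 / 2 ^+ m.
Proof.
elim: m => [|m [u [um u1]]].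
  exists (-1); rewrite expn0 !expr1 expr0 divr1; split => //.
  by rewrite -opprD nrmN -mulr2n nrm_nat -natrX.
have [v [vu v0]] : exists v : R[i], v ^+ 2 = u /\ 0 <= complex.Re v.
  have [h|h] := leP 0 (complex.Re (sqrtc u)).
    by exists (sqrtc u); rewrite sqr_sqrtc.
  exists (- sqrtc u); rewrite sqrrN sqr_sqrtc raddfN; split => //.
  by rewrite oppr_ge0 ltW.
exists v; split; first by rewrite expnS exprM vu.
have v1 : nrm (v : C) = 1.
  apply/eqP; rewrite -(@pexpr_eq1 _ _ (2 ^ m.+1)) ?expn_gt0 ?nrm_ge0 //.
  by rewrite -nrmX expnS exprM vu um nrmN nrm1.
have e1 : nrm (v - 1 : C) ^+ 2 * nrm (v + 1 : C) ^+ 2 = nrm (u - 1) ^+ 2.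
  rewrite -exprMn -nrmM -subr_sqr expr1n.
  by have -> : (v : C) ^+ 2 = u by exact: vu.
have e2 : 2 <= nrm (v + 1 : C) ^+ 2.
  have := nrm_sqrC v; rewrite v1 expr1n; rewrite (nrm_sqrC (v + 1)).
  by case: v v0 {vu v1 e1} => a b /= a0; rewrite addr0 sqrrD expr1n mulr1 => ->; nra.
have d0 : 0 <= nrm (v - 1 : C) ^+ 2 by rewrite exprn_ge0 // nrm_ge0.
have p0 : (0 : R) < 2 ^+ m by rewrite exprn_gt0.
rewrite [2 ^+ m.+1]exprS ler_pdivlMr ?mulr_gt0 //.
move: u1; rewrite -e1 ler_pdivlMr //.
set A := nrm _ ^+ 2 in e2 *; nra.
Qed.

(** As u^(2^m) = -1 is not 1, the order of u divides 2^(m+1) but not 2^m, hence equals 2^(m+1). The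
    choice of m ensures both 4 / 2^m < e^2 and N < 2^(m+1). *)
Lemma unit_roots (e : R) N : 0 < e -> exists n w,
  [/\ (N < n)%N, unit_root n w, w != 1 & nrm (w - 1 : C) < e].
Proof.
move=> e0.
pose m := (Num.Def.archi_bound (4 / e ^+ 2) + N).+1.
have [u [um u1]] := half_root m.
have m1 : (-1 : C) != 1 by rewrite eq_sym -subr_eq0 opprK -mulr2n pnatr_eq0.
have un : u ^+ (2 ^ m.+1) = 1 by rewrite expnSr exprM um sqrrN expr1n.
have un1 : u != 1 by apply: contraNneq m1 => u1'; rewrite -um u1' expr1n.
have [d pd] := prim_order_exists (n := 2 ^ m.+1) ltac:(by rewrite expn_gt0) un.
move=> /dvdn_pfactor -/(_ isT)[j jm dj].
have {jm}jm : j = m.+1.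
  apply/eqP; rewrite eqn_leq jm ltnNge /=; apply: contraNN m1 => jm'.
  rewrite -um -(prim_order_dvd pd) dj.
  by apply/dvdn_pfactor => //; exists j.
exists (2 ^ m.+1)%N, u; split => //.
- apply: (@ltn_trans m.+1); last exact: ltn_expl.
  by rewrite /m !ltnS leqW // leq_addl.
- split => //; first by rewrite expn_gt0.
    apply/eqP; rewrite -(@pexpr_eq1 _ _ (2 ^ m.+1)) ?expn_gt0 ?nrm_ge0 //.
    by rewrite -nrmX un nrm1.
  move=> i /andP[i0 im]; rewrite -(prim_order_dvd pd) dj jm.
  by apply: contraTN im => /(dvdn_leq i0); rewrite -leqNgt.
- rewrite -(@ltr_pXn2r _ 2) ?nnegrE ?nrm_ge0 ?(ltW e0) //.
  apply: le_lt_trans u1 _; rewrite ltr_pdivrMr ?exprn_gt0 //.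
  rewrite mulrC -ltr_pdivrMr ?exprn_gt0 //.
  have h0 : 0 <= 4 / e ^+ 2 by rewrite divr_ge0 // exprn_ge0 // ltW.
  apply: lt_le_trans (archi_boundP h0) _.
  rewrite -natrX ler_nat; apply: (@leq_trans m); last exact/ltnW/ltn_expl.
  by rewrite /m leqW // leq_addr.
Qed.
End roots.

Section dirder_closed.
Variables (R : realType) (k : Defs.scalar).
Local Notation K := (Fld R k).
Variables (X H : tvsType K).
Hypothesis hH : hausdorff_space H.

Lemma CK_dirder n (U : set X) (f : X -> H) y : CK n.+1 U f -> CK n U (dirder y f).
Proof.
move=> [oU _ [F fF cF]].
have C1 : CK n U (fun x : X => (x, y) : (X * X)%type).
  by apply: CK_pair; [apply: CK_clin => //; exact: clin_id|exact: CK_cst].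
apply: CK_ext (CK_comp C1 cF _) => //= x Ux.
by rewrite (dirderE hH (fF x y Ux)).
Qed.

Lemma CK_iterD n (U : set X) (f : X -> H) ys : CK (n + size ys) U f ->
  CK n U (iterD f ys).
Proof.
elim: ys f => [|y ys IH] f /=; first by rewrite addn0.
by rewrite addnS => /(CK_dirder y); exact: IH.
Qed.

(** Along the line z -> x + z y the derivatives in the direction y form a chain to which [chain_sum]
    applies. *)
Lemma iterD_cder (U : set X) (f : X -> H) x y (q : H -> R) : csemi q ->
  (forall n, CK n U f) -> forall m (z : K), U (x + z *: y) ->
  cder q (fun z : K => iterD f (nseq m y) (x + z *: y))
         (fun z : K => iterD f (nseq m.+1 y) (x + z *: y)) z.
Proof.
move=> hq Cf m z Uz e e0.
have [_ _ df _] := CK_Cfin hH (Cf m.+1).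
have h : is_dirder (iterD f (nseq m y)) (x + z *: y) y (iterD f (nseq m.+1 y) (x + z *: y)).
  rewrite (_ : nseq m.+1 y = rcons (nseq m y) y); last by elim: m {df} => //= m <-.
  by rewrite iterD_rcons; apply: dirderP => //; apply: df => //; rewrite size_nseq.
have /is_dirderP /(_ q hq e e0) := h; apply: filterS => t.
by rewrite scalerDl addrA.
Qed.

Lemma nbhs_disc (x : X) (U : set X) (r : R) : 0 < r -> nbhs x U ->
  nbhs 0 [set y | forall z : K, nrm z <= r -> U (x + z *: y)].
Proof.
move=> r0 nU; have := nbhsB (- x) nU; rewrite addNr => /balanced_convex_nbhd[B [nB BU Bb _]].
have rn : (ofR r^-1 : K) != 0 by rewrite fmorph_eq0 invr_eq0 gt_eqF.
apply: filterS (nbhs0Z rn nB) => _ [y By <-] z zr.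
have [u Uu] : (+%R (- x) @` U) (z *: (ofR r^-1 *: y)).
  apply: BU; rewrite scalerA; apply: Bb => //.
  by rewrite nrmM nrm_ofR gtr0_norm ?invr_gt0 // ler_pdivrMr // mul1r.
by move=> <-; rewrite addrA subrr add0r.
Qed.

(** The directions before the slot are absorbed into the function [iterD f us], which makes the slot
    the first direction. *)
Lemma iterD_slot (U : set X) (f : X -> H) us vs (a : K) u v x :
  (forall n, CK n U f) -> U x ->
  iterD f (us ++ a *: u + v :: vs) x =
    a *: iterD f (us ++ u :: vs) x + iterD f (us ++ v :: vs) x.
Proof.
move=> Cf Ux; have E ws : iterD f (us ++ ws) = iterD (iterD f us) ws.
  by rewrite /iterD foldl_cat.
rewrite !E; apply: (@iterD_hd _ _ _ _ U _ (size vs)) => //.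
exact/CK_Cfin/CK_iterD/Cf.
Qed.

Lemma iterD_multilinear (U : set X) (f : X -> H) m x : (forall n, CK n U f) -> U x ->
  multilinear (fun Y : 'I_m -> X => iterD f [seq Y i | i <- enum 'I_m] x).
Proof.
move=> Cf Ux Y i a u v.
have [s1 [s2 E]] : exists s1 s2, forall w, [seq dfwith Y i w j | j <- enum 'I_m] = s1 ++ w :: s2.
  have := enum_uniq 'I_m; case/splitPr: (mem_enum 'I_m i) => p1 p2.
  rewrite cat_uniq /= negb_or => /and3P[_ /andP[ip1 _] /andP[ip2 _]].
  exists [seq Y j | j <- p1], [seq Y j | j <- p2] => w.
  rewrite map_cat /= dfwithin; congr (_ ++ _ :: _); apply/eq_in_map => j jp.
    by rewrite dfwithout //; apply: contraNneq ip1 => ->.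
  by rewrite dfwithout //; apply: contraNneq ip2 => ->.
by rewrite !E (iterD_slot _ _ _ _ _ Cf).
Qed.
End dirder_closed.

(** * Complex and real analytic maps *)

Section CK_analytic.
Variables (R : realType).
Local Notation C := (Fld R ScC).
Variables (X H : tvsType C).
Hypothesis hH : hausdorff_space H.

Lemma taylor_cvg (U : set X) (f : X -> H) x y : (forall n, CK n U f) ->
  (forall z : C, nrm z <= 2 -> U (x + z *: y)) ->
  (\sum_(m < N) (m`!%:R)^-1 *: iterD f (nseq m y) x @[N --> \oo]) --> f (x + y).
Proof.
move=> Cf Uy; apply/cvg_csemi => q hq e e0.
(* The disc of radius 2 is known to be mapped into U; any radius strictly between 1 and 2 would
   do. *)
have r1 : (1 : R) < 3 / 2 by lra.
have r2 : (3 / 2 : R) < 2 by lra.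
have := @chain_sum R ScC H q hq (fun m z => iterD f (nseq m y) (x + z *: y)) 2 (3 / 2) _ r1 r2 (@unit_roots R) e e0.
rewrite scale0r addr0 scale1r; apply => m z z2.
by apply: iterD_cder Cf _ _ _ => //; apply: Uy; exact: ltW.
Qed.

Lemma CK_analytic (U : set X) (f : X -> H) : (forall n, CK n U f) ->
  @analytic_series C X H U f.
Proof.
move=> Cf; have [oU cf] := Cf 0%N; split => //; first exact/cont_onP.
move=> x Ux; exists (fun m y => (m`!%:R)^-1 *: iterD f (nseq m y) x).
exists [set y | forall z : C, nrm z <= 2 -> U (x + z *: y)]; split.
- move=> m; split.
    move=> y; apply: at_Z; first exact: at_cst.
    apply: (Cfin_cont_list (CK_Cfin hH (Cf m)) (t := y) (x0 := fun=> x)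
      (ls := nseq m id) (us := fun y => nseq m y)) => //.
    + by move=> z; rewrite map_nseq.
    + exact: at_cst.
    + by rewrite size_nseq.
    + by move=> i; rewrite size_nseq => im; rewrite nth_nseq im; exact: at_id.
  exists (fun Y : 'I_m -> X => (m`!%:R)^-1 *: iterD f [seq Y i | i <- enum 'I_m] x).
    move=> Y i a u v; rewrite (@iterD_multilinear _ _ _ _ hH U f m x Cf Ux Y i a u v).
    by rewrite scalerDr !scalerA mulrC.
  move=> y; congr (_ *: iterD f _ x).
  by rewrite -[in LHS](size_enum_ord m); elim: (enum _) => //= _ s ->.
- by apply: nbhs_disc => //; exact: open_nbhs_nbhs.
- move=> y Vy; split; first by have := Vy 1; rewrite scale1r nrm1; apply; lra.
  exact: taylor_cvg Cf Vy.
Qed.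
End CK_analytic.

(** * Multilinear maps on the diagonal *)

Section multilinear.
Variables (K : numFieldType) (X H : tvsType K) (n : nat) (b : ('I_n -> X) -> H).
Hypothesis hb : multilinear b.

Lemma dfwith_id (Y : 'I_n -> X) i : dfwith Y i (Y i) = Y.
Proof.
apply/funext => j; have [->|ij] := eqVneq j i; first by rewrite dfwithin.
by rewrite dfwithout // eq_sym.
Qed.

Lemma multilinear0 (Y : 'I_n -> X) i : Y i = 0 -> b Y = 0.
Proof.
move=> Yi; have := hb Y i (-1) 0 0; rewrite scaler0 addr0 scaleN1r addNr.
by rewrite -{1}Yi dfwith_id.
Qed.

Lemma multilinearZ (Y : 'I_n -> X) i a u :
  b (dfwith Y i (a *: u)) = a *: b (dfwith Y i u).
Proof.
have := hb Y i a u 0; rewrite addr0 => ->.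
by rewrite (@multilinear0 (dfwith Y i 0) i) ?dfwithin ?addr0.
Qed.

(** Leads from y at s = 0 to the constant family w at s = n, so that identities on the diagonal are
    proved one slot at a time. *)
Let mix s (w : X) (y : 'I_n -> X) (j : 'I_n) := if (j < s)%N then w else y j.

Let mix_dfwith s (sn : (s < n)%N) w y t :
  dfwith (mix s w y) (Ordinal sn) t = mix s w (dfwith y (Ordinal sn) t).
Proof.
apply/funext => j; rewrite /mix.
have [->|ij] := eqVneq j (Ordinal sn); first by rewrite !dfwithin ltnn.
by rewrite !dfwithout // eq_sym.
Qed.

Let mixS s (sn : (s < n)%N) w y :
  mix s.+1 w y = mix s w (dfwith y (Ordinal sn) w).
Proof.
apply/funext => j; rewrite /mix ltnS.
have [->|ij] := eqVneq j (Ordinal sn); first by rewrite leqnn ltnn dfwithin.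
rewrite dfwithout 1?eq_sym // leq_eqVlt.
by rewrite (_ : (j == s :> nat) = false) //; apply: negbTE.
Qed.

Let mixn w y : mix n w y = fun=> w.
Proof. by apply/funext => j; rewrite /mix ltn_ord. Qed.

Lemma multilinear_scale a w : b (fun=> a *: w) = a ^+ n *: b (fun=> w).
Proof.
suff h s y : (s <= n)%N -> b (mix s (a *: w) y) = a ^+ s *: b (mix s w y).
  by rewrite -(mixn (a *: w) (fun=> w)) h // mixn.
elim: s y => [|s IH] y sn; first by rewrite expr0 scale1r.
rewrite (mixS sn) IH ?(ltnW sn) // -mix_dfwith multilinearZ scalerA -exprSr.
by rewrite mix_dfwith -mixS.
Qed.

(** As b is not assumed symmetric, the coefficient of a is a sum over the slots that v may occupy;
    the higher ones stay anonymous. *)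
Lemma multilinear_expand (z v : X) : exists c : nat -> H,
  [/\ forall i, (n < i)%N -> c i = 0,
      forall a, b (fun=> z + a *: v) = \sum_(i < n.+1) a ^+ i *: c i
    & c 1%N = \sum_(i < n) b (dfwith (fun=> z) i v)].
Proof.
suff h s y : (s <= n)%N -> exists c : nat -> H,
  [/\ forall i, (s < i)%N -> c i = 0,
      forall a, b (mix s (z + a *: v) y) = \sum_(i < n.+1) a ^+ i *: c i,
      c 0%N = b (mix s z y)
    & c 1%N = \sum_(i < n | (i < s)%N) b (dfwith (mix s z y) i v)].
  have [c [c1 c2 _ c4]] := h n (fun=> z) (leqnn n); exists c; split => //.
    by move=> a; rewrite -(c2 a) mixn.
  by rewrite c4; apply: eq_big => [i|i _]; rewrite ?ltn_ord // mixn.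
elim: s y => [|s IH] y sn.
  exists (fun i => if i is 0%N then b (mix 0 z y) else 0); split => //.
  - by case.
  - by move=> a; rewrite big_ord_recl expr0 scale1r big1 ?addr0 // => i _; rewrite /= scaler0.
  - by rewrite big_pred0.
pose i0 := Ordinal sn.
have [c1 [c1a c1b c1c c1d]] := IH (dfwith y i0 z) (ltnW sn).
have [c2 [c2a c2b c2c c2d]] := IH (dfwith y i0 v) (ltnW sn).
(* The slot s contributes z or a v; the second choice raises the degree in a by one. *)
exists (fun i => c1 i + if i is i'.+1 then c2 i' else 0); split.
- by case=> // i si; rewrite c1a ?c2a ?addr0 // ltnW.
- move=> a; rewrite (mixS sn) -mix_dfwith.
  have -> : b (dfwith (mix s (z + a *: v) y) i0 (z + a *: v)) =
      b (dfwith (mix s (z + a *: v) y) i0 z) + a *: b (dfwith (mix s (z + a *: v) y) i0 v).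
    by rewrite [RHS]addrC -hb; congr (b (dfwith _ _ _)); exact: addrC.
  rewrite !mix_dfwith c1b c2b.
  under [RHS]eq_bigr do rewrite scalerDr.
  rewrite big_split /=; congr (_ + _).
  rewrite big_ord_recr /= (c2a n) ?scaler0 ?addr0 //.
  rewrite [RHS]big_ord_recl /= scaler0 add0r scaler_sumr.
  by apply: eq_bigr => i _; rewrite scalerA -exprS.
- by rewrite addr0 c1c -mixS.
- rewrite c1d c2c [RHS](bigD1 i0) ?ltnSn //= addrC; congr (_ + _); last first.
    congr b; rewrite (mixS sn) -!mix_dfwith; apply/funext => j.
    have [->|ij] := eqVneq j i0; first by rewrite !dfwithin.
    by rewrite !dfwithout // eq_sym.
  rewrite (mixS sn); apply: eq_bigl => i.
  by rewrite ltnS ltn_neqAle andbC.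
Qed.
End multilinear.

Section root_extract.
Variables (R : realType) (k : Defs.scalar).
Local Notation K := (Fld R k).
Variables (H : tvsType K) (n : nat) (w : K).
Hypothesis hw : unit_root n w.

Lemma unit_root_inj i l : (i < n)%N -> (l < n)%N -> w ^+ i = w ^+ l -> i = l.
Proof.
wlog il : i l / (i <= l)%N.
  move=> h; have [il|/ltnW li] := leqP i l; first exact: h.
  by move=> i1 l1 /esym e; apply/esym/h.
move=> _ ln e; apply/eqP; rewrite eqn_leq il /=; have [_ _ _ h] := hw.
rewrite leqNgt; apply/negP => il'.
have := h (l - i)%N; rewrite subn_gt0 il' /= (leq_ltn_trans (leq_subr _ _) ln) => /(_ isT).
have wi0 : w ^+ i != 0 by rewrite expf_neq0 // (unit_root_neq0 hw).
by rewrite -(inj_eq (mulIf wi0)) -exprD subnK // mul1r e eqxx.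
Qed.

(** Discrete Fourier inversion: as m <= n, the differences i - l with i distinct from l are no
    multiples of n, and their powers of w average to 0. *)
Lemma root_extract m l (c : nat -> H) : (m <= n)%N -> (l < m)%N ->
  avg (fun j : 'I_n => (w ^+ j)^-1 ^+ l *: \sum_(i < m) (w ^+ j) ^+ i *: c i) = c l.
Proof.
move=> mn lm.
transitivity (avg (fun j : 'I_n => \sum_(i < m) ((w ^+ j)^-1 ^+ l * (w ^+ j) ^+ i) *: c i)).
  by apply: avg_eq => j; rewrite scaler_sumr; apply: eq_bigr => i _; rewrite scalerA.
rewrite avg_sum (bigD1 (Ordinal lm)) //= big1 ?addr0 => [|i il].
  rewrite avg_scalar (eq_bigr (fun=> 1)) ?sumr_const ?card_ord ?mulVf ?scale1r ?(unit_root_n hw) //.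
  by move=> j _; rewrite -exprMn mulVf ?expr1n // expf_neq0 // (unit_root_neq0 hw).
rewrite avg_scalar (eq_bigr (fun j : 'I_n => (w^-1 ^+ l * w ^+ i) ^+ j)); last first.
  by move=> j _; rewrite -exprVn -!exprM exprMn -!exprM ![(_ * j)%N]mulnC.
have [_ _ wn _] := hw.
rewrite sum_unit_rootX ?mulr0 ?scale0r //.
  by rewrite exprMn -!exprM ![(_ * n)%N]mulnC !exprM exprVn wn invr1 !expr1n mulr1.
have wl0 : w ^+ l != 0 by rewrite expf_neq0 // (unit_root_neq0 hw).
apply: contraNneq il => e; apply/eqP/val_inj; apply: unit_root_inj.
- exact: leq_trans (ltn_ord i) mn.
- exact: leq_trans lm mn.
- by have := congr1 ( *%R (w ^+ l)) e; rewrite mulr1 mulrA -exprMn mulfV ?expr1n ?mul1r // (unit_root_neq0 hw).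
Qed.
End root_extract.

(** * Cauchy estimates for power series *)

Section power_series.
Variables (R : realType).
Local Notation C := (Fld R ScC).
Variables (H : tvsType C) (q : H -> R).
Hypothesis hq : csemi q.

Lemma half_decay (A e : R) : 0 < e -> exists N, A * 2^-1 ^+ N < e.
Proof.
move=> e0; have [A0|A0] := leP A 0.
  by exists 0%N; rewrite expr0 mulr1 (le_lt_trans A0).
have : (2^-1 : R) ^+ N @[N --> \oo] --> (0 : R).
  by apply: cvg_expr; rewrite gtr0_norm ?invr_gt0 // invf_lt1 // ltr1n.
move=> /cvgrPdist_lt /(_ (e / A) (divr_gt0 e0 A0)) [N _ /(_ N (leqnn N))] /=.
rewrite sub0r normrN ger0_norm ?exprn_ge0 ?invr_ge0 // ltr_pdivlMr // mulrC => h.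
by exists N.
Qed.

Lemma half_sum (A : R) N d : \sum_(N <= i < N + d) A * 2^-1 ^+ i =
  2 * A * 2^-1 ^+ N - 2 * A * 2^-1 ^+ (N + d).
Proof.
elim: d => [|d IH]; first by rewrite addn0 big_geq // subrr.
by rewrite addnS big_nat_recr ?leq_addr //= IH [in RHS]exprS; field.
Qed.

Lemma half_sum_le (A : R) N d : 0 <= A ->
  \sum_(N <= i < N + d) A * 2^-1 ^+ i <= 2 * A * 2^-1 ^+ N.
Proof.
move=> A0; rewrite half_sum lerBlDr lerDl !mulr_ge0 // exprn_ge0 // invr_ge0 //.
Qed.

Lemma series_tail (a : nat -> H) (g : H) (A : R) : 0 <= A ->
  (\sum_(i < N) a i @[N --> \oo]) --> g -> (forall i, q (a i) <= A * 2^-1 ^+ i) ->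
  forall N, q (g - \sum_(i < N) a i) <= 2 * A * 2^-1 ^+ N.
Proof.
move=> A0 /cvg_csemi ag aA N; apply/ler_addgt0Pr => e e0.
have [N1 _ h1] := ag q hq e e0.
have := h1 (N + N1)%N (leq_addl _ _) => /= h2.
apply: le_trans (csemi_dist hq _ (\sum_(i < N + N1) a i) _) _.
rewrite addrC; apply: lerD; last by rewrite csemiB // ltW.
rewrite -(big_mkord xpredT) (big_cat_nat (n := N)) ?leq_addr //= big_mkord.
rewrite [X in q X]addrC addKr.
apply: le_trans (csemi_sum hq _ _ _) _.
by apply: le_trans (ler_sum _ (fun i _ => aA i)) _; exact: half_sum_le.
Qed.

(** Convergence at 2 bounds the coefficients by A 2^-i with an uncontrolled A. Partial sums then
    converge uniformly on the unit circle, so that a coefficient, extracted from a partial sum, is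
    up to any e an average of values of g. In this way A leaves the bound. *)
Lemma cauchy_estimate (a : nat -> H) (g : C -> H) M :
  (forall z, nrm z <= 2 -> (\sum_(i < N) z ^+ i *: a i @[N --> \oo]) --> g z) ->
  (forall z, nrm z <= 1 -> q (g z) <= M) -> forall i, q (a i) <= M.
Proof.
move=> ag gM.
have [A A0 hA] : exists2 A, 0 <= A & forall i, q (a i) <= A * 2^-1 ^+ i.
  have n2 : nrm (2 : C) <= 2 by rewrite nrm_nat.
  have [N _ hN] := (cvg_csemi _ _).1 (ag 2 n2) q hq _ ltr01.
  have e i : q (a i) = q (2 ^+ i *: a i) * 2^-1 ^+ i.
    by rewrite csemiZ // nrmX nrm_nat mulrAC -exprMn mulfV ?pnatr_eq0 // expr1n mul1r.
  exists (2 + \sum_(i < N) q (2 ^+ i *: a i)).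
    by rewrite addr_ge0 // sumr_ge0 // => i _; exact: (csemi_ge0 hq).
  move=> i; rewrite e ler_wpM2r ?exprn_ge0 ?invr_ge0 //.
  have [iN|Ni] := ltnP i N.
    rewrite (bigD1 (Ordinal iN)) //= addrCA lerDl addr_ge0 // sumr_ge0 // => l _.
    exact: (csemi_ge0 hq).
  have h1 := hN i Ni; have h2 := hN i.+1 (leqW Ni); rewrite /= in h1 h2.
  apply: (@le_trans _ _ 2); last by rewrite lerDl sumr_ge0 // => l _; exact: (csemi_ge0 hq).
  have -> : 2 ^+ i *: a i = (\sum_(l < i.+1) 2 ^+ l *: a l - g 2) -
      (\sum_(l < i) 2 ^+ l *: a l - g 2).
    by rewrite big_ord_recr /= opprB addrA subrK [X in X - _]addrC addrK.
  apply: le_trans (csemiD hq _ _) _; rewrite csemiN //; lra.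
move=> i; apply/ler_addgt0Pr => e e0.
have [N0 hN0] := half_decay (2 * A) e0.
(* [N0] makes the tail small, and N > i keeps the coefficient i in the partial sum. *)
pose N := maxn N0 i.+1.
have [n [w [Nn hw w1 _]]] := @unit_roots R 1 N ltr01.
have iN : (i < N)%N by rewrite /N leq_max ltnSn orbT.
rewrite -(root_extract hw a (ltnW Nn) iN).
have [n0 _ _ _] := hw; apply: avg_le => // j.
have nj : nrm (w ^+ j) = 1 by exact: unit_root_nrm hw _.
rewrite csemiZ // nrmX nrmV nj invr1 expr1n mul1r.
have nj2 : nrm (w ^+ j) <= 2 by rewrite nj ler1n.
have := @series_tail (fun l => (w ^+ j) ^+ l *: a l) (g (w ^+ j)) A A0 (ag _ nj2) _ N.
have hAj l : q ((w ^+ j) ^+ l *: a l) <= A * 2^-1 ^+ l.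
  by rewrite csemiZ // nrmX nj expr1n mul1r.
move=> /(_ hAj) h.
rewrite -[X in q X](subrK (g (w ^+ j))); apply: le_trans (csemiD hq _ _) _.
rewrite csemiB // addrC; apply: lerD; first by apply: gM; rewrite nj.
apply: le_trans h _; apply: le_trans (ltW hN0).
rewrite ler_wpM2l ?mulr_ge0 // ler_wiXn2l ?invr_ge0 ?invf_le1 ?ler1n //.
by rewrite leq_maxl.
Qed.
End power_series.

(** Reduces statements that are homogeneous in a direction v to small directions; one factor c
    serves all y near v. *)
Lemma absorb (R : realType) (k : Defs.scalar) (X : tvsType (Fld R k)) (W : set X)
    (v : X) : nbhs 0 W ->
  exists2 c : Fld R k, c != 0 & exists2 A, nbhs v A & forall y, A y -> W (c *: y).
Proof.
move=> nW; have nW' : nbhs ((0 : Fld R k) *: v) W by rewrite scale0r.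
have [[A1 A] /= [nA1 nA] AB] := @scale_continuous _ X (0, v) W nW'.
have /nbhs_nrm[e e0 eA] := nA1.
exists (ofR (e / 2)); first by rewrite fmorph_eq0 gt_eqF // divr_gt0.
exists A => // y Ay; apply: (AB (_, y)); split => //=; apply: eA.
by rewrite subr0 nrm_ofR gtr0_norm ?divr_gt0 //; lra.
Qed.

(** * Differentiating a series of homogeneous polynomials *)

Section center.
Variables (R : realType).
Local Notation C := (Fld R ScC).
Variables (X H : tvsType C) (b : forall k, ('I_k -> X) -> H).
Arguments b : clear implicits.
Hypothesis hb : forall k, multilinear (b k).

Definition hpoly k (z : X) : H := b k (fun=> z).
(* The derivative of hpoly k at z in the direction v. *)
Definition dpoly k (z v : X) : H := \sum_(i < k) b k (dfwith (fun=> z) i v).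

Lemma dpoly_linear k z : linear (dpoly k z).
Proof.
move=> a u v; rewrite /dpoly scaler_sumr -big_split; apply: eq_bigr => i _.
exact: hb.
Qed.

Lemma dpoly_D k z u v : dpoly k z (u + v) = dpoly k z u + dpoly k z v.
Proof. by have := dpoly_linear k z 1 u v; rewrite !scale1r. Qed.

Lemma dpoly_Z k z a v : dpoly k z (a *: v) = a *: dpoly k z v.
Proof.
have d0 : dpoly k z 0 = 0.
  by apply: (addrI (dpoly k z 0)); rewrite -dpoly_D !addr0.
by have := dpoly_linear k z a v 0; rewrite d0 !addr0.
Qed.

Lemma dpoly0z k v : k != 1%N -> dpoly k 0 v = 0.
Proof.
move=> k1; rewrite /dpoly big1 // => i _.
have [j ij] : exists j : 'I_k, j != i.
  case: k k1 i => [|[|k]] // _ i; first by case: i.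
  by have [->|i0] := eqVneq i ord0; [exists (lift ord0 ord0)|exists ord0; rewrite eq_sym].
have h := @multilinear0 _ _ _ _ _ (@hb k) (dfwith (fun=> 0) i v) j.
by apply: h; rewrite dfwithout // eq_sym.
Qed.

(** The length is k + 2 rather than k + 1 so that the coefficient 1 can be extracted for k = 0 as
    well. *)
Lemma hpoly_expand k z v : exists c : nat -> H, [/\ c 0%N = hpoly k z, c 1%N = dpoly k z v
  & forall a, hpoly k (z + a *: v) = \sum_(i < k.+2) a ^+ i *: c i].
Proof.
have [c [c0 c1 c2]] := multilinear_expand (@hb k) z v.
have E a : hpoly k (z + a *: v) = \sum_(i < k.+2) a ^+ i *: c i.
  by rewrite big_ord_recr /= c0 // scaler0 addr0; exact: c1.
exists c; split=> //; have := E 0; rewrite scale0r addr0 => ->.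
rewrite big_ord_recl expr0 scale1r big1 ?addr0 // => i _.
by rewrite exprS mul0r scale0r.
Qed.

Lemma hpolyZ k a z : hpoly k (a *: z) = a ^+ k *: hpoly k z.
Proof. exact: multilinear_scale. Qed.

(** Continuity is known for the polynomial, not for the multilinear map behind it. Writing the
    derivative through values of the polynomial makes it continuous ([dpoly_continuous]) and
    comparable with values of f ([diff_le]). *)
Lemma dpoly_avg k n w (hw : unit_root n w) z v : (k.+2 <= n)%N ->
  dpoly k z v = avg (fun j : 'I_n => (w ^+ j)^-1 *: hpoly k (z + w ^+ j *: v)).
Proof.
move=> kn; have [c [_ <- cE]] := hpoly_expand k z v.
rewrite -[LHS](@root_extract _ _ _ _ _ hw k.+2) //.
by apply: avg_eq => j; rewrite cE expr1.
Qed.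

Lemma dpoly_continuous k : (forall k, continuous (hpoly k)) ->
  continuous (fun p : X * X => dpoly k p.1 p.2).
Proof.
move=> hc; have [n [w [kn hw _ _]]] := @unit_roots R 1 k.+2 ltr01.
rewrite (_ : (fun p => _) = fun p : X * X =>
  avg (fun j : 'I_n => (w ^+ j)^-1 *: hpoly k (p.1 + w ^+ j *: p.2))); last first.
  by apply/funext => p; apply: dpoly_avg => //; exact: ltnW.
move=> p; rewrite /avg; apply: at_Z; first exact: at_cst.
apply: at_sum => j _; apply: at_Z; first exact: at_cst.
have c0 : (fun p : X * X => p.1 + w ^+ j *: p.2) @ p --> p.1 + w ^+ j *: p.2.
  apply: at_D; first exact: at_fst.
  by apply: at_Z; [exact: at_cst|exact: at_snd].
exact: (at_comp c0 (hc k _)).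
Qed.

Section estimates.
Variables (q : H -> R) (f : X -> H) (x z v : X) (M : R).
Hypotheses (hq : csemi q) (M0 : 0 <= M).
Hypothesis fE : forall s a : C, nrm s <= 8 -> nrm a <= 1 ->
  (\sum_(i < N) hpoly i (s *: (z + a *: v)) @[N --> \oo]) --> f (x + s *: (z + a *: v)).
Hypothesis fM : forall s a : C, nrm s <= 8 -> nrm a <= 1 ->
  q (f (x + s *: (z + a *: v))) <= M.

Let h2 : (0 : R) <= 2^-1. Proof. by rewrite invr_ge0. Qed.

(** The radius 8 is 2 * 4: [cauchy_estimate] wants convergence up to 2, and the dilation by 4 yields
    the decay 4^-k. One factor 2^-k of it later pays for the number of coefficients in the expansion
    in a ([k_le]). *)
Lemma hpoly_le k a : nrm a <= 1 -> q (hpoly k (z + a *: v)) <= M * 4^-1 ^+ k.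
Proof.
move=> a1; pose y := z + a *: v.
have : q (4 ^+ k *: hpoly k y) <= M.
  apply: (@cauchy_estimate R H q hq (fun k => 4 ^+ k *: hpoly k y)
    (fun s => f (x + (s * 4) *: y)) M) => s s2; last first.
    apply: fM => //; rewrite nrmM nrm_nat.
    by apply: (@le_trans _ _ 4); [rewrite ler_piMl|rewrite ler_nat].
  under eq_fun do under eq_bigr do rewrite scalerA -exprMn -hpolyZ.
  apply: fE => //; rewrite nrmM nrm_nat.
  by rewrite (_ : 8 = 2 * 4) ?ler_wpM2r // -natrM.
by rewrite csemiZ // nrmX nrm_nat exprVn ler_pdivlMr ?exprn_gt0 // mulrC.
Qed.

Let quarter k : (4^-1 : R) ^+ k = 2^-1 ^+ k * 2^-1 ^+ k.
Proof. by rewrite -exprMn -invfM -natrM. Qed.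

Lemma hpoly_coef_le k (c : nat -> H) i : (i < k.+2)%N ->
  (forall a, hpoly k (z + a *: v) = \sum_(i < k.+2) a ^+ i *: c i) ->
  q (c i) <= M * 4^-1 ^+ k.
Proof.
move=> ik cE; have [n [w [kn hw _ _]]] := @unit_roots R 1 k.+2 ltr01.
rewrite -(root_extract hw c (ltnW kn) ik).
have [n0 _ _ _] := hw; apply: avg_le => // j; rewrite -cE csemiZ //.
rewrite nrmX nrmV (unit_root_nrm hw) invr1 expr1n mul1r.
by apply: hpoly_le; rewrite (unit_root_nrm hw).
Qed.

Let k_le k : k.+1%:R * 4^-1 ^+ k <= 2^-1 ^+ k :> R.
Proof.
rewrite quarter mulrA ler_piMl ?exprn_ge0 // exprVn ler_pdivrMr ?exprn_gt0 //.
by rewrite mul1r -natrX ler_nat ltn_expl.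
Qed.

Lemma hpoly_diff_le k t : nrm t <= 1 ->
  q (hpoly k (z + t *: v) - hpoly k z) <= nrm t * M * 2^-1 ^+ k.
Proof.
move=> t1; have [c [<- _ cE]] := hpoly_expand k z v.
rewrite cE big_ord_recl expr0 scale1r addrC addKr.
apply: le_trans (csemi_sum hq _ _ _) _.
apply: (@le_trans _ _ (\sum_(i < k.+1) nrm t * (M * 4^-1 ^+ k))).
  apply: ler_sum => i _; rewrite csemiZ // nrmX.
  apply: ler_pM; rewrite ?exprn_ge0 ?nrm_ge0 ?csemi_ge0 //; last exact: hpoly_coef_le.
  by rewrite exprS ler_piMr ?nrm_ge0 // exprn_ile1 ?nrm_ge0.
rewrite sumr_const card_ord -[_ *+ _]mulr_natl mulrCA -mulrA.
by rewrite ler_wpM2l ?nrm_ge0 // mulrCA ler_wpM2l.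
Qed.

Lemma hpoly_diff2_le k t : nrm t <= 1 ->
  q (hpoly k (z + t *: v) - hpoly k z - t *: dpoly k z v) <= nrm t ^+ 2 * M * 2^-1 ^+ k.
Proof.
move=> t1; have [c [<- <- cE]] := hpoly_expand k z v.
rewrite cE big_ord_recl expr0 scale1r [c 0%N + _]addrC addrK.
rewrite big_ord_recl /= expr1 addrC addKr.
apply: le_trans (csemi_sum hq _ _ _) _.
apply: (@le_trans _ _ (\sum_(i < k) nrm t ^+ 2 * (M * 4^-1 ^+ k))).
  apply: ler_sum => i _; rewrite csemiZ // nrmX.
  apply: ler_pM; rewrite ?exprn_ge0 ?nrm_ge0 ?csemi_ge0 //; last first.
    exact: (hpoly_coef_le (ltn_ord (lift ord0 (lift ord0 i))) cE).
  by rewrite ler_wiXn2l ?nrm_ge0.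
rewrite sumr_const card_ord -[_ *+ _]mulr_natl mulrCA -mulrA.
rewrite ler_wpM2l ?exprn_ge0 ?nrm_ge0 // mulrCA ler_wpM2l //.
by apply: le_trans (k_le k); rewrite ler_wpM2r ?ler_nat.
Qed.

Let fE1 a : nrm a <= 1 ->
  (\sum_(i < N) hpoly i (z + a *: v) @[N --> \oo]) --> f (x + (z + a *: v)).
Proof.
move=> a1; have := @fE 1 a; rewrite scale1r nrm1; apply => //.
by rewrite ler1n.
Qed.

Lemma hpoly_tail a N : nrm a <= 1 ->
  q (f (x + (z + a *: v)) - \sum_(i < N) hpoly i (z + a *: v)) <= 2 * M * 2^-1 ^+ N.
Proof.
move=> a1; apply: (@series_tail R H q hq (fun i => hpoly i (z + a *: v)) _ M M0 (fE1 a1)).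
move=> i; apply: le_trans (hpoly_le i a1) _; rewrite ler_wpM2l // quarter.
by rewrite ler_piMl ?exprn_ge0 // exprn_ile1 // invf_le1 ?ler1n.
Qed.

Lemma series_cvgB (a a' : nat -> H) g g' :
  (\sum_(i < N) a i @[N --> \oo]) --> g -> (\sum_(i < N) a' i @[N --> \oo]) --> g' ->
  (\sum_(i < N) (a i - a' i) @[N --> \oo]) --> g - g'.
Proof.
move=> ag ag'; under eq_fun do rewrite sumrB.
by apply: (@tvs_cvgD _ _ \oo _ H); last exact: (@tvs_cvgN _ _ \oo H).
Qed.

Lemma hpoly_diff_cvg t : nrm t <= 1 ->
  (\sum_(i < N) (hpoly i (z + t *: v) - hpoly i z) @[N --> \oo]) -->
    f (x + z + t *: v) - f (x + z).
Proof.
move=> t1; apply: (@series_cvgB (fun i => hpoly i (z + t *: v)) (fun i => hpoly i z)).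
  by rewrite -addrA; exact: fE1.
by have := @fE1 0; rewrite nrm0 scale0r addr0; apply; exact: ler01.
Qed.

(** The existence of l comes from the expansion of f around x + z itself; here l is identified with
    the differentiated series around x. After multiplication by t there are three errors: that of l,
    the tail of the difference series, with a factor |t|, and second order terms, with a factor
    |t|^2. Division by |t| leaves the tail. *)
Lemma dirder_series l : is_dirder f (x + z) v l -> forall N,
  q (l - \sum_(i < N) dpoly i z v) <= 2 * M * 2^-1 ^+ N.
Proof.
move=> /is_dirderP fl N; apply/ler_addgt0Pr => e e0.
have e2 : 0 < e / 2 by rewrite divr_gt0.
have /nbhs_nrm[d d0 hd] := fl q hq _ e2.
have M1 : 0 < 2 * M + 1 by rewrite ltr_wpDl // mulr_ge0.
(* Below d, so that the error of l is at most e / 2; at most 1 for the estimates on the polynomials;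
   and so small that the second order terms cost at most another e / 2. *)
pose t0 := Num.min (d / 2) (Num.min 1 (e / 2 / (2 * M + 1))).
have t00 : 0 < t0 by rewrite !lt_min ltr01 !divr_gt0.
pose t : C := ofR t0.
have nt : nrm t = t0 by rewrite nrm_ofR gtr0_norm.
have t1 : nrm t <= 1 by rewrite nt !ge_min lexx !orbT.
have td : nrm t < d.
  by rewrite nt; apply: (@le_lt_trans _ _ (d / 2)); [rewrite ge_min lexx|lra].
have tM : t0 * (2 * M) <= e / 2.
  apply: (@le_trans _ _ (e / 2 / (2 * M + 1) * (2 * M))).
    by rewrite ler_wpM2r ?mulr_ge0 // !ge_min lexx !orbT.
  by rewrite mulrAC ler_pdivrMr // ler_wpM2l ?(ltW e2) // lerDl.
have := hd t; rewrite subr0 => /(_ td) h1.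
have hA : 0 <= nrm t * M by rewrite mulr_ge0 ?nrm_ge0.
have h3 := series_tail hq hA (hpoly_diff_cvg t1) (fun i => hpoly_diff_le i t1) N.
have h4 : q (\sum_(i < N) (hpoly i (z + t *: v) - hpoly i z - t *: dpoly i z v)) <=
    nrm t ^+ 2 * (2 * M).
  apply: le_trans (csemi_sum hq _ _ _) _.
  apply: (@le_trans _ _ (\sum_(i < N) nrm t ^+ 2 * M * 2^-1 ^+ i)).
    by apply: ler_sum => i _; exact: hpoly_diff2_le.
  rewrite -(big_mkord xpredT (fun i => nrm t ^+ 2 * M * 2^-1 ^+ i)).
  have := @half_sum_le R (nrm t ^+ 2 * M) 0 N; rewrite add0n expr0 mulr1.
  by rewrite mulr_ge0 ?exprn_ge0 ?nrm_ge0 // => /(_ isT); rewrite mulrCA.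
have E : t *: (l - \sum_(i < N) dpoly i z v) =
    - (f (x + z + t *: v) - f (x + z) - t *: l) +
    ((f (x + z + t *: v) - f (x + z) - \sum_(i < N) (hpoly i (z + t *: v) - hpoly i z)) +
    \sum_(i < N) (hpoly i (z + t *: v) - hpoly i z - t *: dpoly i z v)).
  rewrite [X in _ + (_ + X)]sumrB -scaler_sumr scalerBr.
  set A := f _ - f _; set D := t *: \sum_(i < N) _; set B := \sum_(i < N) (_ - _).
  have -> : A - B + (B - D) = A - D by rewrite addrA subrK.
  by rewrite opprB addrA subrK.
have t0p : 0 < nrm t by rewrite nt.
rewrite -(ler_pM2l t0p) -csemiZ // E.
apply: le_trans (csemiD hq _ _) _; rewrite csemiN //.
apply: le_trans (lerD h1 (csemiD hq _ _)) _.
apply: le_trans (lerD (lexx _) (lerD h3 h4)) _.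
rewrite -nt in tM; have := ler_wpM2l (ltW t0p) tM.
lra.
Qed.

(** At z = 0 only the polynomial of degree 1 has a nonzero derivative, so the second order
    remainders sum to the first order error of f, which is then estimated as a tail starting at
    0. *)
Lemma dirder_center t : z = 0 -> nrm t <= 1 ->
  q (f (x + t *: v) - f x - t *: dpoly 1 0 v) <= 2 * M * nrm t ^+ 2.
Proof.
move=> z0 t1; have h1 := hpoly_diff_cvg t1.
have h3 : (\sum_(i < N) t *: dpoly i z v @[N --> \oo]) --> t *: dpoly 1 0 v.
  apply/cvg_csemi => p hp e e0; near=> N.
  have N1 : (1 < N)%N by near: N; exact: nbhs_infty_gt.
  rewrite (bigD1 (Ordinal N1)) //= big1 ?addr0 => [|i i1].
    by rewrite z0 subrr csemi0.
  by rewrite z0 dpoly0z ?scaler0.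
have := @series_tail R H q hq
  (fun i => hpoly i (z + t *: v) - hpoly i z - t *: dpoly i z v) _ (nrm t ^+ 2 * M) _
  (@series_cvgB (fun i => hpoly i (z + t *: v) - hpoly i z) (fun i => t *: dpoly i z v) _ _ h1 h3) (fun i => hpoly_diff2_le i t1) 0%N.
rewrite big_ord0 subr0 expr0 mulr1 z0 !addr0 => h; apply: le_trans (h _) _.
  by rewrite mulr_ge0 // exprn_ge0 // nrm_ge0.
by rewrite le_eqVlt; apply/orP; left; apply/eqP; ring.
Unshelve. all: by end_near. Qed.

End estimates.
End center.

(** * The derivative of a complex analytic map *)

Section analytic_derivative.
Variables (R : realType).
Local Notation C := (Fld R ScC).
Variables (X H : tvsType C) (U : set X) (f : X -> H).
Hypotheses (hH : hausdorff_space H) (hf : @analytic_series C X H U f).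

Let oU : open U. Proof. by case: hf. Qed.
Let cf : cont_on U f. Proof. by case: hf => oU' /(cont_onP f oU') h _. Qed.

(** An expansion around x with a neighbourhood W from which both the point z and the direction v may
    be taken, leaving room for the dilations in the estimates above. *)
Let center x (b : forall k, ('I_k -> X) -> H) (W : set X) :=
  [/\ forall k, multilinear (b k), forall k, continuous (hpoly b k), nbhs 0 W
   & forall z v, W z -> W v -> forall s a : C, nrm s <= 8 -> nrm a <= 1 ->
     U (x + s *: (z + a *: v)) /\
     (\sum_(i < N) hpoly b i (s *: (z + a *: v)) @[N --> \oo]) --> f (x + s *: (z + a *: v))].

Lemma analytic_center x : U x -> exists b W, center x b W.
Proof.
move=> Ux; have [_ _ /(_ x Ux)[p [V [hp nV hV]]]] := hf.
have hb k : exists b : ('I_k -> X) -> H, multilinear b /\ forall x, p k x = b (fun=> x).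
  by have [_ [b hb bE]] := hp k; exists b.
pose b k := sval (cid (hb k)).
have pE : p = hpoly b by apply/funext => k; apply/funext => y; have [_] := svalP (cid (hb k)); apply.
have [B [nB BV Bb Bc]] := balanced_convex_nbhd nV.
(* 1/16 = 1/2 * 1/8: the factor 1/8 compensates |s| <= 8, and 1/2 turns s (z + a v) into a convex
   combination. *)
have n16 : (ofR 16^-1 : C) != 0 by rewrite fmorph_eq0 invr_eq0 pnatr_eq0.
exists b, ( *:%R (ofR 16^-1 : C) @` B); split.
- by move=> k; have [] := svalP (cid (hb k)).
- by move=> k; rewrite -pE; have [] := hp k.
- exact: nbhs0Z.
- move=> _ _ [z Bz <-] [v Bv <-] s a s8 a1.
  have By : B (s *: (ofR 16^-1 *: z + a *: (ofR 16^-1 *: v))).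
    have sz (c : C) y : nrm c <= 8 -> B y -> B ((c * ofR 8^-1) *: y).
      move=> c8 By; apply: Bb => //; rewrite nrmM nrm_ofR gtr0_norm ?invr_gt0 //.
      by rewrite ler_pdivrMr // mul1r.
    have sa8 : nrm (s * a) <= 8.
      by rewrite nrmM; apply: le_trans s8; rewrite ler_piMr ?nrm_ge0.
    have hh : (0 : R) <= 2^-1 by rewrite invr_ge0.
    have h1 : (2^-1 + 2^-1 : R) = 1 by lra.
    have := Bc _ _ _ _ hh hh h1 (sz s z s8 Bz) (sz _ v sa8 Bv).
    have e16 : ofR 16^-1 = ofR 2^-1 * ofR 8^-1 :> C.
      by rewrite -rmorphM -invfM -natrM.
    rewrite e16 scalerDr !scalerA; congr (B (_ *: _ + _ *: _)).
      by rewrite mulrCA.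
    by rewrite mulrCA !mulrA.
  by rewrite -pE; exact: (hV _ (BV _ By)).
Qed.

Section at_center.
Variables (x : X) (b : forall k, ('I_k -> X) -> H) (W : set X).
Arguments b : clear implicits.
Hypothesis xbW : center x b W.

Let hb k : multilinear (b k). Proof. by case: xbW => h _ _ _; exact: h. Qed.
Let nW : nbhs 0 W. Proof. by case: xbW. Qed.
Let W0 : W 0. Proof. exact: nbhs_singleton. Qed.
Lemma center_sub z : W z -> U (x + z).
Proof.
move=> Wz; have [_ _ _ h] := xbW.
have [] := h z 0 Wz W0 1 0; rewrite ?nrm1 ?nrm0 ?ler1n //.
by rewrite scale1r scaler0 addr0.
Qed.

Lemma center_bound q z v : csemi q -> W z -> W v -> exists2 M : R, 0 <= M &
  forall s a : C, nrm s <= 8 -> nrm a <= 1 -> q (f (x + s *: (z + a *: v))) <= M.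
Proof.
move=> hq Wz Wv; have [_ _ _ h] := xbW.
have cA := compact_setX (@compact_disc R ScC 8) (@compact_disc R ScC 1).
have [|M M0 hM] := @compact_bound R _ _ (fun p : C * C => q (f (x + p.1 *: (z + p.2 *: v)))) cA.
  move=> [s a] [/= s8 a1]; have [Us _] := h z v Wz Wv s a s8 a1.
  have c0 : (fun p : C * C => x + p.1 *: (z + p.2 *: v)) @ (s, a) --> x + s *: (z + a *: v).
    apply: at_D; first exact: at_cst.
    apply: at_Z; first exact: (@at_fst _ _ (s, a)).
    apply: at_D; first exact: at_cst.
    by apply: at_Z; [exact: (@at_snd _ _ (s, a))|exact: at_cst].
  have c1 := cvg_comp _ _ c0 (cf Us).
  exact: (cvg_comp _ _ c1 (@csemi_continuous _ _ _ _ hq _)).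
by exists M; [exact: ltW|move=> s a s8 a1; exact: (hM (s, a))].
Qed.

Lemma center_series z v : W z -> W v -> forall s a : C, nrm s <= 8 -> nrm a <= 1 ->
  (\sum_(i < N) hpoly b i (s *: (z + a *: v)) @[N --> \oo]) --> f (x + s *: (z + a *: v)).
Proof. by move=> Wz Wv s a s8 a1; have [_ _ _ h] := xbW; have [] := h z v Wz Wv s a s8 a1. Qed.

Lemma center_dirder v : is_dirder f x v (dpoly b 1 0 v).
Proof.
have [c c0 [A nA AW]] := absorb v nW.
have Wv := AW v (nbhs_singleton nA).
suff h : is_dirder f x (c *: v) (dpoly b 1 0 (c *: v)).
  have := is_dirderZd (a := c^-1) h.
  by rewrite (dpoly_Z hb) !scalerA mulVf // !scale1r.
apply/is_dirderP => q hq e e0; have [M M0 hM] := center_bound hq W0 Wv.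
have M1 : 0 < 2 * M + 1 by rewrite ltr_wpDl // mulr_ge0.
have d0 : 0 < Num.min 1 (e / (2 * M + 1)) by rewrite lt_min ltr01 divr_gt0.
apply: filterS (near_nrm _ d0) => t; rewrite lt_min => /andP[/ltW t1 te].
apply: le_trans (dirder_center hb hq M0 (center_series W0 Wv) hM erefl t1) _.
rewrite expr2 mulrA ler_wpM2r ?nrm_ge0 //.
move: te; rewrite ltr_pdivlMr // mulrC => /ltW te; apply: le_trans te.
by rewrite ler_wpM2r ?nrm_ge0 // lerDl.
Qed.
End at_center.

Let F (p : X * X) := dirder p.2 f p.1.

Let fF : der_on U f F.
Proof.
move=> x y Ux; apply: dirderP => //; have [b [W xbW]] := analytic_center Ux.
by exists (dpoly b 1 0 y); exact: (center_dirder xbW).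
Qed.

Let F_linear x : U x -> linear (fun v => F (x, v)).
Proof.
move=> Ux a u v; have [b [W xbW]] := analytic_center Ux; have [hb _ _ _] := xbW.
by rewrite /F /= !(dirderE hH (@center_dirder x b W xbW _)) (dpoly_linear hb).
Qed.

Let FD x u v : U x -> F (x, u + v) = F (x, u) + F (x, v).
Proof. by move=> Ux; have := F_linear Ux 1 u v; rewrite !scale1r. Qed.

Let FZ x a v : U x -> F (x, a *: v) = a *: F (x, v).
Proof.
move=> Ux; have F0 : F (x, 0) = 0.
  by apply: (addrI (F (x, 0))); rewrite -FD // !addr0.
by have := F_linear Ux a v 0; rewrite F0 !addr0.
Qed.

Section derivative_at.
Variables (x : X) (b : forall k, ('I_k -> X) -> H) (W : set X).
Arguments b : clear implicits.
Hypothesis xbW : center x b W.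
Hypothesis Ux : U x.

Let hb k : multilinear (b k). Proof. by case: xbW => h _ _ _; exact: h. Qed.
Let nW : nbhs 0 W. Proof. by case: xbW. Qed.
Let W0 : W 0. Proof. exact: nbhs_singleton. Qed.

Let series_W z v : W z -> W v ->
  (\sum_(i < N) dpoly b i z v @[N --> \oo]) --> F (x + z, v).
Proof.
move=> Wz Wv; apply/cvg_csemi => q hq e e0.
have [M M0 hM] := center_bound xbW hq Wz Wv.
have [N0 hN0] := half_decay (2 * M) e0.
exists N0 => // N N0N /=; rewrite csemiB //.
have h := dirder_series hb hq M0 (center_series xbW Wz Wv) hM (@fF _ v (center_sub xbW Wz)) N.
apply: le_lt_trans h _; apply: le_lt_trans hN0.
by rewrite ler_wpM2l ?mulr_ge0 // ler_wiXn2l ?invr_ge0 ?invf_le1 ?ler1n.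
Qed.

Lemma derivative_series z v : W z ->
  (\sum_(i < N) dpoly b i z v @[N --> \oo]) --> F (x + z, v).
Proof.
move=> Wz; have [c c0 [A nA AW]] := absorb v nW.
have h := series_W Wz (AW v (nbhs_singleton nA)).
rewrite (FZ _ _ (center_sub xbW Wz)) in h.
have E : (fun N => \sum_(i < N) dpoly b i z v) =
    (fun N => c^-1 *: \sum_(i < N) dpoly b i z (c *: v)).
  apply/funext => N; rewrite scaler_sumr; apply: eq_bigr => i _.
  by rewrite (dpoly_Z hb) scalerA mulVf // scale1r.
rewrite E -[F (x + z, v)]scale1r -(mulVf c0) -scalerA.
exact: (@tvs_cvgZ _ _ \oo _ H (fun=> c^-1) _ c^-1 _ (@cvg_cst _ c^-1 _ \oo _) h).
Qed.

(** Up to geometric tails both derivatives are averages of values of f, at x + z + a v and at x + a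
    v0, over the same scalars a with |a| = 1. This transfers continuity from f to F. *)
Let diff_le q z v v0 Q : csemi q -> W z -> W v -> W v0 ->
  (forall a : C, nrm a <= 1 -> q (f (x + (z + a *: v)) - f (x + (0 + a *: v0))) <= Q) ->
  q (F (x + z, v) - F (x, v0)) <= Q.
Proof.
move=> hq Wz Wv Wv0 hQ; apply/ler_addgt0Pr => e e0.
have [M M0 hM] := center_bound xbW hq Wz Wv.
have [M' M0' hM'] := center_bound xbW hq W0 Wv0.
(* M and M' each enter twice with a factor 2, through [dirder_series] and through [hpoly_tail]. *)
have [N hN] := half_decay (4 * (M + M')) e0.
have [n [w [Nn hw _ _]]] := @unit_roots R 1 N.+1 ltr01.
have [n0 _ _ _] := hw.
pose S z v := \sum_(i < N) dpoly b i z v.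
pose P y := \sum_(i < N) hpoly b i y.
have SE z' v' : S z' v' = avg (fun j : 'I_n => (w ^+ j)^-1 *: P (z' + w ^+ j *: v')).
  rewrite (@avg_eq _ _ _ _ _ (fun j : 'I_n =>
    \sum_(i < N) (w ^+ j)^-1 *: hpoly b i (z' + w ^+ j *: v'))); last first.
    by move=> j; rewrite /P scaler_sumr.
  rewrite avg_sum; apply: eq_bigr => i _; apply: (dpoly_avg hb hw).
  by apply: leq_trans Nn; rewrite !ltnS ltnW.
have t1 := dirder_series hb hq M0 (center_series xbW Wz Wv) hM (@fF _ v (center_sub xbW Wz)) N.
have fF0 : is_dirder f (x + 0) v0 (F (x, v0)) by rewrite addr0; exact: fF.
have t2 := dirder_series hb hq M0' (center_series xbW W0 Wv0) hM' fF0 N.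
have t3 : q (S z v - S 0 v0) <= Q + (2 * M * 2^-1 ^+ N + 2 * M' * 2^-1 ^+ N).
  rewrite !SE -avgB; apply: avg_le => // j.
  have nj : nrm (w ^+ j) = 1 := unit_root_nrm hw j.
  have nj1 : nrm (w ^+ j) <= 1 by rewrite nj.
  rewrite -scalerBr csemiZ // nrmV nj invr1 mul1r.
  have u1 := hpoly_tail hb hq M0 (center_series xbW Wz Wv) hM N nj1.
  have u2 := hpoly_tail hb hq M0' (center_series xbW W0 Wv0) hM' N nj1.
  have u3 := hQ _ nj1.
  apply: le_trans (csemi_dist hq _ (f (x + (z + w ^+ j *: v))) _) _.
  rewrite csemiB // addrC.
  have := csemi_dist hq (f (x + (z + w ^+ j *: v))) (f (x + (0 + w ^+ j *: v0)))
    (P (0 + w ^+ j *: v0)).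
  rewrite /P in u1 u2 *; lra.
have := csemi_dist hq (F (x + z, v)) (S z v) (F (x, v0)).
have := csemi_dist hq (S z v) (S 0 v0) (F (x, v0)).
rewrite [q (S 0 v0 - F (x, v0))]csemiB //; rewrite /S in t1 t2 t3 *.
lra.
Qed.

(** Compactness of the unit disc makes the continuity of f at the points x + a v0 uniform in a, as
    [diff_le] demands. *)
Let cF_W v0 : W v0 -> nbhs v0 W -> forall q, csemi q -> forall e, 0 < e ->
  \forall z \near (0 : X) & v \near v0, q (F (x + z, v) - F (x, v0)) <= e.
Proof.
move=> Wv0 nWv0 q hq e e0.
have : \forall p \near ((0 : X), v0), [set a : C | nrm a <= 1] `<=`
    [set a : C | q (f (x + (p.1 + a *: p.2)) - f (x + (0 + a *: v0))) <= e].
  have /compact_near_coveringP cA := @compact_disc R ScC 1.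
  apply: (cA (X * X)%type (nbhs ((0 : X), v0))
    (fun p a => q (f (x + (p.1 + a *: p.2)) - f (x + (0 + a *: v0))) <= e)) => a a1.
  have Ua : U (x + (0 + a *: v0)).
    have [_ _ _ h] := xbW; have [] := h 0 v0 W0 Wv0 1 a; rewrite ?nrm1 ?ler1n //.
    by rewrite scale1r.
  have e2 : 0 < e / 2 by rewrite divr_gt0.
  have c1 : (fun t : C * (X * X) => f (x + (t.2.1 + t.1 *: t.2.2))) @ (a, ((0 : X), v0)) -->
      f (x + (0 + a *: v0)).
    have c0 : (fun t : C * (X * X) => x + (t.2.1 + t.1 *: t.2.2)) @ (a, ((0 : X), v0)) -->
      x + (0 + a *: v0).
      have cs := @at_snd _ _ (a, ((0 : X), v0)).
      apply: at_D; first exact: at_cst.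
      apply: at_D; first exact: (at_fst_comp cs).
      by apply: at_Z; [exact: (@at_fst _ _ (a, ((0 : X), v0)))|exact: (at_snd_comp cs)].
    exact: (cvg_comp _ _ c0 (cf Ua)).
  have c2 : (fun t : C * (X * X) => f (x + (0 + t.1 *: v0))) @ (a, ((0 : X), v0)) -->
      f (x + (0 + a *: v0)).
    have c0 : (fun t : C * (X * X) => x + (0 + t.1 *: v0)) @ (a, ((0 : X), v0)) -->
      x + (0 + a *: v0).
      apply: at_D; first exact: at_cst.
      apply: at_D; first exact: at_cst.
      by apply: at_Z; [exact: (@at_fst _ _ (a, ((0 : X), v0)))|exact: at_cst].
    exact: (cvg_comp _ _ c0 (cf Ua)).
  have n1 := c1 _ (csemi_nbhs hq (f (x + (0 + a *: v0))) e2).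
  have n2 := c2 _ (csemi_nbhs hq (f (x + (0 + a *: v0))) e2).
  apply: (@filterS2 _ (nbhs (a, ((0 : X), v0))) _ _ _ _ _ n1 n2) => t /= t1 t2.
  apply: le_trans (csemi_dist hq _ (f (x + (0 + a *: v0))) _) _.
  by rewrite [q (f (x + (0 + a *: v0)) - _)]csemiB //; lra.
move=> [[A B] /= [nA nB] AB].
exists (A `&` W, B `&` W) => /=; first by split; exact: filterI.
move=> [z v] /= [[Az Wz] [Bv Wv]]; apply: diff_le => // a a1.
exact: (AB (z, v) (conj Az Bv) a a1).
Qed.

Lemma derivative_continuous v0 : F @ (x, v0) --> F (x, v0).
Proof.
(* The interior, because [cF_W] wants W to be a neighbourhood of the scaled direction. *)
have nW' : nbhs 0 W° by apply: nbhs_interior.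
have [c c0 [A nA AW]] := absorb v0 nW'.
apply/cvg_csemi => q hq e e0.
have nc : 0 < nrm c by rewrite nrm_gt0.
have e2 : 0 < e * nrm c / 2 by rewrite divr_gt0 // mulr_gt0.
have nWv := AW v0 (nbhs_singleton nA).
have [[B1 B2] /= [nB1 nB2] B12] := cF_W (nbhs_singleton nWv) nWv hq e2.
have c1 : (fun p : X * X => p.1 - x) @ (x, v0) --> 0.
  rewrite -(subrr x); apply: at_B; last exact: at_cst.
  exact: (@at_fst _ _ (x, v0)).
have c2 : (fun p : X * X => c *: p.2) @ (x, v0) --> c *: v0.
  by apply: at_Z; [exact: at_cst|exact: (@at_snd _ _ (x, v0))].
have n0 : nbhs (x, v0) (fst @^-1` U).
  exact: (@at_fst _ _ (x, v0) _ (open_nbhs_nbhs (conj oU Ux))).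
apply: (@filterS3 _ (nbhs (x, v0)) _ _ _ _ _ _ (c1 _ nB1) (c2 _ nB2) n0) => -[x' v] /= h1 h2 Ux'.
have := B12 (_, _) (conj h1 h2); rewrite /= [x + _]addrC subrK !FZ // -scalerBr csemiZ //.
rewrite mulrC -ler_pdivlMr // mulrAC mulfK ?gt_eqF // => /le_lt_trans; apply.
by rewrite ltr_pdivrMr // ltr_pMr // ltr1n.
Qed.
End derivative_at.

Lemma analytic_derivative : exists2 F : X * X -> H,
  der_on U f F & @analytic_series C (X * X)%type H (U `*` setT) F.
Proof.
exists F => //; have oUT : open (U `*` [set: X]) by exact: open_XT.
split => //.
  apply/(cont_onP _ oUT) => -[x v0] [/= Ux _].
  by have [b [W xbW]] := analytic_center Ux; exact: (derivative_continuous xbW Ux).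
move=> [x v0] [/= Ux _]; have [b [W xbW]] := analytic_center Ux.
have [hb hc nW _] := xbW.
(* F (x + z, v0 + v) splits into the directions v0 and v. The term of degree k of f contributes
   degree k - 1 in z when the direction v0 is fixed, but degree k in (z, v); hence the shift in the
   first summand. *)
exists (fun m p => dpoly b m.+1 p.1 v0 + dpoly b m p.1 p.2), (W `*` setT); split.
- move=> m; split.
    move=> p; apply: at_D; last exact: (dpoly_continuous hb hc).
    have c0 : (fun p : X * X => (p.1, v0)) @ p --> (p.1, v0).
      by apply: at_pair; [exact: at_fst|exact: at_cst].
    exact: (cvg_comp _ _ c0 (@dpoly_continuous _ _ _ b hb m.+1 hc (p.1, v0))).
  exists (fun Y : 'I_m -> X * X =>
    \sum_(i < m.+1) b m.+1 (fun j => if unlift i j is Some j' then (Y j').1 else v0) +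
    \sum_(i < m) b m (fun j => if j == i then (Y j).2 else (Y j).1)); last first.
    move=> p; congr (_ + _); apply: eq_bigr => i _; congr (b _ _); apply/funext => j.
      by case: unliftP => [j'|] ->; rewrite ?dfwithin // dfwithout // neq_lift.
    have [->|ji] := eqVneq j i; first by rewrite dfwithin.
    by rewrite dfwithout // eq_sym.
  move=> Y l a u v.
  rewrite scalerDr addrACA !scaler_sumr -!big_split /=; congr (_ + _); apply: eq_bigr => i _.
    have E w : (fun j => if unlift i j is Some j' then (dfwith Y l w j').1 else v0) =
        dfwith (fun j => if unlift i j is Some j' then (Y j').1 else v0) (lift i l) w.1.
      apply/funext => j; have [->|jl] := eqVneq j (lift i l).
        by rewrite liftK !dfwithin.
      rewrite dfwithout 1?eq_sym //; case: unliftP => [j' jE|//].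
      by rewrite dfwithout //; apply: contraNneq jl => ->; rewrite jE.
    by rewrite !E hb.
  have E w : (fun j => if j == i then (dfwith Y l w j).2 else (dfwith Y l w j).1) =
      dfwith (fun j => if j == i then (Y j).2 else (Y j).1) l (if l == i then w.2 else w.1).
    apply/funext => j; have [->|jl] := eqVneq j l; first by rewrite !dfwithin.
    by rewrite !dfwithout // eq_sym.
  by rewrite !E -hb; case: (l == i).
- exists (W, setT) => //=; split => //; exact: filterT.
- move=> [z v] [/= Wz _]; split; first by split => //=; exact: (center_sub xbW).
  have h1 := @derivative_series x b W xbW z v0 Wz; have h2 := @derivative_series x b W xbW z v Wz.
  rewrite -[F _]/(F (x + z, v0 + v)) (FD _ _ (center_sub xbW Wz)).
  under eq_fun do rewrite big_split /=.
  apply: (@tvs_cvgD _ _ \oo _ H) => //.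
  (* [dpoly b 0] is an empty sum, so the shift only reindexes the partial sums. *)
  have -> : (fun N => \sum_(i < N) dpoly b i.+1 z v0) =
      (fun N => (fun N => \sum_(i < N) dpoly b i z v0) N.+1).
    apply/funext => N; rewrite big_ord_recl [dpoly b 0 z v0]big_ord0 add0r.
    by apply: eq_bigr.
  apply: (@cvg_comp _ _ _ S (fun N => \sum_(i < N) dpoly b i z v0) \oo \oo) => //.
  by move=> A [N _ NA]; exists N => // m Nm; apply: NA; exact: leqW.
Qed.
End analytic_derivative.

Lemma analytic_CK (R : realType) n (X H : tvsType (Fld R ScC)) (U : set X) (f : X -> H) :
  hausdorff_space H -> @analytic_series (Fld R ScC) X H U f -> CK n U f.
Proof.
move=> hH; elim: n X U f => [|n IH] X U f hf; have [oU /(cont_onP f oU) cf _] := hf; first by [].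
split=> //; have [F fF hF] := analytic_derivative hH hf.
by exists F => //; exact: IH.
Qed.

Lemma analytic_seriesP (R : realType) (X H : tvsType (Fld R ScC)) (U : set X) (f : X -> H) :
  hausdorff_space H ->
  @analytic_series (Fld R ScC) X H U f <-> forall n, CK n U f.
Proof. by move=> hH; split=> [h n|]; [exact: analytic_CK|exact: CK_analytic]. Qed.

(** * Real analytic maps through complex extensions *)

Section complexification.
Variable R : realType.
Local Notation C := (Fld R ScC).
Local Notation Rf := (Fld R ScR).

Lemma cplx_hausdorff (H : tvsType R) : hausdorff_space H -> hausdorff_space (cplx H).
Proof.
move=> hH [a b] [a' b'] ab; congr pair; apply: hH => A B nA nB.
  have n1 : nbhs ((a, b) : cplx H) (fst @^-1` A) := @at_fst H H (a, b) A nA.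
  have n2 : nbhs ((a', b') : cplx H) (fst @^-1` B) := @at_fst H H (a', b') B nB.
  by have [z [z1 z2]] := ab _ _ n1 n2; exists z.1.
have n1 : nbhs ((a, b) : cplx H) (snd @^-1` A) := @at_snd H H (a, b) A nA.
have n2 : nbhs ((a', b') : cplx H) (snd @^-1` B) := @at_snd H H (a', b') B nB.
by have [z [z1 z2]] := ab _ _ n1 n2; exists z.2.
Qed.

Lemma cplx_scaleE (H : tvsType R) (a : R[i]) (v : cplx H) :
  a *: v = (complex.Re a *: v.1 - complex.Im a *: v.2,
            complex.Re a *: v.2 + complex.Im a *: v.1).
Proof. by []. Qed.

Lemma at_cplx (T : topologicalType) (x : T) (X : tvsType R) (f g : T -> X) (a b : X) :
  f @ x --> a -> g @ x --> b ->
  (fun z => (f z, g z) : cplx X) @ x --> ((a, b) : cplx X).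
Proof. by move=> fa gb; exact: (at_pair fa gb). Qed.

Lemma cplx_clin (X H : tvsType R) (f : X -> H) : @clin R ScR X H f ->
  @clin R ScC (cplx X) (cplx H) (fun z => (f z.1, f z.2)).
Proof.
move=> hf; split=> [a x y|[a b]].
  rewrite !cplx_scaleE; congr pair; rewrite /= !(clinD hf).
    by rewrite -scaleNr !(clinZ hf) scaleNr.
  by rewrite !(clinZ hf).
exact: (at_cplx (cvg_comp _ _ (@at_fst X X (a, b)) (hf.2 _))
  (cvg_comp _ _ (@at_snd X X (a, b)) (hf.2 _))).
Qed.

(** The complexification of a product holds the same four components in another order. This
    direction joins two extensions into one; the inverse [cplx_unpair_clin] prepares the argument of
    a complexified bilinear map. *)
Lemma cplx_pair_clin (X Y : tvsType R) :
  @clin R ScC (cplx X * cplx Y)%type (cplx (X * Y)%type)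
    (fun p => ((p.1.1, p.2.1), (p.1.2, p.2.2))).
Proof.
split=> [a x y //|p].
have c1 := @at_fst (cplx X) (cplx Y) p; have c2 := @at_snd (cplx X) (cplx Y) p.
apply: at_cplx; apply: at_pair.
- exact: (@at_fst_comp _ X X _ _ _ c1).
- exact: (@at_fst_comp _ Y Y _ _ _ c2).
- exact: (@at_snd_comp _ X X _ _ _ c1).
- exact: (@at_snd_comp _ Y Y _ _ _ c2).
Qed.

Lemma cplx_unpair_clin (X Y : tvsType R) :
  @clin R ScC (cplx (X * Y)%type) (cplx X * cplx Y)%type
    (fun p => ((p.1.1, p.2.1), (p.1.2, p.2.2))).
Proof.
split=> [a x y //|p].
have c1 := @at_fst (X * Y)%type (X * Y)%type p; have c2 := @at_snd (X * Y)%type (X * Y)%type p.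
apply: at_pair; apply: at_cplx.
- exact: (@at_fst_comp _ X Y _ _ _ c1).
- exact: (@at_fst_comp _ X Y _ _ _ c2).
- exact: (@at_snd_comp _ X Y _ _ _ c1).
- exact: (@at_snd_comp _ X Y _ _ _ c2).
Qed.

Lemma cplx_cbil (X Y H : tvsType R) (b : X * Y -> H) : @cbil R ScR X Y H b ->
  @cbil R ScC (cplx X) (cplx Y) (cplx H)
    (fun p => (b (p.1.1, p.2.1) - b (p.1.2, p.2.2), b (p.1.1, p.2.2) + b (p.1.2, p.2.1))).
Proof.
move=> hb; have [bl br bc] := hb.
have b0l y : b (0, y) = 0.
  by apply: (addrI (b (0, y))); rewrite -(cbilDl hb) !addr0.
have b0r x : b (x, 0) = 0.
  by apply: (addrI (b (x, 0))); rewrite -(cbilDr hb) !addr0.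
have bZl (a : R) x y : b (a *: x, y) = a *: b (x, y).
  by have := bl y a x 0; rewrite !addr0 b0l addr0.
have bZr (a : R) x y : b (x, a *: y) = a *: b (x, y).
  by have := br x a y 0; rewrite !addr0 b0r addr0.
have bNl x y : b (- x, y) = - b (x, y) by rewrite -scaleN1r bZl scaleN1r.
have bNr x y : b (x, - y) = - b (x, y) by rewrite -scaleN1r bZr scaleN1r.
split.
- move=> [y y'] a [x x'] [u u']; rewrite cplx_scaleE; congr pair;
    rewrite /= !(cbilDl hb) ?bNl !bZl ?scalerBr !scalerDr ?opprD !addrA;
    by rewrite [LHS](ACl (1*4*5*2*3*6)).
- move=> [y y'] a [x x'] [u u']; rewrite cplx_scaleE; congr pair;
    rewrite /= !(cbilDr hb) ?bNr !bZr ?scalerBr !scalerDr ?opprD !addrA;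
    by rewrite [LHS](ACl (1*4*2*5*3*6)).
- move=> p.
have c1 := @at_fst (cplx X) (cplx Y) p; have c2 := @at_snd (cplx X) (cplx Y) p.
  have c11 := @at_fst_comp _ X X _ _ _ c1.
  have c12 := @at_snd_comp _ X X _ _ _ c1.
  have c21 := @at_fst_comp _ Y Y _ _ _ c2.
  have c22 := @at_snd_comp _ Y Y _ _ _ c2.
  apply: at_cplx.
    by apply: at_B; apply: (cvg_comp _ _ (at_pair _ _) (bc _)).
  by apply: at_D; apply: (cvg_comp _ _ (at_pair _ _) (bc _)).
Qed.

Lemma cplx_incl_continuous (X : tvsType R) : continuous (@cplx_incl R X).
Proof. by move=> x; apply: at_cplx; [exact: at_id|exact: at_cst]. Qed.

Lemma real_analyticP (X H : tvsType R) (U : set X) (f : X -> H) : hausdorff_space H ->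
  real_analytic U f <-> open U /\ exists (V : set (cplx X)) (g : cplx X -> cplx H),
    [/\ forall x, U x -> V (cplx_incl x), forall n, @CK R ScC n (cplx H) (cplx X) V g
      & forall x, U x -> g (cplx_incl x) = cplx_incl (f x)].
Proof.
move=> hH; have hC := cplx_hausdorff hH.
split=> -[oU [V [g [h1 h2 h3]]]]; split=> //; exists V, g; split=> //.
  exact: (@analytic_seriesP R (cplx X) (cplx H) V g hC).1.
exact: (@analytic_seriesP R (cplx X) (cplx H) V g hC).2.
Qed.

Section real_analytic_theory.
Variables (X H : tvsType R).
Hypothesis hH : hausdorff_space H.
Implicit Types (U : set X) (f : X -> H).

Lemma real_analytic_ext U f g : (forall x, U x -> f x = g x) ->
  real_analytic U f -> real_analytic U g.
Proof.
move=> fg [oU [V [G [h1 h2 h3]]]]; split=> //; exists V, G; split=> // x Ux.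
by rewrite -fg // h3.
Qed.

Lemma real_analytic_sub U W f : open W -> W `<=` U ->
  real_analytic U f -> real_analytic W f.
Proof.
move=> oW WU [oU [V [G [h1 h2 h3]]]]; split=> //; exists V, G.
by split=> // x /WU; [exact: h1|exact: h3].
Qed.

Lemma real_analytic_cont U f : real_analytic U f -> cont_on U f.
Proof.
move=> /(real_analyticP _ _ hH)[oU [V [g [h1 h2 h3]]]] x Ux.
have := CK_cont (h2 0%N) (h1 x Ux) => cg.
have c1 := cvg_comp _ _ (@cplx_incl_continuous X x) cg.
have c2 := @at_fst_comp _ H H _ _ _ c1.
rewrite h3 // in c2; move: c2 => /= c2 A nA; have nU : nbhs x U by exact: open_nbhs_nbhs.
have := c2 A nA; apply: (@filterS2 _ (nbhs x) _ _ _ _ _ nU) => y Uy /=.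
by rewrite h3.
Qed.

Lemma real_analytic_clin U f : @clin R ScR X H f -> open U -> real_analytic U f.
Proof.
move=> hf oU; apply/real_analyticP => //; split=> //.
exists setT, (fun z => (f z.1, f z.2)); split=> //.
  by move=> n; apply: CK_clin; [exact: cplx_clin|exact: openT].
by move=> x Ux; rewrite /cplx_incl /= (clin0 hf).
Qed.
End real_analytic_theory.

Lemma real_analytic_comp (X Y H : tvsType R) (U : set X) (V : set Y) (f : X -> Y)
    (g : Y -> H) : hausdorff_space Y -> hausdorff_space H ->
  real_analytic U f -> real_analytic V g -> (forall x, U x -> V (f x)) ->
  real_analytic U (g \o f).
Proof.
move=> hY hH /(real_analyticP _ _ hY)[oU [U' [F [F1 F2 F3]]]].
move=> /(real_analyticP _ _ hH)[oV [V' [G [G1 G2 G3]]]] UV.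
apply/real_analyticP => //; split=> //.
have oU' := CK_open (F2 0%N); have oV' := CK_open (G2 0%N).
have oW : open (U' `&` F @^-1` V').
  rewrite openE => z [Uz Vz]; apply: filterI; first exact: open_nbhs_nbhs.
  exact: (CK_cont (F2 0%N) Uz (open_nbhs_nbhs (conj oV' Vz))).
exists (U' `&` F @^-1` V'), (G \o F); split.
- by move=> x Ux; split; [exact: F1|rewrite /= F3 //; exact/G1/UV].
- move=> n; apply: (CK_comp _ (G2 n)); last by move=> z [].
  by apply: CK_sub (F2 n) => // z [].
- by move=> x Ux; rewrite /= F3 // G3 //; exact: UV.
Qed.

Lemma real_analytic_pair (X Y H : tvsType R) (U : set X) (f : X -> Y) (g : X -> H) :
  hausdorff_space Y -> hausdorff_space H -> hausdorff_space (Y * H)%type ->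
  real_analytic U f -> real_analytic U g ->
  @real_analytic R X (Y * H)%type U (fun x => (f x, g x)).
Proof.
move=> hY hH hYH /(real_analyticP _ _ hY)[oU [U' [F [F1 F2 F3]]]].
move=> /(real_analyticP _ _ hH)[_ [V' [G [G1 G2 G3]]]].
apply/real_analyticP => //; split=> //.
have oW : open (U' `&` V') by apply: openI; [exact: CK_open (F2 0%N)|exact: CK_open (G2 0%N)].
exists (U' `&` V'), ((fun p => ((p.1.1, p.2.1), (p.1.2, p.2.2))) \o (fun z => (F z, G z))); split.
- by move=> x Ux; split; [exact: F1|exact: G1].
- move=> n.
  have C1 : @CK R ScC n (cplx Y) (cplx X) (U' `&` V') F by apply: CK_sub (F2 n) => // z [].
  have C2 : @CK R ScC n (cplx H) (cplx X) (U' `&` V') G by apply: CK_sub (G2 n) => // z [].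
  exact: (CK_comp (CK_pair C1 C2) (CK_clin n (cplx_pair_clin Y H) openT)).
- by move=> x Ux; rewrite /= F3 // G3.
Qed.

Lemma real_analytic_cbil (X Y H : tvsType R) (U : set (X * Y)) (b : X * Y -> H) :
  hausdorff_space H -> @cbil R ScR X Y H b -> open U ->
  @real_analytic R (X * Y)%type H U b.
Proof.
move=> hH hb oU; apply/real_analyticP => //; split=> //.
pose B (p : cplx X * cplx Y) : cplx H :=
  (b (p.1.1, p.2.1) - b (p.1.2, p.2.2), b (p.1.1, p.2.2) + b (p.1.2, p.2.1)).
exists setT, (B \o (fun p => ((p.1.1, p.2.1), (p.1.2, p.2.2)))); split=> //.
  move=> n.
  exact: (CK_comp (CK_clin n (cplx_unpair_clin X Y) openT) (CK_cbil n (cplx_cbil hb) openT)).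
move=> [x y] _; rewrite /B /cplx_incl /=.
have b0l y' : b (0, y') = 0.
  by apply: (addrI (b (0, y'))); rewrite -(cbilDl hb) !addr0.
have b0r x' : b (x', 0) = 0.
  by apply: (addrI (b (x', 0))); rewrite -(cbilDr hb) !addr0.
by rewrite b0l b0r b0l subr0 addr0.
Qed.
End complexification.

(** * Gluing real analytic maps *)

Section glue.
Variable R : realType.
Local Notation C := (Fld R ScC).

Lemma nbhs_cplx_csemi (X : tvsType R) (x : X) (V : set (cplx X)) (W : set X) :
  nbhs (cplx_incl x) V -> nbhs x W ->
  exists q : X -> R, [/\ @csemi R ScR X q,
    forall z : cplx X, q (z.1 - x) < 1 -> q z.2 < 1 -> V z
  & forall y, q (y - x) < 1 -> W y].
Proof.
move=> [[A B] /= [nA nB] AB] nW.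
have [qa [ha qaA]] := @csemi_ex R ScR X x A nA.
have [qb [hb' qbB]] := @csemi_ex R ScR X 0 B nB.
have [qw [hw qwW]] := @csemi_ex R ScR X x W nW.
exists (fun y => qa y + qb y + qw y); split.
- by apply: csemi_add => //; exact: csemi_add.
- move=> [a b] /= h1 h2; apply: AB; split => /=.
    apply: qaA; have := csemi_ge0 hb' (a - x); have := csemi_ge0 hw (a - x); lra.
  apply: qbB; rewrite subr0; have := csemi_ge0 ha b; have := csemi_ge0 hw b; lra.
- move=> y h; apply: qwW; have := csemi_ge0 ha (y - x); have := csemi_ge0 hb' (y - x); lra.
Qed.

(** A complex derivative can be computed along real multiples of c alone, where the difference
    quotients vanish. The induction on m proves the vanishing on the whole segment, not only at
    x. *)
Lemma iterD_real_zero (X H : tvsType C) (U : set X) (h : X -> H) (x y : X) (c : C) :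
  hausdorff_space H -> (forall n, CK n U h) -> c != 0 ->
  (forall s : R, `|s| < 2 -> U (x + (ofR s * c) *: y) /\ h (x + (ofR s * c) *: y) = 0) ->
  forall m, iterD h (nseq m y) x = 0.
Proof.
move=> hH Ch c0 hs.
suff E m s : `|s| < 2 -> iterD h (nseq m y) (x + (ofR s * c) *: y) = 0.
  by move=> m; have := E m 0; rewrite rmorph0 mul0r scale0r addr0 normr0; apply.
elim: m s => [|m IH] s s2; first by have [] := hs s s2.
apply: (hausdorff_csemi hH) => q hq.
have [Us _] := hs s s2.
apply/eqP; rewrite eq_le csemi_ge0 // andbT; apply/ler_addgt0Pr => e e0; rewrite add0r.
have /nbhs_nrm[d d0 hd] := iterD_cder hH hq Ch m Us e0.
have nc : 0 < nrm c by rewrite nrm_gt0.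
pose t := Num.min ((2 - `|s|) / 2) (d / nrm c / 2).
have t0 : 0 < t by rewrite lt_min !divr_gt0 // subr_gt0.
have td : nrm (ofR t * c) < d.
  rewrite nrmM nrm_ofR gtr0_norm // -ltr_pdivlMr //.
  apply: (@le_lt_trans _ _ (d / nrm c / 2)); first by rewrite ge_min lexx orbT.
  by rewrite ltr_pdivrMr // ltr_pMr ?divr_gt0 // ltr1n.
have st2 : `|s + t| < 2.
  apply: le_lt_trans (ler_normD _ _) _; rewrite (gtr0_norm t0).
  have : t <= (2 - `|s|) / 2 by rewrite ge_min lexx.
  lra.
have := hd (ofR t * c); rewrite subr0 => /(_ td).
rewrite -mulrDl -rmorphD !IH // subrr sub0r csemiN // csemiZ // [e * _]mulrC ler_pM2l //.
by rewrite nrmM nrm_ofR gtr0_norm // mulr_gt0.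
Qed.

(** The local extensions are shrunk to sets [E x] on whose overlaps they agree; then any x with z in
    [E x] may be used to define the global extension at z. *)
Lemma real_analytic_local (X H : tvsType R) (U : set X) (f : X -> H) :
  hausdorff_space H ->
  (forall x, U x -> exists W, [/\ W x, W `<=` U & real_analytic W f]) ->
  real_analytic U f.
Proof.
move=> hH hU; have hC := cplx_hausdorff hH.
apply/real_analyticP => //; split.
  rewrite openE => x /hU[W [Wx WU [oW _]]].
  by apply: filterS WU _; exact: open_nbhs_nbhs.
have /choice[D hD] : forall x, exists d : (cplx X -> cplx H) * (X -> R) * set (cplx X),
    U x -> [/\ @csemi R ScR X d.1.2,
      forall z : cplx X, d.1.2 (z.1 - x) < 1 -> d.1.2 z.2 < 1 -> d.2 z,
      forall n, @CK R ScC n (cplx H) (cplx X) d.2 d.1.1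
    & forall y, d.1.2 (y - x) < 1 -> U y /\ d.1.1 (cplx_incl y) = cplx_incl (f y)].
  move=> x; have [Ux|nUx] := pselect (U x); last by exists ((fun=> 0), (fun=> 0), set0).
  have [W [Wx WU /(real_analyticP _ _ hH)[oW [V [g [h1 h2 h3]]]]]] := hU x Ux.
  have nV : nbhs (cplx_incl x) V.
    by apply: open_nbhs_nbhs; split; [exact: CK_open (h2 0%N)|exact: h1].
  have [q [hq qV qW]] := nbhs_cplx_csemi nV (open_nbhs_nbhs (conj oW Wx)).
  exists (g, q, V) => _; split => // y /qW Wy; split; [exact: WU|exact: h3].
pose q x := (D x).1.2; pose g x := (D x).1.1.
(* The radius 1/4 keeps the disc of radius 2 in the direction i Im z, required by [taylor_cvg],
   inside the domain: 1/4 + 2 * 1/4 < 1. *)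
pose E x := [set z : cplx X | q x (z.1 - x) < 1 / 4 /\ q x z.2 < 1 / 4].
have oE x : U x -> open (E x).
  move=> Ux; have [hq _ _ _] := hD x Ux; rewrite -/(q x) in hq.
  rewrite openE => z [z1 z2].
  have e1 : 0 < 1 / 4 - q x (z.1 - x) by rewrite subr_gt0.
  have e2 : 0 < 1 / 4 - q x z.2 by rewrite subr_gt0.
  exists ([set y | q x (y - z.1) < 1 / 4 - q x (z.1 - x)],
          [set y | q x (y - z.2) < 1 / 4 - q x z.2]).
    by split; exact: (csemi_nbhs hq).
  move=> [a b] /= [h1 h2]; split => /=.
    by have := csemi_dist hq a z.1 x; lra.
  by have := csemi_dist hq b z.2 0; rewrite !subr0; lra.
have agree x y z : U x -> U y -> E x z -> E y z -> g x z = g y z.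
  case: z => a b Ux Uy [/= x1 x2] [/= y1 y2].
  (* The difference of the two extensions vanishes on the real points around Re z, hence
     so do its derivatives there, and Taylor's formula in the direction i Im z applies. *)
  have [hqx hVx Cx gx] := hD x Ux; have [hqy hVy Cy gy] := hD y Uy.
  pose h z := g x z + (-1 : C) *: g y z.
  have oV : open ((D x).2 `&` (D y).2) by apply: openI; [exact: CK_open (Cx 0%N)|exact: CK_open (Cy 0%N)].
  have Ch n : @CK R ScC n (cplx H) (cplx X) ((D x).2 `&` (D y).2) h.
    have C1 : @CK R ScC n (cplx H) (cplx X) ((D x).2 `&` (D y).2) (g x) by apply: CK_sub (Cx n) => // ? [].
    have C2 : @CK R ScC n (cplx H) (cplx X) ((D x).2 `&` (D y).2) (g y) by apply: CK_sub (Cy n) => // ? [].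
    apply: CK_D => //.
    have hs : @clin R ScC (cplx H) (cplx H) (fun v => (-1 : C) *: v).
      split=> [c u v|v]; first by rewrite scalerDr !scalerA mulrC.
      by apply: at_Z; [exact: at_cst|exact: at_id].
    exact: (CK_comp C2 (CK_clin n hs openT)).
  pose ib : cplx X := (0, b).
  (* For purely imaginary c these points are real, and both extensions take the value of f there. *)
  have curve (c : C) : cplx_incl a + c *: ib = (a - complex.Im c *: b, complex.Re c *: b).
    by rewrite cplx_scaleE /= !scaler0 sub0r addr0; congr pair; exact: add0r.
  have nIm (c : R[i]) : `|complex.Im c| <= nrm (c : C).
    rewrite -(@ler_pXn2r _ 2) ?nnegrE ?nrm_ge0 // nrm_sqrC real_normK ?num_real //.
    by rewrite lerDr sqr_ge0.
  have nRe (c : R[i]) : `|complex.Re c| <= nrm (c : C).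
    rewrite -(@ler_pXn2r _ 2) ?nnegrE ?nrm_ge0 // nrm_sqrC real_normK ?num_real //.
    by rewrite lerDl sqr_ge0.
  have qa p (w : X) (s : R) : @csemi R ScR X p -> p (a - w) < 1 / 4 -> p b < 1 / 4 -> `|s| <= 2 ->
      p (a - s *: b - w) < 1 /\ p (s *: b) < 1.
    move=> hp p1 p2 s2; have pb := csemi_ge0 hp b.
    have E0 : p (s *: b) = `|s| * p b by exact: (csemiZ hp).
    have E1 : `|s| * p b <= 2 * p b by rewrite ler_wpM2r.
    split; last by rewrite E0; lra.
    rewrite addrAC; have := csemiD hp (a - w) (- (s *: b)).
    by rewrite (csemiN hp) E0; lra.
  have inV (c : C) : nrm c <= 2 -> ((D x).2 `&` (D y).2) (cplx_incl a + c *: ib).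
    move=> c2; rewrite curve.
    have i2 := le_trans (nIm c) c2; have r2 := le_trans (nRe c) c2.
    split; [apply: hVx|apply: hVy] => /=.
    + by have [] := qa _ x _ hqx x1 x2 i2.
    + by have [] := qa _ x _ hqx x1 x2 r2.
    + by have [] := qa _ y _ hqy y1 y2 i2.
    + by have [] := qa _ y _ hqy y1 y2 r2.
  have h0 : h (cplx_incl a + ib) = 0.
    have := taylor_cvg hC Ch inV.
    have Z := @iterD_real_zero (cplx X) (cplx H) _ h (cplx_incl a) ib (Complex 0 1 : C) hC Ch.
    have ni : nrm (Complex 0 1 : C) = 1.
      by apply/eqP; rewrite -(@pexpr_eq1 _ _ 2) ?nrm_ge0 // nrm_sqrC /= expr0n add0r expr1n.
    have c0 : (Complex 0 1 : C) != 0 by rewrite -nrm_gt0 ni.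
    have hz s : `|s| < 2 -> ((D x).2 `&` (D y).2) (cplx_incl a + (ofR s * (Complex 0 1 : C)) *: ib) /\
        h (cplx_incl a + (ofR s * (Complex 0 1 : C)) *: ib) = 0.
      move=> s2; split.
        by apply: inV; rewrite nrmM nrm_ofR ni mulr1 ltW.
      rewrite curve.
      have -> : complex.Re (ofR s * (Complex 0 1 : C)) = 0 by rewrite /= mulr0 mul0r subr0.
      have -> : complex.Im (ofR s * (Complex 0 1 : C)) = s by rewrite /= mulr1 mul0r addr0.
      rewrite scale0r -[(_, 0)]/(cplx_incl _) /h.
      have [_ gxa] := gx (a - s *: b) (qa _ x s hqx x1 x2 (ltW s2)).1.
      have [_ gya] := gy (a - s *: b) (qa _ y s hqy y1 y2 (ltW s2)).1.
      by rewrite /g gxa gya scaleN1r subrr.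
    have {}Z := Z c0 hz.
    under eq_fun do under eq_bigr do rewrite Z scaler0.
    move=> cv; have cv0 : (\sum_(m < N) (0 : cplx H) @[N --> \oo]) --> (0 : cplx H).
      by under eq_fun do rewrite big1_eq; exact: (@cvg_cst _ _ _ \oo).
    exact: (cvg_unique hC cv cv0).
  have := curve 1; rewrite scale1r /= scale0r subr0 scale1r => E1.
  move: h0; rewrite E1 /h scaleN1r => /eqP; rewrite subr_eq0 => /eqP; exact.
pose pick z := xget (0 : X) [set x | U x /\ E x z].
have pickP x z : U x -> E x z -> U (pick z) /\ E (pick z) z.
  by move=> Ux Ez; exact: (@xgetI _ _ [set x | U x /\ E x z] x (conj Ux Ez)).
have Eincl x : U x -> E x (cplx_incl x).
  move=> Ux; have [hq _ _ _] := hD x Ux.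
  by split => /=; rewrite /q ?subrr (csemi0 hq) divr_gt0.
exists [set z | exists2 x, U x & E x z], (fun z => g (pick z) z); split.
- by move=> x Ux; exists x => //; exact: Eincl.
- move=> n; apply: CK_local => // z [x Ux Ez]; exists (E x); split => //.
    by move=> w Ew; exists x.
  have [hq hV Cx _] := hD x Ux.
  have CE : @CK R ScC n (cplx H) (cplx X) (E x) (g x).
    apply: CK_sub (Cx n); first exact: oE.
    by move=> w [w1 w2]; apply: hV; rewrite -/(q x); lra.
  apply: CK_ext CE => w Ew; have [Up Ep] := pickP x w Ux Ew.
  exact: agree.
- move=> x Ux; have [Up Ep] := pickP x _ Ux (Eincl x Ux).
  rewrite (agree _ _ _ Up Ux Ep (Eincl x Ux)).
  have [hq _ _ gx] := hD x Ux; apply: (gx x _).2.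
  by rewrite subrr (csemi0 hq).
Qed.
End glue.

Lemma hausdorff_prod (X Y : topologicalType) :
  hausdorff_space X -> hausdorff_space Y -> hausdorff_space (X * Y)%type.
Proof.
move=> hX hY [a b] [a' b'] ab; congr pair; [apply: hX|apply: hY] => A B nA nB.
  have n1 : nbhs (a, b) (fst @^-1` A) := @at_fst X Y (a, b) A nA.
  have n2 : nbhs (a', b') (fst @^-1` B) := @at_fst X Y (a', b') B nB.
  by have [z [z1 z2]] := ab _ _ n1 n2; exists z.1.
have n1 : nbhs (a, b) (snd @^-1` A) := @at_snd X Y (a, b) A nA.
have n2 : nbhs (a', b') (snd @^-1` B) := @at_snd X Y (a', b') B nB.
by have [z [z1 z2]] := ab _ _ n1 n2; exists z.2.
Qed.

(** * The calculus of C^r-maps *)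

Section Cr_theory.
Variable R : realType.

Definition finite_order (r : smoothness) (n : nat) :=
  if r is Fin m then (n <= m)%N else true.

(** Real analyticity is the one class described by extensions; all others, complex analyticity
    included, amount to [CK n] for the admissible finite n. Each rule of the calculus is proved for
    these two cases. *)
Lemma Cr_cases (k : Defs.scalar) (r : smoothness) :
  (k = ScR /\ r = Omega) \/
  forall (X H : tvsType (Fld R k)) (U : set X) (f : X -> H), hausdorff_space H ->
    Cr r U f <-> forall n, finite_order r n -> CK n U f.
Proof.
case: r => [m||]; [right|right|].
- move=> X H U f hH; split=> [/(Cfin_CK _ _ _ hH) h n nm|h].
    exact: CK_le nm h.
  by apply/Cfin_CK => //; exact: h (leqnn m).
- move=> X H U f hH; split=> [h n _|h n]; first exact/Cfin_CK/h.
  by apply/Cfin_CK => //; exact: h.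
- case: k; [by left|right] => X H U f hH.
  split=> [/(analytic_seriesP _ _ hH) h n _|h]; first exact: h.
  by apply/analytic_seriesP => // n; exact: h.
Qed.

Lemma finite_order0 r : finite_order r 0. Proof. by case: r. Qed.

Variables (k : Defs.scalar) (r : smoothness).
Local Notation K := (Fld R k).

Lemma Cr_open (X H : tvsType K) (U : set X) (f : X -> H) : Cr r U f -> open U.
Proof.
move: X H U f; case: r => [m||] X H U f; [by case|by move=> /(_ 0%N)[]|].
by move: X H U f; case: k => X H U f; case.
Qed.

Lemma Cr_cont (X H : tvsType K) (U : set X) (f : X -> H) :
  hausdorff_space H -> Cr r U f -> cont_on U f.
Proof.
move: X H U f; case: (Cr_cases k r) => [[-> ->]|h] X H U f hH.
  exact: real_analytic_cont.
by move=> /(h _ _ _ _ hH) Cf; exact: CK_cont (Cf 0%N (finite_order0 r)).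
Qed.

Lemma Cr_ext (X H : tvsType K) (U : set X) (f g : X -> H) : hausdorff_space H ->
  (forall x, U x -> f x = g x) -> Cr r U f -> Cr r U g.
Proof.
move: X H U f g; case: (Cr_cases k r) => [[-> ->]|h] X H U f g hH fg.
  exact: real_analytic_ext.
by move=> /(h _ _ _ _ hH) Cf; apply/h => // n /Cf; exact: CK_ext.
Qed.

Lemma Cr_sub (X H : tvsType K) (U W : set X) (f : X -> H) : hausdorff_space H ->
  open W -> W `<=` U -> Cr r U f -> Cr r W f.
Proof.
move: X H U W f; case: (Cr_cases k r) => [[-> ->]|h] X H U W f hH oW WU.
  exact: real_analytic_sub.
by move=> /(h _ _ _ _ hH) Cf; apply/h => // n /Cf; exact: CK_sub.
Qed.

Lemma Cr_local (X H : tvsType K) (U : set X) (f : X -> H) : hausdorff_space H ->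
  (forall x, U x -> exists W, [/\ W x, W `<=` U & Cr r W f]) -> Cr r U f.
Proof.
move: X H U f; case: (Cr_cases k r) => [[-> ->]|h] X H U f hH hU.
  exact: real_analytic_local.
apply/h => // n rn; apply: CK_local => // x /hU[W [Wx WU /(h _ _ _ _ hH) Cf]].
by exists W; split => //; exact: Cf.
Qed.

Lemma Cr_comp (X Y H : tvsType K) (U : set X) (V : set Y) (f : X -> Y) (g : Y -> H) :
  hausdorff_space Y -> hausdorff_space H ->
  Cr r U f -> Cr r V g -> (forall x, U x -> V (f x)) -> Cr r U (g \o f).
Proof.
move: X Y H U V f g; case: (Cr_cases k r) => [[-> ->]|h] X Y H U V f g hY hH.
  exact: real_analytic_comp.
move=> /(h _ _ _ _ hY) Cf /(h _ _ _ _ hH) Cg UV; apply/h => // n rn.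
exact: CK_comp (Cf n rn) (Cg n rn) UV.
Qed.

Lemma Cr_pair (X Y H : tvsType K) (U : set X) (f : X -> Y) (g : X -> H) :
  hausdorff_space Y -> hausdorff_space H ->
  Cr r U f -> Cr r U g -> Cr r U (fun x => (f x, g x) : (Y * H)%type).
Proof.
move=> hY hH; have hYH := hausdorff_prod hY hH; move: X Y H U f g hY hH hYH.
case: (Cr_cases k r) => [[-> ->]|h] X Y H U f g hY hH hYH.
  exact: real_analytic_pair.
move=> /(h _ _ _ _ hY) Cf /(h _ _ _ _ hH) Cg; apply/h => // n rn.
exact: CK_pair (Cf n rn) (Cg n rn).
Qed.

Lemma Cr_clin (X H : tvsType K) (U : set X) (f : X -> H) : hausdorff_space H ->
  clin f -> open U -> Cr r U f.
Proof.
move: X H U f; case: (Cr_cases k r) => [[-> ->]|h] X H U f hH hf oU.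
  exact: real_analytic_clin.
by apply/h => // n _; exact: CK_clin.
Qed.

Lemma Cr_cbil (X Y H : tvsType K) (U : set (X * Y)) (b : X * Y -> H) :
  hausdorff_space H -> cbil b -> open U -> Cr r U b.
Proof.
move: X Y H U b; case: (Cr_cases k r) => [[-> ->]|h] X Y H U b hH hb oU.
  exact: real_analytic_cbil.
by apply/h => // n _; exact: CK_cbil.
Qed.

Lemma Cr_cst (X H : tvsType K) (U : set X) (a : H) : hausdorff_space H ->
  open U -> Cr r U (fun=> a).
Proof.
move: X H U a; case: (Cr_cases k r) => [[-> ->]|h] X H U a hH oU.
  split=> //; exists setT, (fun=> cplx_incl a); split => //.
  apply/analytic_seriesP => [|n]; first exact: cplx_hausdorff.
  exact: (@CK_cst R ScC n (cplx X) (cplx H) setT _ openT).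
by apply/h => // n _; exact: CK_cst.
Qed.

Lemma Cr_sum (X H : tvsType K) (U : set X) n (f : 'I_n -> X -> H) : hausdorff_space H ->
  open U -> (forall i, Cr r U (f i)) -> Cr r U (fun x => \sum_(i < n) f i x).
Proof.
move=> hH oU Cf; elim: (index_enum _) => [|i s IH].
  rewrite [X in Cr _ _ X](_ : _ = fun=> 0); first exact: Cr_cst.
  by apply/funext => x; rewrite big_nil.
rewrite [X in Cr _ _ X](_ : _ = (fun p => p.1 + p.2) \o
    (fun x => (f i x, \sum_(j <- s) f j x))); last first.
  by apply/funext => x; rewrite big_cons.
apply: (Cr_comp _ hH (Cr_pair hH hH (Cf i) IH) (Cr_clin hH (clin_add H) openT)) => //.
exact: hausdorff_prod.
Qed.
End Cr_theory.

(** * Tensor products with a finite-dimensional factor *)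

Section basis_coord_continuous.
Variables (R : realType) (k : Defs.scalar).
Local Notation K := (Fld R k).
Variables (V : tvsType K) (n : nat) (e : 'I_n -> V) (he : is_basis e).
Hypothesis hV : hausdorff_space V.

Let comb (a : {ptws 'I_n -> K}) : V := \sum_i a i *: e i.

Let comb_continuous : continuous comb.
Proof.
move=> a; apply: at_sum => i _; apply: at_Z; last exact: at_cst.
exact: (@proj_continuous _ (fun=> K) i a).
Qed.

Let coord_comb a : basis_coord he (comb a) = [ffun i => a i].
Proof.
by apply: basis_coord_unique; apply: eq_bigr => i _; rewrite ffunE.
Qed.

(* A vector with largest coordinate a_j is a_j times the image of a point of sphere j,
   and these images are compact and do not contain 0. *)
Let sphere (j : 'I_n) : set {ptws 'I_n -> K} :=
  [set a | forall i, (if i == j then [set z : K | nrm z = 1] else [set z : K | nrm z <= 1]) (a i)].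

Let sphere_compact j : compact (sphere j).
Proof.
pose A i : set K := if i == j then [set z : K | nrm z = 1] else [set z : K | nrm z <= 1].
suff cA i : compact (A i) by exact: (@tychonoff 'I_n (fun=> K) A cA).
rewrite /A; case: ifP => _; last exact: compact_disc.
have cl : closed [set z : K | nrm z = 1].
  apply: (@closed_comp _ _ (@nrm R k) [set x | x = 1]); last exact: closed_eq.
  by move=> z _; exact: nrm_continuous.
by apply: (subclosed_compact cl (@compact_disc R k 1)) => z /= ->.
Qed.

Lemma basis_coord_csemi : exists2 q : V -> R, csemi q &
  forall v i, nrm (basis_coord he v i) <= q v.
Proof.
have cS j : compact (comb @` sphere j).
  apply: continuous_compact; last exact: sphere_compact.
  exact: continuous_subspaceT.
have nS j : nbhs (0 : V) (~` (comb @` sphere j)).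
  apply: open_nbhs_nbhs; split; first exact: closed_openC (compact_closed hV (cS j)).
  move=> [a aS a0]; have := aS j; rewrite eqxx /= => aj.
  have := coord_comb a; rewrite a0 => /ffunP /(_ j); rewrite ffunE => aj0.
  have /ffunP /(_ j) : basis_coord he 0 = [ffun=> 0].
    by apply: basis_coord_unique; rewrite big1 // => i _; rewrite ffunE scale0r.
  rewrite aj0 ffunE => aj00; move: aj; rewrite aj00 nrm0 => /esym /eqP.
  by rewrite oner_eq0.
have nN := @filter_forall _ _ _ (nbhs (0 : V)) _ nS.
have [q [hq qN]] := csemi_ex0 (nN _).
exists q => // v i; pose a := basis_coord he v.
have [j _ jmax] := @arg_maxP _ _ _ i predT (fun l => nrm (a l)) isT.
apply: le_trans (jmax i isT) _; have [->|aj] := eqVneq (a j) 0.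
  by rewrite nrm0 csemi_ge0.
have aj0 : 0 < nrm (a j) by rewrite nrm_gt0.
(* Otherwise v / a_j would avoid the image of [sphere j]; but it lies there, having the coordinates
   a_l / a_j, of absolute value at most 1, and exactly 1 at j. *)
have : 1 <= q ((a j)^-1 *: v).
  rewrite leNgt; apply/negP => /qN /(_ j); apply.
  exists (fun l => (a j)^-1 * a l).
    move=> l; case: eqP => [->|_] /=; rewrite nrmM nrmV.
      by rewrite mulVf // gt_eqF.
    by rewrite mulrC ler_pdivrMr // mul1r; exact: jmax.
  rewrite /comb [in RHS](basis_coordE he v) scaler_sumr.
  by apply: eq_bigr => l _; rewrite scalerA.
by rewrite csemiZ // nrmV mulrC ler_pdivlMr // mul1r.
Qed.

Lemma basis_coord_continuous i : continuous (fun v => basis_coord he v i).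
Proof.
have [q hq qc] := basis_coord_csemi.
move=> v U /nbhs_nrm[eps eps0 eU]; have := csemi_nbhs hq v eps0.
apply: filterS => y /= yv; apply: eU; apply: le_lt_trans yv.
suff <- : basis_coord he (y - v) i = basis_coord he y i - basis_coord he v i by exact: qc.
have := basis_coord_linear he i (-1) v y.
by rewrite /= !scaleN1r (addrC (- v)) => ->; rewrite addrC.
Qed.
End basis_coord_continuous.

Section tens_map_linear.
Variables (L : fieldType) (V V' W W' : lmodType L) (f : V -> V') (g : W -> W').
Hypotheses (fl : linear f) (gl : linear g).

Lemma tens_mapE v w : tens_map f g (tens v w) = tens (f v) (g w).
Proof.
rewrite /tens_map tens_liftE // => u a x y.
  by rewrite fl tens_is_Dl tens_is_Zl.
by rewrite gl tens_is_Dr tens_is_Zr.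
Qed.

Lemma tens_map_linear : linear (tens_map f g).
Proof.
apply: tens_lift_linear => u a x y.
  by rewrite fl tens_is_Dl tens_is_Zl.
by rewrite gl tens_is_Dr tens_is_Zr.
Qed.

Lemma tens_map_sumb n (e : 'I_n -> V) (y : 'I_n -> W) :
  tens_map f g (tens_sumb e y) = \sum_i tens (f (e i)) (g (y i)).
Proof.
pose F : {linear _ -> _} := HB.pack (tens_map f g)
  (GRing.isLinear.Build _ _ _ _ _ tens_map_linear).
rewrite /tens_sumb; transitivity (\sum_i tens_map f g (tens (e i) (y i))).
  exact: (raddf_sum F).
by apply: eq_bigr => i _; exact: tens_mapE.
Qed.
End tens_map_linear.

Section tensor_topology.
Variables (R : realType) (c : scalars).
Local Notation K := (Fld R (baseK c)).
Local Notation L := (Fld R (fibK c)).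
Variables (F1 F2 : tvsType L) (n : nat) (e : 'I_n -> F1) (he : is_basis e).
Local Notation T12 := (tensorT he F2).

Lemma tens_coord_continuous i : continuous (fun w : T12 => tens_coord he w i).
Proof.
have [_ hc _ _] := tensorT_homeo he F2.
move=> w; pose g : {ptws 'I_n -> F2} -> F2 := fun y => y i.
have hg : continuous g := @proj_continuous _ (fun=> F2) i.
exact: (@at_comp _ w {ptws 'I_n -> F2} F2 _ g (hc w) (hg _)).
Qed.

Lemma at_tensorT (T : topologicalType) (x : T) (f : T -> T12) :
  (forall i, (fun z => tens_coord he (f z) i) @ x --> tens_coord he (f x) i) ->
  f @ x --> f x.
Proof.
move=> h; have [hs _ _ hK] := tensorT_homeo he F2.
rewrite (_ : f = tens_sumb e \o (fun z => tens_coord he (f z))); last first.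
  by apply/funext => z /=; rewrite tens_coordK.
pose g z : {ptws 'I_n -> F2} := tens_coord he (f z).
have gx : g @ x --> g x by exact: ptws_at.
exact: (@at_comp _ x {ptws 'I_n -> F2} T12 g (tens_sumb e) gx (hs _)).
Qed.

Lemma tensorT_hausdorff : hausdorff_space F2 -> hausdorff_space T12.
Proof.
move=> hF v w vw; rewrite -(tens_coordK he v) -(tens_coordK he w); congr tens_sumb.
apply/funext => i; apply: hF => A B nA nB.
have [z [zA zB]] := vw _ _ (tens_coord_continuous nA) (tens_coord_continuous nB).
by exists (tens_coord he z i).
Qed.

Lemma tens_coord_clin i :
  clin ((fun w => tens_coord he w i) : restr T12 -> restr F2).
Proof.
split; last exact: tens_coord_continuous.
move=> a v w; exact: (tens_coord_linear he i (emb a) v w).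
Qed.

Hypothesis hF1 : hausdorff_space F1.

(** The i-th coordinate of v (x) w is the i-th coordinate of v times w, so continuity reduces to
    that of the coordinate functionals of F1. *)
Lemma tens_cbil :
  cbil ((fun p => @tens L F1 F2 p.1 p.2) : (restr F1 * restr F2)%type -> restr T12).
Proof.
split.
- move=> w a u v /=.
  by rewrite -[RHS]/(emb a *: @tens L F1 F2 u w + @tens L F1 F2 v w) -tens_is_Zl -tens_is_Dl.
- move=> u a v w /=.
  by rewrite -[RHS]/(emb a *: @tens L F1 F2 u v + @tens L F1 F2 u w) -tens_is_Zr -tens_is_Dr.
- move=> p; apply: at_tensorT => i.
  under eq_fun do rewrite tens_coordE.
  rewrite tens_coordE; apply: at_Z; last exact: (@at_snd F1 F2 p).
  have h1 : (fst : restr F1 * restr F2 -> restr F1) @ p --> p.1 by exact: at_fst.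
have h2 := @basis_coord_continuous R (fibK c) F1 n e he hF1 i p.1.
exact: (@at_comp _ p (restr F1) L fst (fun v => basis_coord he v i) h1 h2).
Qed.

Hypothesis hF2 : hausdorff_space F2.
Variable r : smoothness.

Lemma tens_map_Cr (P : tvsType K) (O : set P) (B1 : P -> F1 -> F1) (B2 : P -> F2 -> F2) :
  open O -> hausdorff_space P ->
  (forall p, O p -> linear (B1 p)) -> (forall p, O p -> linear (B2 p)) ->
  Cr r (O `*` setT) ((fun z => B1 z.1 z.2) : (P * restr F1)%type -> restr F1) ->
  Cr r (O `*` setT) ((fun z => B2 z.1 z.2) : (P * restr F2)%type -> restr F2) ->
  Cr r (O `*` setT) ((fun z => tens_map (B1 z.1) (B2 z.1) z.2) :
     (P * restr T12)%type -> restr T12).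
Proof.
move=> oO hP l1 l2 C1 C2; have oOT := @open_XT _ (restr T12) _ oO.
have hT : hausdorff_space (restr T12) by exact: tensorT_hausdorff.
have hR1 : hausdorff_space (restr F1) by [].
have hR2 : hausdorff_space (restr F2) by [].
have Cfst : Cr r (O `*` setT) (fst : (P * restr T12)%type -> P).
  by apply: Cr_clin => //; exact: clin_fst.
apply: (@Cr_ext R _ r _ _ _ (fun z : P * restr T12 => \sum_i
    (@tens L F1 F2 (B1 z.1 (e i)) (B2 z.1 (tens_coord he z.2 i)) : restr T12))) => //.
  move=> [p w] [/= Op _]; rewrite -[in RHS](tens_coordK he w).
  by rewrite tens_map_sumb //; [exact: l1|exact: l2].
apply: Cr_sum => // i.
have D1 : Cr r (O `*` setT) (fun z : P * restr T12 => B1 z.1 (e i) : restr F1).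
  apply: (Cr_comp (hausdorff_prod hP hR1) hR1
    (Cr_pair hP hR1 Cfst (Cr_cst r (e i : restr F1) hR1 oOT)) C1).
  by move=> z [].
have D2 : Cr r (O `*` setT)
    (fun z : P * restr T12 => B2 z.1 (tens_coord he z.2 i) : restr F2).
  have Cc : Cr r (O `*` setT)
      (fun z : P * restr T12 => tens_coord he z.2 i : restr F2).
    apply: Cr_clin => //.
    exact: (clin_comp (@clin_snd _ _ P (restr T12)) (tens_coord_clin i)).
  apply: (Cr_comp (hausdorff_prod hP hR2) hR2 (Cr_pair hP hR2 Cfst Cc) C2).
  by move=> z [].
exact: (Cr_comp (hausdorff_prod hR1 hR2) hT (Cr_pair hR1 hR2 D1 D2)
  (Cr_cbil r hT tens_cbil openT)).
Qed.
End tensor_topology.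

(** * C^r-maps between manifolds *)

Section manifold.
Variables (R : realType) (k : Defs.scalar) (r : smoothness).
Local Notation atlas := (atlas R k).

Lemma Cr_preimage (X H : tvsType (Fld R k)) (U : set X) (V : set H) (f : X -> H) :
  hausdorff_space H -> Cr r U f -> open V -> open (U `&` f @^-1` V).
Proof.
move=> hH Cf oV; have oU := Cr_open Cf; rewrite openE => x [Ux Vx].
apply: filterI; first exact: open_nbhs_nbhs.
by apply: (Cr_cont hH Cf Ux); exact: open_nbhs_nbhs.
Qed.

(* A manifold whose charts need neither cover it nor separate its points. *)
Definition premanifold (T : Type) (A : atlas T) :=
  [/\ hausdorff_space (model A),
      forall c p, charts A c -> cdom c p -> cinv c (cfun c p) = p
    & forall c d, charts A c -> charts A d ->
        Cr r (cfun c @` (cdom c `&` cdom d)) (cfun d \o cinv c)].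

Lemma is_manifold_pre (T : Type) (A : atlas T) : is_manifold r A -> premanifold A.
Proof. by case. Qed.

Definition covered (T : Type) (A : atlas T) (p : T) :=
  exists2 c, charts A c & cdom c p.

(* f is C^r near p, as seen in some pair of charts and then, by Crat_charts, in all. *)
Definition Crat (T T' : Type) (A : atlas T) (B : atlas T') (f : T -> T') (p : T) :=
  exists (c : chart T (model A)) (d : chart T' (model B)) (W : set (model A)),
    [/\ charts A c, charts B d, cdom c p & cdom d (f p)] /\
    [/\ W (cfun c p), W `<=` cfun c @` (cdom c `&` f @^-1` cdom d)
      & Cr r W (cfun d \o f \o cinv c)].

Section one.
Variables (T : Type) (A : atlas T).
Hypothesis hA : premanifold A.

Lemma pre_hausdorff : hausdorff_space (model A). Proof. by case: hA. Qed.

Lemma chartK c p : charts A c -> cdom c p -> cinv c (cfun c p) = p.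
Proof. by case: hA => _ h _; exact: h. Qed.

Lemma chart_inj c p q : charts A c -> cdom c p -> cdom c q ->
  cfun c p = cfun c q -> p = q.
Proof.
by move=> hc cp cq E; rewrite -(chartK hc cp) E (chartK hc cq).
Qed.

Lemma chart_trans c d : charts A c -> charts A d ->
  Cr r (cfun c @` (cdom c `&` cdom d)) (cfun d \o cinv c).
Proof. by case: hA => _ _ h; exact: h. Qed.

Lemma chart_open c : charts A c -> open (cfun c @` cdom c).
Proof. by move=> hc; have := Cr_open (chart_trans hc hc); rewrite setIid. Qed.

Lemma atlas_open_chart c (S : set (model A)) : charts A c -> open S ->
  atlas_open A (cdom c `&` cfun c @^-1` S).
Proof.
move=> hc oS d hd.
suff -> : cfun d @` (cdom d `&` (cdom c `&` cfun c @^-1` S)) =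
    (cfun d @` (cdom d `&` cdom c)) `&` (cfun c \o cinv d) @^-1` S.
  exact: Cr_preimage pre_hausdorff (chart_trans hd hc) oS.
apply/seteqP; split=> [_ [p [dp [cp Sp]] <-]|_ [[p [dp cp] <-]]] /=.
  by split; [exists p|rewrite chartK].
by rewrite chartK // => Sp; exists p.
Qed.

Lemma atlas_openI (O O' : set T) : atlas_open A O -> atlas_open A O' ->
  atlas_open A (O `&` O').
Proof.
move=> oO oO' c hc.
suff -> : cfun c @` (cdom c `&` (O `&` O')) =
   (cfun c @` (cdom c `&` O)) `&` (cfun c @` (cdom c `&` O')).
  by apply: openI; [exact: oO|exact: oO'].
apply/seteqP; split=> [_ [p [cp [Op Op']] <-]|_ [[p [cp Op] <-] [q [cq Oq]]]].
  by split; exists p.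
by move=> /(chart_inj hc cq cp) qp; subst q; exists p.
Qed.

Lemma atlas_openT : atlas_open A setT.
Proof. by move=> c hc; rewrite setIT; exact: chart_open. Qed.

Lemma atlas_open_local (O : set T) :
  (forall p, O p -> exists W, [/\ atlas_open A W, W p & W `<=` O]) -> atlas_open A O.
Proof.
move=> h c hc; rewrite openE => _ [p [cp Op] <-].
have [W [oW Wp WO]] := h p Op.
have : nbhs (cfun c p) (cfun c @` (cdom c `&` W)).
  by apply: open_nbhs_nbhs; split; [exact: oW|exists p].
apply: filterS => _ [q [cq Wq] <-]; exists q => //; split => //; exact: WO.
Qed.
End one.

Section two.
Variables (T T' : Type) (A : atlas T) (B : atlas T').
Hypotheses (hA : premanifold A) (hB : premanifold B).
Implicit Types (f g : T -> T').

Let hHA := pre_hausdorff hA.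
Let hHB := pre_hausdorff hB.

(** The known representation is composed with transition maps on both sides; the new W consists of
    the images of points whose relevant values lie in all four chart domains. *)
Lemma Crat_charts f p c d : Crat A B f p ->
  charts A c -> charts B d -> cdom c p -> cdom d (f p) ->
  exists W, [/\ W (cfun c p), W `<=` cfun c @` (cdom c `&` f @^-1` cdom d)
    & Cr r W (cfun d \o f \o cinv c)].
Proof.
move=> [c0 [d0 [W [[hc0 hd0 c0p d0p] [Wp WI CW]]]]] hc hd cp dp.
have Ct := chart_trans hA hc hc0.
have Cd := chart_trans hB hd0 hd.
have oW1 := Cr_preimage hHB CW (Cr_open Cd).
have oW2 := Cr_preimage hHA Ct oW1.
have WE x : (cfun c @` (cdom c `&` cdom c0) `&` (cfun c0 \o cinv c) @^-1`
    (W `&` (cfun d0 \o f \o cinv c0) @^-1` (cfun d0 @` (cdom d0 `&` cdom d)))) x ->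
    exists2 q, [/\ cdom c q, cdom c0 q, cdom d0 (f q) & cdom d (f q)] &
      W (cfun c0 q) /\ x = cfun c q.
  move=> [[q [cq c0q] <-]] /=; rewrite (chartK hA hc cq) => -[Wq [y [d0y dy]]].
  have [q' [c0q' d0q'] E] := WI _ Wq; have qq := chart_inj hA hc0 c0q' c0q E.
  rewrite (chartK hA hc0 c0q); move: d0q'; rewrite /= qq => d0q.
  by move=> /(chart_inj hB hd0 d0y d0q) yq; exists q => //; rewrite -yq.
exists (cfun c @` (cdom c `&` cdom c0) `&` (cfun c0 \o cinv c) @^-1`
    (W `&` (cfun d0 \o f \o cinv c0) @^-1` (cfun d0 @` (cdom d0 `&` cdom d)))).
split.
- split; first by exists p.
  rewrite /= (chartK hA hc cp) (chartK hA hc0 c0p); split => //.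
  by exists (f p).
- by move=> x /WE[q [cq _ _ dq] [_ ->]]; exists q.
apply: (@Cr_ext _ _ r _ _ _
  ((cfun d \o cinv d0) \o ((cfun d0 \o f \o cinv c0) \o (cfun c0 \o cinv c)))) => //.
  move=> _ /WE[q [cq c0q d0q dq] [_ ->]] /=.
  by rewrite (chartK hA hc cq) (chartK hA hc0 c0q) (chartK hB hd0 d0q).
apply: (Cr_comp hHB hHB _ Cd).
  apply: (Cr_comp hHA hHB _ CW).
    by apply: (Cr_sub hHA oW2 _ Ct) => x [].
  by move=> x [_ []].
by move=> x [_ []].
Qed.

Lemma Crat_Crmap (O : set T) f : atlas_open A O ->
  (forall p, O p -> covered A p -> covered B (f p) -> Crat A B f p) ->
  Crmap r A B O f.
Proof.
move=> oO h c d hc hd; apply: Cr_local => // _ [p [[cp Op] /= dp] <-].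
have [||W [Wp WI CW]] := Crat_charts (h p Op _ _) hc hd cp dp.
- by exists c.
- by exists d.
exists (W `&` cfun c @` (cdom c `&` O)); split.
- by split => //; exists p.
- move=> x [Wx [q [cq Oq] E]]; move: Wx; rewrite -E => /WI[q' [cq' dq']].
  by move=> /(chart_inj hA hc cq' cq) qq; move: dq'; rewrite /= qq => dq; exists q.
by apply: (Cr_sub hHB _ _ CW) => [|x []//]; apply: openI; [exact: Cr_open CW|exact: oO].
Qed.

Lemma Crmap_Crat (O : set T) f p : Crmap r A B O f -> O p ->
  covered A p -> covered B (f p) -> Crat A B f p.
Proof.
move=> h Op [c hc cp] [d hd dp].
exists c, d, (cfun c @` (cdom c `&` O `&` f @^-1` cdom d)); split => //.
split; [by exists p| |exact: h].
by move=> _ [q [[cq _] dq] <-]; exists q.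
Qed.

Lemma Crat_ext (O : set T) f g p : atlas_open A O -> O p ->
  (forall q, O q -> f q = g q) -> Crat A B f p -> Crat A B g p.
Proof.
move=> oO Op fg [c [d [W [[hc hd cp dp] [Wp WI CW]]]]].
have WE x : (W `&` cfun c @` (cdom c `&` O)) x ->
    exists2 q, [/\ cdom c q, O q & cdom d (f q)] & x = cfun c q.
  move=> [Wx [q [cq Oq] E]]; move: Wx; rewrite -E => /WI[q' [cq' dq']].
  move=> /(chart_inj hA hc cq' cq) qq; move: dq'; rewrite /= qq => dq.
  by exists q.
exists c, d, (W `&` cfun c @` (cdom c `&` O)); split; first by rewrite -fg.
split; first by split => //; exists p.
  by move=> x /WE[q [cq Oq dq] ->]; exists q => //; split => //=; rewrite -fg.
apply: (@Cr_ext _ _ r _ _ _ (cfun d \o f \o cinv c)) => //.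
  by move=> _ /WE[q [cq Oq dq] ->] /=; rewrite (chartK hA hc cq) fg.
by apply: (Cr_sub hHB _ _ CW) => [|x []//]; apply: openI; [exact: Cr_open CW|exact: oO].
Qed.

Lemma Crat_cont (V : set T') f p : Crat A B f p -> atlas_open B V -> V (f p) ->
  exists O, [/\ atlas_open A O, O p & O `<=` f @^-1` V].
Proof.
move=> [c [d [W [[hc hd cp dp] [Wp WI CW]]]]] oV Vp.
exists (cdom c `&` cfun c @^-1`
  (W `&` (cfun d \o f \o cinv c) @^-1` (cfun d @` (cdom d `&` V)))); split.
- by apply: atlas_open_chart => //; apply: Cr_preimage hHB CW _; exact: oV.
- by split => //; split => //=; rewrite (chartK hA hc cp); exists (f p).
move=> q [cq [/WI[q' [cq' dq'] E]]] /=.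
have qq := chart_inj hA hc cq' cq E; move: dq'; rewrite /= qq => dq.
by rewrite (chartK hA hc cq) => -[y [dy Vy]] /(chart_inj hB hd dy dq) <-.
Qed.

Lemma Crat_covered f p : Crat A B f p -> covered A p /\ covered B (f p).
Proof. by move=> [c [d [W [[hc hd cp dp] _]]]]; split; [exists c|exists d]. Qed.

Lemma Crat_open (U : set T) (V : set T') f : (forall p, U p -> Crat A B f p) ->
  atlas_open A U -> atlas_open B V -> atlas_open A (U `&` f @^-1` V).
Proof.
move=> h oU oV; apply: atlas_open_local => p [Up Vp].
have [O [oO Op OV]] := Crat_cont (h p Up) oV Vp.
by exists (U `&` O); split => [||q [Uq /OV]]//; exact: atlas_openI.
Qed.
End two.

Lemma Crat_comp (T1 T2 T3 : Type) (A : atlas T1) (B : atlas T2) (C : atlas T3)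
    (f : T1 -> T2) (g : T2 -> T3) p :
  premanifold A -> premanifold B -> premanifold C ->
  Crat A B f p -> Crat B C g (f p) -> Crat A C (g \o f) p.
Proof.
move=> hA hB hC [c [d [W [[hc hd cp dp] [Wp WI CW]]]]] Cg.
have [_ [e he ep]] := Crat_covered Cg.
have [W' [Wp' WI' CW']] := Crat_charts hB hC Cg hd he dp ep.
have hHB := pre_hausdorff hB; have hHC := pre_hausdorff hC.
have WE x : (W `&` (cfun d \o f \o cinv c) @^-1` W') x ->
    exists2 q, [/\ cdom c q, cdom d (f q) & cdom e (g (f q))] & x = cfun c q.
  move=> [/WI[q [cq dq] <-]] /=; rewrite (chartK hA hc cq) => /WI'[y [dy ey]].
  by move=> /(chart_inj hB hd dy dq) yq; exists q => //; split; rewrite // -yq.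
exists c, e, (W `&` (cfun d \o f \o cinv c) @^-1` W'); split => //; split.
- by split => //=; rewrite (chartK hA hc cp).
- by move=> _ /WE[q [cq dq eq] ->]; exists q.
apply: (@Cr_ext _ _ r _ _ _ ((cfun e \o g \o cinv d) \o (cfun d \o f \o cinv c))) => //.
  move=> _ /WE[q [cq dq eq] ->] /=.
  by rewrite (chartK hA hc cq) (chartK hB hd dq).
apply: (Cr_comp hHB hHC _ CW'); last by move=> x [].
apply: (Cr_sub hHB _ _ CW) => [|x []//].
exact: Cr_preimage hHB CW (Cr_open CW').
Qed.

End manifold.

(** * Products of manifolds *)

Section products.
Variables (R : realType) (k : Defs.scalar) (r : smoothness).
Local Notation atlas := (atlas R k).
Local Notation Crat := (@Crat R k r _ _).
Local Notation premanifold := (@premanifold R k r _).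

Lemma Cr_id (X : tvsType (Fld R k)) (U : set X) : hausdorff_space X -> open U ->
  Cr r U id.
Proof. by move=> hX oU; apply: Cr_clin => //; exact: clin_id. Qed.

Lemma Cr_fst (X Y : tvsType (Fld R k)) (U : set (X * Y)) : hausdorff_space X ->
  open U -> Cr r U fst.
Proof. by move=> hX oU; apply: Cr_clin => //; exact: clin_fst. Qed.

Lemma Cr_snd (X Y : tvsType (Fld R k)) (U : set (X * Y)) : hausdorff_space Y ->
  open U -> Cr r U snd.
Proof. by move=> hX oU; apply: Cr_clin => //; exact: clin_snd. Qed.

Lemma lcs_pre (X : tvsType (Fld R k)) : hausdorff_space X -> premanifold (lcs_atlas X).
Proof.
move=> hX; split => // [c p -> //|c d -> ->] /=.
rewrite setIT image_id; apply: (Cr_ext (f := id)) => //; exact: Cr_id openT.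
Qed.

Lemma lcs_covered (X : tvsType (Fld R k)) (x : X) : covered (lcs_atlas X) x.
Proof. by exists (Chart setT id id). Qed.

Lemma prod_chart_image (T T' X X' : Type) (c : chart T X) (c' : chart T' X')
    (O : set T) (O' : set T') :
  cfun (prod_chart c c') @` (cdom (prod_chart c c') `&` (O `*` O')) =
  (cfun c @` (cdom c `&` O)) `*` (cfun c' @` (cdom c' `&` O')).
Proof.
apply/seteqP; split=> [_ [[p q] [[/= cp cq] [/= dp dq]] <-]|].
  by split; [exists p|exists q].
move=> [_ _] [/= [p [cp dp] <-] [q [cq dq] <-]] /=.
by exists (p, q).
Qed.

Section pair.
Variables (T T' : Type) (A : atlas T) (B : atlas T').
Hypotheses (hA : premanifold A) (hB : premanifold B).
Let hHA := pre_hausdorff hA.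
Let hHB := pre_hausdorff hB.

Lemma prod_pre : premanifold (prod_atlas A B).
Proof.
split=> [|_ [p q] [c [d [hc hd ->]]] [cp dq]|].
- exact: hausdorff_prod.
- by rewrite /= (chartK hA hc cp) (chartK hB hd dq).
move=> _ _ [c [c' [hc hc' ->]]] [d [d' [hd hd' ->]]].
rewrite prod_chart_image; have Ct := chart_trans hA hc hd.
have Ct' := chart_trans hB hc' hd'.
have oI := open_X (Cr_open Ct) (Cr_open Ct').
apply: (Cr_pair hHA hHB).
  by apply: (Cr_comp hHA hHA (Cr_fst hHA oI) Ct) => z [].
by apply: (Cr_comp hHB hHB (Cr_snd hHB oI) Ct') => z [].
Qed.

Lemma prod_covered p q : covered A p -> covered B q -> covered (prod_atlas A B) (p, q).
Proof. by move=> [c hc cp] [d hd dq]; exists (prod_chart c d) => //; exists c, d. Qed.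

Lemma Crat_fst z : covered A z.1 -> covered B z.2 -> Crat (prod_atlas A B) A fst z.
Proof.
move: z => [p q] [c hc cp] [d hd dq].
exists (prod_chart c d), c, (cfun (prod_chart c d) @` cdom (prod_chart c d)).
split; first by split => //; exists c, d.
split; first by exists (p, q).
  by move=> _ [[p' q'] [/= cp' dq'] <-]; exists (p', q').
have hP : charts (prod_atlas A B) (prod_chart c d) by exists c, d.
have := chart_open prod_pre hP => oP.
apply: (Cr_ext hHA _ (Cr_fst hHA oP)) => _ [[p' q'] [/= cp' dq'] <-] /=.
by rewrite (chartK hA hc cp').
Qed.

Lemma Crat_snd z : covered A z.1 -> covered B z.2 -> Crat (prod_atlas A B) B snd z.
Proof.
move: z => [p q] [c hc cp] [d hd dq].
exists (prod_chart c d), d, (cfun (prod_chart c d) @` cdom (prod_chart c d)).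
split; first by split => //; exists c, d.
split; first by exists (p, q).
  by move=> _ [[p' q'] [/= cp' dq'] <-]; exists (p', q').
have hP : charts (prod_atlas A B) (prod_chart c d) by exists c, d.
have := chart_open prod_pre hP => oP.
apply: (Cr_ext hHB _ (Cr_snd hHB oP)) => _ [[p' q'] [/= cp' dq'] <-] /=.
by rewrite (chartK hB hd dq').
Qed.

End pair.

Lemma Crat_pair (T1 T2 T3 : Type) (A : atlas T1) (B : atlas T2) (C : atlas T3)
    (f : T1 -> T2) (g : T1 -> T3) p :
  premanifold A -> premanifold B -> premanifold C ->
  Crat A B f p -> Crat A C g p -> Crat A (prod_atlas B C) (fun q => (f q, g q)) p.
Proof.
move=> hA hB hC [c [d [W [[hc hd cp dp] [Wp WI CW]]]]] Cg.
have [_ [e he ep]] := Crat_covered Cg.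
have [W' [Wp' WI' CW']] := Crat_charts hA hC Cg hc he cp ep.
have hHB := pre_hausdorff hB; have hHC := pre_hausdorff hC.
have oI := openI (Cr_open CW) (Cr_open CW').
exists c, (prod_chart d e), (W `&` W'); split; first by split => //; exists d, e.
split=> //.
  move=> _ [/WI[q [cq dq] <-] /WI'[q' [cq' eq']]].
  by move=> /(chart_inj hA hc cq' cq) qq; subst q'; exists q.
by apply: (Cr_pair hHB hHC); [apply: (Cr_sub hHB oI _ CW)|apply: (Cr_sub hHC oI _ CW')] => x [].
Qed.

Lemma atlas_open_X (T T' : Type) (A : atlas T) (B : atlas T') (O : set T) (O' : set T') :
  atlas_open A O -> atlas_open B O' -> atlas_open (prod_atlas A B) (O `*` O').
Proof.
move=> oO oO' _ [c [d [hc hd ->]]].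
by rewrite prod_chart_image; apply: open_X; [exact: oO|exact: oO'].
Qed.

Lemma atlas_open_lcs (X : tvsType (Fld R k)) (O : set X) : open O ->
  atlas_open (lcs_atlas X) O.
Proof. by move=> oO c -> /=; rewrite image_id setTI. Qed.
End products.

Section tensor.
Variables (R : realType) (c : scalars) (r : smoothness).
Local Notation L := (Fld R (fibK c)).
Variables (F1 F2 : tvsType L) (n : nat) (e : 'I_n -> F1) (he : is_basis e).
Hypotheses (hF1 : hausdorff_space F1) (hF2 : hausdorff_space F2).
Local Notation T12 := (tensorT he F2).
Variables (T : Type) (N : atlas R (baseK c) T) (hN : premanifold r N).

(** Moves the parameter from the manifold to its model space, where [tens_map_Cr] applies. *)
Lemma Crat_Cr (F : tvsType L) (O : set T) (B : T -> F -> F) a :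
  hausdorff_space F -> atlas_open N O -> charts N a ->
  (forall p w, O p -> covered N p ->
    Crat r (prod_atlas N (lcs_atlas (restr F))) (lcs_atlas (restr F))
      (fun z => B z.1 z.2) (p, w)) ->
  Cr r ((cfun a @` (cdom a `&` O)) `*` setT)
    ((fun z => B (cinv a z.1) z.2) : (model N * restr F)%type -> restr F).
Proof.
move=> hF oO ha h; have hL := lcs_pre r (hF : hausdorff_space (restr F)).
have hP := prod_pre hN hL.
apply: Cr_local => // -[_ w] [/= [p [ap Op] <-] _].
have cp : covered N p by exists a.
have hpa : charts (prod_atlas N (lcs_atlas (restr F)))
   (prod_chart a (Chart setT id id)) by exists a, (Chart setT id id).
have [//|//|W [Wp WI CW]] := Crat_charts hP hL (h p w Op cp) hpa (erefl : charts (lcs_atlas (restr F)) (Chart setT id id)).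
exists (W `&` ((cfun a @` (cdom a `&` O)) `*` setT)); split.
- by split => //; split => //; exists p.
- by move=> z [].
apply: (Cr_sub _ _ _ CW) => //.
by apply: openI; [exact: Cr_open CW|apply: open_XT; exact: oO].
Qed.

Lemma Crat_tens_map (O : set T) (B1 : T -> F1 -> F1) (B2 : T -> F2 -> F2) p w :
  atlas_open N O ->
  (forall p, O p -> linear (B1 p)) -> (forall p, O p -> linear (B2 p)) ->
  (forall p w, O p -> covered N p ->
    Crat r (prod_atlas N (lcs_atlas (restr F1))) (lcs_atlas (restr F1))
      (fun z => B1 z.1 z.2) (p, w)) ->
  (forall p w, O p -> covered N p ->
    Crat r (prod_atlas N (lcs_atlas (restr F2))) (lcs_atlas (restr F2))
      (fun z => B2 z.1 z.2) (p, w)) ->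
  O p -> covered N p ->
  Crat r (prod_atlas N (lcs_atlas (restr T12))) (lcs_atlas (restr T12))
      (fun z => tens_map (B1 z.1) (B2 z.1) z.2) (p, w).
Proof.
move=> oO l1 l2 C1 C2 Op [a ha ap].
exists (prod_chart a (Chart setT id id)), (Chart setT id id),
  ((cfun a @` (cdom a `&` O)) `*` setT).
split; first by split => //; exists a, (Chart setT id id).
split; first by split => //; exists p.
  by move=> [_ v] [/= [q [aq Oq] <-] _]; exists (q, v).
have li (F : tvsType L) (B : T -> F -> F) : (forall p, O p -> linear (B p)) ->
    forall x, (cfun a @` (cdom a `&` O)) x -> linear (B (cinv a x)).
  by move=> lB _ [q [aq Oq] <-]; rewrite (chartK hN ha aq); exact: lB.
exact: (tens_map_Cr he hF1 hF2 (oO _ ha) (pre_hausdorff hN) (li _ _ l1) (li _ _ l2)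
  (Crat_Cr hF1 oO ha C1) (Crat_Cr hF2 oO ha C2)).
Qed.
End tensor.

(** * The tensor product bundle *)

Section linear_inverse.
Variables (L : numFieldType) (V W : lmodType L) (f : V -> W) (g : W -> V).

Lemma can_linear : linear f -> cancel f g -> cancel g f -> linear g.
Proof. by move=> fl fK gK a x y; apply: (can_inj fK); rewrite fl !gK. Qed.
End linear_inverse.

(** Equality of second components is obtained through decidable equality of the index type, supplied
    by [{classic M}]. *)
Lemma Tagged_inj (M : Type) (E : M -> Type) x : injective (@Tagged M x E).
Proof. by move=> u v; exact: (@existT_inj2 {classic M} E). Qed.

Section bundle.
Variables (R : realType) (c : scalars) (r : smoothness).
Local Notation L := (Fld R (fibK c)).
Variables (M : Type) (aM : atlas R (baseK c) M).
Variables (F : tvsType L) (E : M -> lmodType L).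
Variable aE : atlas R (baseK c) (total_space E).
Local Notation aF := (lcs_atlas (restr F)).

Lemma is_manifold_covered (T : Type) (A : atlas R (baseK c) T) p :
  is_manifold r A -> covered A p.
Proof. by case=> _ + _ _ _; exact. Qed.

Definition fibre_map (psi : total_space E -> M * F) (x : M) (v : E x) : F :=
  (psi (Tagged E v)).2.

(** Chosen within the fibre: the inverse of [psi] takes values in the total space, whose base point
    equals x only up to a proof, and would need a transport to [E x]. *)
Definition fibre_inv (psi : total_space E -> M * F) (x : M) (w : F) : E x :=
  xget 0 [set v | fibre_map psi v = w].

Hypotheses (hM : is_manifold r aM) (hE : is_manifold r aE) (hF : hausdorff_space F).

Let hL : premanifold r aF := lcs_pre r (hF : hausdorff_space (restr F)).
Let hP : premanifold r (prod_atlas aM aF) := prod_pre (is_manifold_pre hM) hL.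

Lemma bundle_covered z : covered (prod_atlas aM aF) z.
Proof.
by case: z => x w; apply: prod_covered; [exact: is_manifold_covered hM|exact: lcs_covered].
Qed.

Section triv.
Variables (U : set M) (psi : total_space E -> M * F).
Hypothesis hpsi : local_triv r aM aE U psi.

Lemma triv_open : atlas_open aM U. Proof. by case: hpsi. Qed.

Lemma fibre_map_linear x : U x -> linear (@fibre_map psi x).
Proof. by case: hpsi => _ _ _ + Ux; exact. Qed.

Lemma trivE x (v : E x) : U x -> psi (Tagged E v) = (x, fibre_map psi v).
Proof.
move=> Ux; have [_ _ /(_ x Ux) h _] := hpsi.
have : (psi @` (@tag M E @^-1` [set x])) (psi (Tagged E v)) by exists (Tagged E v).
by rewrite h /fibre_map; case: (psi _) => y w /= [/= -> _].
Qed.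

Lemma fibre_mapK x : U x -> cancel (@fibre_map psi x) (@fibre_inv psi x).
Proof.
move=> Ux v; rewrite /fibre_inv; case: xgetP => [u _ /= E1|/(_ v)]; last by move=> h; case: (h erefl).
have [_ [g [gK _ _ _]] _ _] := hpsi.
have : Tagged E u = Tagged E v.
  have [_ <-] := gK (Tagged E u) Ux; have [_ <-] := gK (Tagged E v) Ux.
  by rewrite !trivE // E1.
exact: Tagged_inj.
Qed.

Lemma fibre_invK x : U x -> cancel (@fibre_inv psi x) (@fibre_map psi x).
Proof.
move=> Ux w; rewrite /fibre_inv; case: xgetP => [u _ //|h].
have [_ _ /(_ x Ux) hU _] := hpsi.
have : ([set x] `*` setT) (x, w) by [].
rewrite -hU => -[[y v] /= yx E1]; subst y; case: (h v).
by rewrite /= /fibre_map E1.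
Qed.

Lemma fibre_inv_linear x : U x -> linear (@fibre_inv psi x).
Proof.
move=> Ux; apply: (can_linear (fibre_map_linear Ux)); first exact: fibre_mapK.
exact: fibre_invK.
Qed.

Lemma Crat_triv v : U (tag v) -> Crat r aE (prod_atlas aM aF) psi v.
Proof.
move=> Uv; have [_ [g [_ _ h _]] _ _] := hpsi.
apply: (Crmap_Crat h) => //; first exact: is_manifold_covered hE.
exact: bundle_covered.
Qed.

Lemma Crat_triv_inv x w : U x -> Crat r (prod_atlas aM aF) aE
  (fun z => Tagged E (fibre_inv psi z.1 z.2)) (x, w).
Proof.
move=> Ux; have [_ [g [gK1 gK2 _ h]] _ _] := hpsi.
apply: (@Crat_ext _ _ _ _ _ _ _ hP (is_manifold_pre hE) (U `*` setT) g).
- by apply: atlas_open_X; [exact: triv_open|exact: atlas_openT hL].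
- by [].
- move=> [y v] [Uy _]; have [Uy' _] := gK2 (y, v) (conj Uy I).
  have [_ <-] := gK1 (Tagged E (fibre_inv psi y v)) Uy.
  by rewrite trivE // fibre_invK.
apply: (Crmap_Crat h) => //; first exact: bundle_covered.
exact: is_manifold_covered hE.
Qed.

End triv.

Lemma Crmap_sub (T T' : Type) (A : atlas R (baseK c) T) (B : atlas R (baseK c) T')
    (O W : set T) (f : T -> T') : premanifold r A -> premanifold r B ->
  Crmap r A B O f -> atlas_open A W -> W `<=` O -> Crmap r A B W f.
Proof.
move=> hA hB h oW WO; apply: Crat_Crmap => // p Wp cp cfp.
by apply: (Crmap_Crat h) => //; exact: WO.
Qed.

Lemma local_triv_sub (U W : set M) (psi : total_space E -> M * F) : Crmap r aE aM setT (@tag M E) ->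
  local_triv r aM aE U psi -> atlas_open aM W -> W `<=` U ->
  local_triv r aM aE W psi.
Proof.
move=> ht hpsi oW WU; have [oU [g [gK1 gK2 Cpsi Cg]] him hlin] := hpsi.
split=> //; [|by move=> y /WU; exact: him|by move=> y /WU; exact: hlin].
exists g; split.
- move=> [x v] Wx; have [_ gK] := gK1 _ (WU _ Wx : (@tag M E @^-1` U) (Tagged E v)).
  by split=> //; rewrite (trivE hpsi v (WU _ Wx)).
- move=> [y w] [Wy _]; have [Uy gK] := gK2 (y, w) (conj (WU _ Wy) I).
  by split=> //; move: gK; case: (g _) Uy => z v Uz; rewrite (trivE hpsi v Uz) => /(congr1 fst) /= ->.
- apply: (Crmap_sub (is_manifold_pre hE) hP Cpsi) => [|v]; last exact: WU.
  rewrite -[X in atlas_open _ X]setTI; apply: (Crat_open (is_manifold_pre hE) (is_manifold_pre hM)) => //.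
    move=> v _; apply: (Crmap_Crat ht) => //; exact: is_manifold_covered.
  exact: atlas_openT (is_manifold_pre hE).
- apply: (Crmap_sub hP (is_manifold_pre hE) Cg) => [|z []].
    by apply: atlas_open_X => //; exact: atlas_openT hL.
  by move=> /WU.
Qed.
End bundle.

Section tens_map_comp.
Variables (L : fieldType) (V V' V'' W W' W'' : lmodType L).

Lemma tens_map_id (x : tensor V W) : tens_map id id x = x.
Proof.
apply: (@tens_ext _ _ _ _ (tens_map id id) id) => // [|v w]; last exact: tens_mapE.
exact: tens_map_linear.
Qed.

Lemma tens_map_comp (f : V -> V') (g : W -> W') (f' : V' -> V'') (g' : W' -> W'') x :
  linear f -> linear g -> linear f' -> linear g' ->
  tens_map f' g' (tens_map f g x) = tens_map (f' \o f) (g' \o g) x.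
Proof.
move=> fl gl fl' gl'.
have fl2 : linear (f' \o f) by move=> a u v; rewrite /= fl fl'.
have gl2 : linear (g' \o g) by move=> a u v; rewrite /= gl gl'.
move: x; apply: tens_ext => [a x y||v w]; last by rewrite !tens_mapE.
  by rewrite (tens_map_linear fl gl) (tens_map_linear fl' gl').
exact: tens_map_linear.
Qed.

Lemma tens_mapK (f : V -> V') (g : W -> W') (f' : V' -> V) (g' : W' -> W) :
  linear f -> linear g -> linear f' -> linear g' -> cancel f f' -> cancel g g' ->
  cancel (tens_map f g) (tens_map f' g').
Proof.
move=> fl gl fl' gl' fK gK x; rewrite /tens_map.
have fl2 : linear (f' \o f) by move=> a u v; rewrite /= fl fl'.
have gl2 : linear (g' \o g) by move=> a u v; rewrite /= gl gl'.
move: x; apply: (@tens_ext _ _ _ _ (fun x => tens_map f' g' (tens_map f g x)) id) => //.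
  by move=> a x y; rewrite (tens_map_linear fl gl) (tens_map_linear fl' gl').
by move=> v w; rewrite !tens_mapE // fK gK.
Qed.
End tens_map_comp.

(** * Atlas, trivializations and uniqueness *)

Section tensor_bundle.
Variables (R : realType) (c : scalars) (r : smoothness).
Local Notation L := (Fld R (fibK c)).
Variables (M : Type) (aM : atlas R (baseK c) M).
Variables (F1 F2 : tvsType L) (E1 E2 : M -> lmodType L).
Variables (aE1 : atlas R (baseK c) (total_space E1)).
Variables (aE2 : atlas R (baseK c) (total_space E2)).
Hypothesis hM : is_manifold r aM.
Hypotheses (hE1 : vector_bundle r aM F1 aE1) (hE2 : vector_bundle r aM F2 aE2).
Variables (n : nat) (e : 'I_n -> F1) (he : is_basis e).

Local Notation aF F := (lcs_atlas (restr F)).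
Local Notation T12 := (tensorT he F2).
Local Notation E12 := (tens_fibre E1 E2).
Local Notation triv1 U psi := (local_triv r aM aE1 U (psi : _ -> M * F1)).
Local Notation triv2 U psi := (local_triv r aM aE2 U (psi : _ -> M * F2)).

Let hF1 : hausdorff_space F1. Proof. by case: hE1. Qed.
Let hF2 : hausdorff_space F2. Proof. by case: hE2. Qed.
Let mE1 : is_manifold r aE1. Proof. by case: hE1. Qed.
Let mE2 : is_manifold r aE2. Proof. by case: hE2. Qed.
Let pM := is_manifold_pre hM.
Let p1 := is_manifold_pre mE1.
Let p2 := is_manifold_pre mE2.

Lemma tensor_hausdorff : hausdorff_space T12. Proof. exact: tensorT_hausdorff. Qed.
Let hT := tensor_hausdorff.
Let pF1 : premanifold r (aF F1) := lcs_pre r (hF1 : hausdorff_space (restr F1)).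
Let pF2 : premanifold r (aF F2) := lcs_pre r (hF2 : hausdorff_space (restr F2)).
Let pT : premanifold r (aF T12) := lcs_pre r (hT : hausdorff_space (restr T12)).
Let pMT := prod_pre pM pT.

Definition tens_inv (psi1 : total_space E1 -> M * F1) (psi2 : total_space E2 -> M * F2)
    (z : M * T12) : total_space E12 :=
  @Tagged M z.1 E12 (tens_map (@fibre_inv _ _ _ _ _ psi1 z.1) (@fibre_inv _ _ _ _ _ psi2 z.1) z.2).

Section pair_of_trivs.
Variables (U : set M) (psi1 : total_space E1 -> M * F1) (psi2 : total_space E2 -> M * F2).
Hypotheses (h1 : triv1 U psi1) (h2 : triv2 U psi2).

Lemma tens_trivK v : U (tag v) -> tens_inv psi1 psi2 (tens_triv he psi1 psi2 v) = v.
Proof.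
case: v => x v /= Ux; rewrite /tens_inv /tens_triv /=; congr existT.
apply: (tens_mapK (fibre_map_linear h1 Ux) (fibre_map_linear h2 Ux)
  (fibre_inv_linear h1 Ux) (fibre_inv_linear h2 Ux)).
  exact: fibre_mapK h1 _ Ux.
exact: fibre_mapK h2 _ Ux.
Qed.

Lemma tens_invK z : U z.1 -> tens_triv he psi1 psi2 (tens_inv psi1 psi2 z) = z.
Proof.
case: z => x w /= Ux; rewrite /tens_inv /tens_triv /=; congr pair.
apply: (tens_mapK (fibre_inv_linear h1 Ux) (fibre_inv_linear h2 Ux)
  (fibre_map_linear h1 Ux) (fibre_map_linear h2 Ux)).
  exact: fibre_invK h1 _ Ux.
exact: fibre_invK h2 _ Ux.
Qed.
End pair_of_trivs.

(* Applied with a = b = id to changes of trivialization and with a = snd, b = alpha to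
   the action. *)
Lemma Crat_tens_fibre (T : Type) (N : atlas R (baseK c) T) (O : set T) (a b : T -> M)
    (h1 : forall t, E1 (a t) -> E1 (b t)) (h2 : forall t, E2 (a t) -> E2 (b t))
    (U U' : set M) psi1 psi2 psi1' psi2' t w :
  premanifold r N -> atlas_open N O ->
  triv1 U psi1 -> triv2 U psi2 -> triv1 U' psi1' -> triv2 U' psi2' ->
  (forall t, O t -> U (a t) /\ U' (b t)) ->
  (forall t, linear (h1 t)) -> (forall t, linear (h2 t)) ->
  (forall t w, O t -> covered N t -> Crat r (prod_atlas N (aF F1)) aE1
     (fun z => Tagged E1 (h1 z.1 (fibre_inv psi1 (a z.1) z.2))) (t, w)) ->
  (forall t w, O t -> covered N t -> Crat r (prod_atlas N (aF F2)) aE2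
     (fun z => Tagged E2 (h2 z.1 (fibre_inv psi2 (a z.1) z.2))) (t, w)) ->
  O t -> covered N t ->
  Crat r (prod_atlas N (aF T12)) (aF T12) (fun z : T * T12 =>
    (tens_triv he psi1' psi2' (Tagged E12 (tens_map (h1 z.1) (h2 z.1)
      (tagged (tens_inv psi1 psi2 (a z.1, z.2)))))).2) (t, w).
Proof.
move=> pN oO t1 t2 t1' t2' OU l1 l2 C1 C2 Ot ct.
pose B1 t w := fibre_map psi1' (h1 t (fibre_inv psi1 (a t) w)).
pose B2 t w := fibre_map psi2' (h2 t (fibre_inv psi2 (a t) w)).
apply: (@Crat_ext _ _ _ _ _ _ _ (prod_pre pN pT) pT (O `*` setT)
  (fun z : T * T12 => tens_map (B1 z.1) (B2 z.1) z.2)) => //.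
- by apply: atlas_open_X => //; exact: atlas_openT pT.
- move=> [s u] [/= /OU[Us Us'] _]; rewrite /tens_triv /tens_inv /=.
  have hi1 := fibre_inv_linear t1 Us; have hi2 := fibre_inv_linear t2 Us.
  have hm1 := fibre_map_linear t1' Us'; have hm2 := fibre_map_linear t2' Us'.
  rewrite (tens_map_comp _ hi1 hi2 (l1 s) (l2 s)) tens_map_comp //.
    by move=> x y z /=; rewrite hi1 l1.
  by move=> x y z /=; rewrite hi2 l2.
apply: (@Crat_tens_map R c r F1 F2 n e he hF1 hF2 T N pN O B1 B2 t w oO) => //.
- move=> s /OU[Us Us'] x y z; rewrite /B1 (fibre_inv_linear t1 Us) l1.
  by rewrite (fibre_map_linear t1' Us').
- move=> s /OU[Us Us'] x y z; rewrite /B2 (fibre_inv_linear t2 Us) l2.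
  by rewrite (fibre_map_linear t2' Us').
- move=> s u Os cs; have [Us Us'] := OU s Os.
  apply: (Crat_comp (prod_pre pN pF1) (prod_pre pM pF1) pF1
    (Crat_comp (prod_pre pN pF1) p1 (prod_pre pM pF1) (C1 s u Os cs)
      (Crat_triv hM mE1 t1' _)) (Crat_snd pM pF1 _ _)) => //.
  + exact: is_manifold_covered hM.
  + exact: lcs_covered.
- move=> s u Os cs; have [Us Us'] := OU s Os.
  apply: (Crat_comp (prod_pre pN pF2) (prod_pre pM pF2) pF2
    (Crat_comp (prod_pre pN pF2) p2 (prod_pre pM pF2) (C2 s u Os cs)
      (Crat_triv hM mE2 t2' _)) (Crat_snd pM pF2 _ _)) => //.
  + exact: is_manifold_covered hM.
  + exact: lcs_covered.
Qed.


Section one_triv.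
Variables (U : set M) (psi1 : total_space E1 -> M * F1) (psi2 : total_space E2 -> M * F2).
Hypotheses (h1 : triv1 U psi1) (h2 : triv2 U psi2).
Variables (U' : set M) (psi1' : total_space E1 -> M * F1) (psi2' : total_space E2 -> M * F2).
Hypotheses (h1' : triv1 U' psi1') (h2' : triv2 U' psi2').

Lemma Crat_tens_transition x w : U x -> U' x ->
  Crat r (prod_atlas aM (aF T12)) (prod_atlas aM (aF T12))
    (tens_triv he psi1' psi2' \o tens_inv psi1 psi2) (x, w).
Proof.
move=> Ux Ux'; have oO := atlas_openI pM (triv_open h1) (triv_open h1').
have cx : covered aM x by exact: is_manifold_covered hM.
have cw : covered (aF T12) w by exact: lcs_covered.
have Cf := @Crat_tens_fibre M aM (U `&` U') id id (fun=> id) (fun=> id) U U' psi1 psi2 psi1' psi2' x w pM oO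
  h1 h2 h1' h2' (fun t => id) (fun t a u v => erefl) (fun t a u v => erefl).
have := Crat_pair pMT pM pT (Crat_fst (z := (x, w)) pM pT cx cw) (Cf _ _ (conj Ux Ux') cx).
move=> C; apply: (@Crat_ext _ _ _ _ _ _ _ pMT pMT setT) (C _ _) => //.
- exact: atlas_openT pMT.
- by move=> [y u] _ /=; rewrite /tens_triv /tens_inv /= tens_map_id.
- by move=> t u [Ut _] _; exact: (Crat_triv_inv hM mE1 hF1 h1 u Ut).
- by move=> t u [Ut _] _; exact: (Crat_triv_inv hM mE2 hF2 h2 u Ut).
Qed.
End one_triv.

Definition tens_chart (U : set M) (psi1 : total_space E1 -> M * F1)
    (psi2 : total_space E2 -> M * F2) (cM : chart M (model aM)) :
    chart (total_space E12) (model aM * restr T12)%type :=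
  Chart (@tag M E12 @^-1` (U `&` cdom cM))
    (fun v => (cfun cM (tag v), (tens_triv he psi1 psi2 v).2))
    (fun z => tens_inv psi1 psi2 (cinv cM z.1, z.2)).

Definition tens_atlas : atlas R (baseK c) (total_space E12) :=
  @Atlas R (baseK c) _ (model aM * restr T12)%type
    [set t | exists U psi1 psi2 cM,
      [/\ triv1 U psi1, triv2 U psi2, charts aM cM & t = tens_chart U psi1 psi2 cM]].

Lemma tens_charts U psi1 psi2 cM : triv1 U psi1 -> triv2 U psi2 -> charts aM cM ->
  charts tens_atlas (tens_chart U psi1 psi2 cM).
Proof. by move=> h1 h2 hc; exists U, psi1, psi2, cM. Qed.

Lemma common_triv x : exists U psi1 psi2, [/\ U x, triv1 U psi1 & triv2 U psi2].
Proof.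
have [_ _ _ t1 /(_ x)[U1 [psi1 [U1x h1]]]] := hE1.
have [_ _ _ t2 /(_ x)[U2 [psi2 [U2x h2]]]] := hE2.
have oU := atlas_openI pM (triv_open h1) (triv_open h2).
exists (U1 `&` U2), psi1, psi2; split => //.
  by apply: (local_triv_sub hM mE1 hF1 t1 h1 oU) => y [].
by apply: (local_triv_sub hM mE2 hF2 t2 h2 oU) => y [].
Qed.

Lemma tens_covered v : covered tens_atlas v.
Proof.
have [U [psi1 [psi2 [Ux h1 h2]]]] := common_triv (tag v).
have [cM hc cx] := is_manifold_covered (tag v) hM.
by exists (tens_chart U psi1 psi2 cM) => //; exact: tens_charts.
Qed.

Lemma tens_pre : premanifold r tens_atlas.
Proof.
split; first exact: hausdorff_prod (pre_hausdorff pM) hT.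
  move=> _ v [U [psi1 [psi2 [cM [h1 h2 hc ->]]]]] [Uv cv].
  rewrite /= (chartK pM hc cv) -[RHS](tens_trivK h1 h2 Uv).
  by case: v Uv cv.
move=> _ _ [U [psi1 [psi2 [cM [h1 h2 hc ->]]]]] [U' [psi1' [psi2' [cM' [h1' h2' hc' ->]]]]].
pose eT : chart T12 (restr T12) := Chart setT id id.
have hP d : charts aM d -> charts (prod_atlas aM (aF T12)) (prod_chart d eT).
  by move=> hd; exists d, eT.
apply: Cr_local; first exact: hausdorff_prod (pre_hausdorff pM) hT.
move=> _ [[x t] [/= [Ux cx] [Ux' cx']] <-].
set w := (tens_triv he psi1 psi2 (Tagged E12 t)).2.
have C := Crat_tens_transition h1 h2 h1' h2' w Ux Ux'.
have [//|//|W [Wp WI CW]] := Crat_charts pMT pMT C (hP _ hc) (hP _ hc').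
have oO := triv_open h1 hc; have oO' := triv_open h1' hc.
exists (W `&` ((cfun cM @` (cdom cM `&` (U `&` U'))) `*` setT)); split.
- by split => //; split => //; exists x.
- move=> [y u] [/WI[[q v] [/= [cq _] [cq' _]] [<- <-]] [/= [q' [cqq [Uq Uq']] E] _]].
  have qq := chart_inj pM hc cqq cq E; subst q'.
  exists (tens_inv psi1 psi2 (q, v)); first by [].
  by congr pair; exact: (congr1 snd (tens_invK h1 h2 (z := (q, v : T12)) Uq)).
- apply: (Cr_sub _ _ _ CW) => //; first exact: hausdorff_prod (pre_hausdorff pM) hT.
  apply: openI; first exact: Cr_open CW.
  by apply: open_XT; exact: (atlas_openI pM (triv_open h1) (triv_open h1') hc).
Qed.

Let pE := tens_pre.

Section one_triv.
Variables (U : set M) (psi1 : total_space E1 -> M * F1) (psi2 : total_space E2 -> M * F2).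
Hypotheses (h1 : triv1 U psi1) (h2 : triv2 U psi2).

Let eT : chart T12 (restr T12) := Chart setT id id.

Let tens_chart_id cM : charts aM cM -> forall z,
  (cfun (tens_chart U psi1 psi2 cM) @` cdom (tens_chart U psi1 psi2 cM)) z ->
  exists x w, [/\ U x, cdom cM x & z = (cfun cM x, w)].
Proof. by move=> hc _ [[x t] [Ux cx] <-]; exists x; eexists. Qed.

(** Read in matching charts, both [tens_triv] and [tens_inv] become this transition of a chart with
    itself. *)
Let tens_chart_Cr cM : charts aM cM ->
  Cr r (cfun (tens_chart U psi1 psi2 cM) @` cdom (tens_chart U psi1 psi2 cM))
    (cfun (tens_chart U psi1 psi2 cM) \o cinv (tens_chart U psi1 psi2 cM)).
Proof.
move=> hc; have := chart_trans pE (tens_charts h1 h2 hc) (tens_charts h1 h2 hc).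
by rewrite setIid.
Qed.

Lemma Crat_tens_triv v : U (tag v) ->
  Crat r tens_atlas (prod_atlas aM (aF T12)) (tens_triv he psi1 psi2) v.
Proof.
move=> Uv; have [cM hc cv] := is_manifold_covered (tag v) hM.
exists (tens_chart U psi1 psi2 cM), (prod_chart cM eT),
  (cfun (tens_chart U psi1 psi2 cM) @` cdom (tens_chart U psi1 psi2 cM)).
split; first by split => //; [exact: tens_charts|exists cM, eT].
split; [by exists v| |exact: tens_chart_Cr].
by move=> _ [u [Uu cu] <-]; exists u.
Qed.

Lemma Crat_tens_inv x w : U x ->
  Crat r (prod_atlas aM (aF T12)) tens_atlas (tens_inv psi1 psi2) (x, w).
Proof.
move=> Ux; have [cM hc cx] := is_manifold_covered x hM.
exists (prod_chart cM eT), (tens_chart U psi1 psi2 cM),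
  (cfun (tens_chart U psi1 psi2 cM) @` cdom (tens_chart U psi1 psi2 cM)).
split; first by split => //; [exists cM, eT|exact: tens_charts].
split; [| |exact: tens_chart_Cr].
  exists (tens_inv psi1 psi2 (x, w)) => //=.
  by congr pair; exact: (congr1 snd (tens_invK h1 h2 (z := (x, w : T12)) Ux)).
by move=> _ /(tens_chart_id hc)[y [u [Uy cy ->]]]; exists (y, u).
Qed.

Lemma Crat_tag_triv v : U (tag v) -> Crat r tens_atlas aM (@tag M E12) v.
Proof.
move=> Uv; apply: (Crat_comp pE pMT pM (Crat_tens_triv Uv) (Crat_fst pM pT _ _)).
  exact: is_manifold_covered hM.
exact: lcs_covered.
Qed.
End one_triv.

Lemma Crat_tens_tag v : Crat r tens_atlas aM (@tag M E12) v.
Proof.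
have [U [psi1 [psi2 [Ux h1 h2]]]] := common_triv (tag v).
exact: Crat_tag_triv h1 h2 _ Ux.
Qed.

Lemma tens_open_tag U : atlas_open aM U -> atlas_open tens_atlas (@tag M E12 @^-1` U).
Proof.
move=> oU; rewrite -[X in atlas_open _ X]setTI.
by apply: (Crat_open pE pM _ (atlas_openT pE) oU) => v _; exact: Crat_tens_tag.
Qed.

Lemma tens_MT_covered z : covered (prod_atlas aM (aF T12)) z.
Proof. exact: (@bundle_covered R c r M aM T12 hM z). Qed.

Lemma tens_local_triv U psi1 psi2 : triv1 U psi1 -> triv2 U psi2 ->
  local_triv r aM tens_atlas U (tens_triv he psi1 psi2).
Proof.
move=> h1 h2; split; first exact: triv_open h1.
- exists (tens_inv psi1 psi2); split.
  + by move=> v Uv; split => //; exact: tens_trivK h1 h2 _ Uv.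
  + by move=> [x w] [Ux _]; split => //; exact: (tens_invK h1 h2 (z := (x, w : T12)) Ux).
  + apply: (Crat_Crmap pE pMT) => [|v Uv _ _]; last exact: (Crat_tens_triv h1 h2 Uv).
    by apply: tens_open_tag; exact: triv_open h1.
  + apply: (Crat_Crmap pMT pE) => [|[x w] [Ux _] _ _]; last exact: (Crat_tens_inv h1 h2).
    by apply: atlas_open_X; [exact: triv_open h1|exact: atlas_openT pT].
- move=> x Ux; apply/seteqP; split=> [_ [v <- <-] //|[y w] [/= -> _]].
  exists (tens_inv psi1 psi2 (x, w)) => //.
  exact: (tens_invK h1 h2 (z := (x, w : T12)) Ux).
- move=> x Ux; exact: tens_map_linear (fibre_map_linear h1 Ux) (fibre_map_linear h2 Ux).
Qed.

(** For the separation of points: different base points are separated in M, and two points of one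
    fibre by a trivialization, since the typical fibre is Hausdorff. *)
Lemma tens_manifold : is_manifold r tens_atlas.
Proof.
have [hH hK hC] := pE; split => // [v|v v' vv'].
  exact: (tens_covered).
have [xx|xx] := pselect (tag v = tag v'); last first.
  have [_ _ _ _ /(_ _ _ xx)[O [O' [oO oO' Ov Ov' OO]]]] := hM.
  exists (@tag M E12 @^-1` O), (@tag M E12 @^-1` O'); split => //; try exact: tens_open_tag.
  by rewrite -preimage_setI OO preimage_set0.
have [U [psi1 [psi2 [Ux h1 h2]]]] := common_triv (tag v).
have Ux' : U (tag v') by rewrite -xx.
pose g u := (tens_triv he psi1 psi2 u).2.
have gg : g v <> g v'.
  move=> E; apply: vv'; rewrite -(tens_trivK h1 h2 Ux) -(tens_trivK h1 h2 Ux').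
  by congr tens_inv; rewrite [LHS]surjective_pairing [RHS]surjective_pairing; congr pair.
have Cg u : U (tag u) -> Crat r tens_atlas (aF T12) g u.
  move=> Uu; apply: (Crat_comp pE pMT pT (Crat_tens_triv h1 h2 Uu) (Crat_snd pM pT _ _)).
    exact: is_manifold_covered hM.
  exact: lcs_covered.
have := hT; rewrite open_hausdorff => /(_ (g v) (g v')) [|[A B] /=]; first exact/eqP.
move=> [/set_mem Av /set_mem Bv] [oA oB /eqP AB].
exists ((@tag M E12 @^-1` U) `&` g @^-1` A), ((@tag M E12 @^-1` U) `&` g @^-1` B).
split => //.
- by apply: (Crat_open pE pT Cg); [apply: tens_open_tag; exact: triv_open h1|exact: atlas_open_lcs].
- by apply: (Crat_open pE pT Cg); [apply: tens_open_tag; exact: triv_open h1|exact: atlas_open_lcs].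
- by rewrite setIACA -preimage_setI AB preimage_set0 setI0.
Qed.

Lemma tens_vector_bundle : vector_bundle r aM T12 tens_atlas.
Proof.
split=> //; first exact: tens_manifold.
- by apply/seteqP; split => // x _; exists (Tagged E12 (0 : E12 x)).
- by apply: (Crat_Crmap pE pM (atlas_openT pE)) => v _ _ _; exact: Crat_tens_tag.
move=> x; have [U [psi1 [psi2 [Ux h1 h2]]]] := common_triv x.
by exists U, (tens_triv he psi1 psi2); split => //; exact: tens_local_triv.
Qed.

Definition compatible (aE : atlas R (baseK c) (total_space E12)) :=
  forall U psi1 psi2, triv1 U psi1 -> triv2 U psi2 ->
    local_triv r aM aE U (tens_triv he psi1 psi2).

(** Locally the identity is a tensor trivialization, smooth for [aE], followed by its inverse,
    smooth into [aE']. Used in both directions it yields uniqueness. *)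
Lemma compatible_Crmap (aE aE' : atlas R (baseK c) (total_space E12)) :
  is_manifold r aE -> Crmap r aE aM setT (@tag M E12) -> compatible aE ->
  is_manifold r aE' -> compatible aE' -> Crmap r aE aE' setT id.
Proof.
move=> mE ht cE mE' cE'; have qE := is_manifold_pre mE; have qE' := is_manifold_pre mE'.
apply: (Crat_Crmap qE qE' (atlas_openT qE)) => v _ _ _.
have [U [psi1 [psi2 [Ux h1 h2]]]] := common_triv (tag v).
have [oU _ _ _] := cE _ _ _ h1 h2.
have [_ [g [gK _ _ Cg]] _ _] := cE' _ _ _ h1 h2.
apply: (Crat_ext qE qE' (O := @tag M E12 @^-1` U) (f := g \o tens_triv he psi1 psi2)) => //.
- rewrite -[X in atlas_open _ X]setTI.
  apply: (Crat_open qE pM _ (atlas_openT qE) oU) => u _.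
  by apply: (Crmap_Crat ht) => //; [exact: is_manifold_covered mE|exact: is_manifold_covered hM].
- by move=> u /gK[].
apply: (Crat_comp qE pMT qE' (Crat_triv hM mE (cE _ _ _ h1 h2) Ux)).
by apply: (Crmap_Crat Cg) => //; [exact: tens_MT_covered|exact: is_manifold_covered mE'].
Qed.

End tensor_bundle.

Section parameter.
Variables (R : realType) (k : Defs.scalar) (r : smoothness).
Variables (G : Type) (aG : atlas R k G).

(* Smooth dependence on g in G is tested in one chart of G at a time: then the
   transition maps of G, which are of class C^s only, play no role. *)
Definition chart_atlas (a : chart G (model aG)) : atlas R k G := Atlas [set a].

Lemma chart_atlas_pre s a : is_manifold s aG -> charts aG a ->
  premanifold r (chart_atlas a).
Proof.
move=> mG ha; have pG := is_manifold_pre mG.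
split=> [|b g -> ag|_ _ -> ->]; first exact: pre_hausdorff pG.
  exact: (chartK pG ha ag).
have hH := pre_hausdorff pG; rewrite setIid; apply: (@Cr_ext R k r _ _ _ id) => //.
  by move=> _ [g ag <-] /=; rewrite (chartK pG ha ag).
exact: (Cr_id r hH (chart_open pG ha)).
Qed.

Lemma chart_atlas_open s a : is_manifold s aG -> charts aG a ->
  atlas_open (chart_atlas a) (cdom a).
Proof.
by move=> mG ha _ ->; rewrite setIid; exact: (chart_open (is_manifold_pre mG) ha).
Qed.

Lemma Crmap_chart_atlas (T T' : Type) (A : atlas R k T) (B : atlas R k T') O f :
  Crmap r (prod_atlas aG A) B O f <->
  forall a, charts aG a -> Crmap r (prod_atlas (chart_atlas a) A) B O f.
Proof.
split=> [h a ha _ d [_ [c [-> hc ->]]] hd|h _ d [a [c [ha hc ->]]] hd].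
  by apply: h => //; exists a, c.
by apply: (h a ha) => //; exists a, c.
Qed.
End parameter.

Section tagged.
Variables (L : numFieldType) (M : Type) (E1 E2 : M -> lmodType L) (V1 V2 : lmodType L).

(** The laws of an action compare elements of fibres over points such as alpha 1 x and x, which are
    equal only up to a proof; hence the detour through the total space. *)
Lemma tens_map_Tagged x y (f1 : V1 -> E1 y) (f2 : V2 -> E2 y) (g1 : V1 -> E1 x)
    (g2 : V2 -> E2 x) t : y = x ->
  (forall v, Tagged E1 (f1 v) = Tagged E1 (g1 v)) ->
  (forall v, Tagged E2 (f2 v) = Tagged E2 (g2 v)) ->
  Tagged (tens_fibre E1 E2) (tens_map f1 f2 t) =
  Tagged (tens_fibre E1 E2) (tens_map g1 g2 t).
Proof.
move=> yx; subst y => h1 h2.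
have -> : f1 = g1 by apply/funext => v; apply: Tagged_inj (h1 v).
by have -> : f2 = g2 by apply/funext => v; apply: Tagged_inj (h2 v).
Qed.
End tagged.

(** * The action on the tensor product bundle *)

Section action.
Variables (R : realType) (c : scalars) (r s : smoothness).
Local Notation L := (Fld R (fibK c)).
Variables (G : groupType) (aG : atlas R (baseK c) G) (mG : is_manifold s aG).
Variables (M : Type) (aM : atlas R (baseK c) M) (alpha : G -> M -> M).
Hypothesis hM : G_manifold r aG aM alpha.
Variables (F1 F2 : tvsType L) (E1 E2 : M -> lmodType L).
Variables (aE1 : atlas R (baseK c) (total_space E1)).
Variables (aE2 : atlas R (baseK c) (total_space E2)).
Variables (beta1 : forall g x, E1 x -> E1 (alpha g x)).
Variables (beta2 : forall g x, E2 x -> E2 (alpha g x)).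
Hypotheses (hE1 : equivariant_bundle r aM F1 aE1 aG beta1).
Hypotheses (hE2 : equivariant_bundle r aM F2 aE2 aG beta2).
Variables (n : nat) (e : 'I_n -> F1) (he : is_basis e).

Local Notation aF F := (lcs_atlas (restr F)).
Local Notation T12 := (tensorT he F2).
Local Notation E12 := (tens_fibre E1 E2).
Local Notation tinv psi1 psi2 := (@tens_inv _ _ _ _ _ _ _ _ _ he psi1 psi2).
Local Notation tatlas := (@tens_atlas _ _ r _ aM _ F2 _ _ aE1 aE2 _ _ he).

Let mM : is_manifold r aM. Proof. by case: hM. Qed.
Let b1 : vector_bundle r aM F1 aE1. Proof. by case: hE1. Qed.
Let b2 : vector_bundle r aM F2 aE2. Proof. by case: hE2. Qed.
Let pE := tens_pre mM b1 b2 he.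

(** Supplies the smoothness hypotheses of [Crat_tens_fibre] for the two given actions, the parameter
    being the pair (g, x). *)
Lemma Crat_transported (E : M -> lmodType L) (F : tvsType L)
    (aE : atlas R (baseK c) (total_space E)) (beta : forall g x, E x -> E (alpha g x))
    (U : set M) psi a g x w :
  equivariant_bundle r aM F aE aG beta -> local_triv r aM aE U psi ->
  charts aG a -> cdom a g -> U x ->
  Crat r (prod_atlas (prod_atlas (chart_atlas a) aM) (aF F)) aE
    (fun z => Tagged E (beta z.1.1 z.1.2 (fibre_inv psi z.1.2 z.2))) ((g, x), w).
Proof.
move=> [[hF mE _ _ _] _ Cbeta _] hpsi ha ag Ux.
have pA := chart_atlas_pre r mG ha; have pM := is_manifold_pre mM.
have pB := is_manifold_pre mE.
have pF : premanifold r (aF F) := lcs_pre r (hF : hausdorff_space (restr F)).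
have cg : covered (chart_atlas a) g by exists a.
have cx : covered aM x by exact: is_manifold_covered mM.
have cw : covered (aF F) w by exact: lcs_covered.
have cgx := prod_covered cg cx.
have pAM := prod_pre pA pM; have pAMF := prod_pre pAM pF.
have C0 := Crat_fst (z := ((g, x), w)) pAM pF cgx cw.
have C1 := Crat_comp pAMF pAM pA C0 (Crat_fst (z := (g, x)) pA pM cg cx).
have C2 := Crat_comp pAMF pAM pM C0 (Crat_snd (z := (g, x)) pA pM cg cx).
have C3 := Crat_pair pAMF pM pF C2 (Crat_snd (z := ((g, x), w)) pAM pF cgx cw).
have C4 := Crat_comp pAMF (prod_pre pM pF) pB C3 (Crat_triv_inv mM mE hF hpsi w Ux).
have C5 := Crat_pair pAMF pA pB C1 C4.
have /Crmap_chart_atlas /(_ a ha) Cb := Cbeta.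
apply: (Crat_comp pAMF (prod_pre pA pB) pB C5 (Crmap_Crat Cb _ _ _)) => //.
  by apply: prod_covered => //; exact: is_manifold_covered mE.
exact: is_manifold_covered mE.
Qed.

Lemma tens_action_left : is_left_action (total_action (tens_action beta1 beta2)).
Proof.
have [_ [a1 aM2] _] := hM; have [_ [p1 q1] _ l1] := hE1; have [_ [p2 q2] _ l2] := hE2.
split=> [[x t]|g h [x t]].
  rewrite -[RHS](_ : Tagged E12 (tens_map id id t) = _); last by rewrite tens_map_id.
  apply: tens_map_Tagged => [|v|v]; first exact: a1.
    exact: (p1 (Tagged E1 v)).
  exact: (p2 (Tagged E2 v)).
rewrite /total_action /= /tens_action (tens_map_comp _ (l1 h x) (l2 h x)) //.
apply: tens_map_Tagged => [|v|v]; first exact: aM2.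
  exact: (q1 g h (Tagged E1 v)).
exact: (q2 g h (Tagged E2 v)).
Qed.

(** Trivialize over U around x and over U' around alpha g x. Near (g, v) the action is then (g, v)
    -> ((g, x), w) -> (alpha g x, w'), followed by the inverse of the second trivialization; the
    middle map is smooth by [Crat_tens_fibre]. *)
Lemma Crmap_tens_action : Crmap r (prod_atlas aG tatlas) tatlas setT
  (fun p => total_action (tens_action beta1 beta2) p.1 p.2).
Proof.
apply/Crmap_chart_atlas => a ha.
have pA := chart_atlas_pre r mG ha; have pM := is_manifold_pre mM.
have pT : premanifold r (aF T12) := lcs_pre r (tensor_hausdorff b2 (he := he) : hausdorff_space (restr T12)).
have pAE := prod_pre pA pE; have pAM := prod_pre pA pM.
have pAMT := prod_pre pAM pT; have pMT := prod_pre pM pT.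
have [_ _ /Crmap_chart_atlas /(_ a ha) Calpha] := hM.
have cM x : covered aM x by exact: is_manifold_covered mM.
have cE v : covered tatlas v by exact: tens_covered.
apply: (Crat_Crmap pAE pE (atlas_openT pAE)) => -[g [x t]] _ [_ [_ [_ [-> _ ->]]] [/= ag _]] _.
have cg : covered (chart_atlas a) g by exists a.
have [U [psi1 [psi2 [Ux h1 h2]]]] := common_triv mM b1 b2 x.
have [U' [psi1' [psi2' [Ux' h1' h2']]]] := common_triv mM b1 b2 (alpha g x).
pose O := (cdom a `*` U) `&` (fun p => alpha p.1 p.2) @^-1` U'.
have oO : atlas_open (prod_atlas (chart_atlas a) aM) O.
  apply: (Crat_open pAM pM) => [[g' x'] [/= ag' _]||].
  - by apply: (Crmap_Crat Calpha) => //; apply: prod_covered => //; exists a.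
  - by apply: atlas_open_X; [exact: chart_atlas_open mG ha|exact: triv_open h1].
  - exact: triv_open h1'.
have Ogx : O (g, x) by [].
pose v : total_space E12 := Tagged E12 t.
have C1 := Crat_fst (z := (g, v)) pA pE cg (cE v).
have C2 := Crat_snd (z := (g, v)) pA pE cg (cE v).
have C3 := Crat_pair pAE pA pM C1 (Crat_comp pAE pE pM C2 (Crat_tens_tag mM b1 b2 he v)).
have [O2 [oO2 O2v O2O]] := Crat_cont pAE pAM C3 oO Ogx.
have C4 := Crat_comp pAE pE pMT C2 (Crat_tens_triv mM b1 b2 he h1 h2 (v := v) Ux).
have C5 := Crat_comp pAE pMT pT C4 (Crat_snd pM pT (cM _) (lcs_covered _)).
have C6 := Crat_pair pAE pAM pT C3 C5.
have cgx := prod_covered cg (cM x).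
pose w := (tens_triv he psi1 psi2 v).2.
have C7 := Crat_fst (z := ((g, x), w)) pAM pT cgx (lcs_covered _).
have C8 := Crat_comp pAMT pAM pM C7 (Crmap_Crat Calpha I cgx (cM _)).
have l1 p : linear (beta1 p.1 (x := p.2)) by case: hE1 => _ _ _; exact.
have l2 p : linear (beta2 p.1 (x := p.2)) by case: hE2 => _ _ _; exact.
have C9 := @Crat_tens_fibre R c r M aM F1 F2 E1 E2 aE1 aE2 mM b1 b2 n e he
  _ _ O snd (fun p => alpha p.1 p.2) (fun p => @beta1 p.1 p.2) (fun p => @beta2 p.1 p.2)
  U U' psi1 psi2 psi1' psi2' (g, x) w pAM oO h1 h2 h1' h2'.
have OU p : O p -> U p.2 /\ U' (alpha p.1 p.2) by move=> [[]].
have Q1 p w' : O p -> covered (prod_atlas (chart_atlas a) aM) p ->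
    Crat r (prod_atlas (prod_atlas (chart_atlas a) aM) (aF F1)) aE1
      (fun z => Tagged E1 (beta1 z.1.1 (fibre_inv psi1 z.1.2 z.2))) (p, w').
  move: p => [g' x'] [[ag' Ux1] _] _; exact: (Crat_transported w' hE1 h1 ha ag' Ux1).
have Q2 p w' : O p -> covered (prod_atlas (chart_atlas a) aM) p ->
    Crat r (prod_atlas (prod_atlas (chart_atlas a) aM) (aF F2)) aE2
      (fun z => Tagged E2 (beta2 z.1.1 (fibre_inv psi2 z.1.2 z.2))) (p, w').
  move: p => [g' x'] [[ag' Ux1] _] _; exact: (Crat_transported w' hE2 h2 ha ag' Ux1).
have {}C9 := C9 OU l1 l2 Q1 Q2 Ogx cgx.
have C10 := Crat_pair pAMT pM pT C8 C9.
have C11 := Crat_comp pAE pAMT pMT C6 C10.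
have C13 := Crat_comp pAE pMT pE C11 (Crat_tens_inv mM b1 b2 h1' h2' (he := he) _ Ux').
apply: (Crat_ext pAE pE oO2 O2v _ C13) => -[g' [x' t']] /O2O [[_ /= Ux1] /= Ux1'].
(* An equality within the fibre over x', which can be rewritten in the argument of the action. *)
have Et : tagged (tinv psi1 psi2 (x', (tens_triv he psi1 psi2 (Tagged E12 t')).2)) = t'.
  exact: Tagged_inj (tens_trivK he h1 h2 (v := Tagged E12 t') Ux1).
rewrite -[RHS](tens_trivK he h1' h2' (v := total_action _ g' (Tagged E12 t')) Ux1').
by rewrite -[in RHS]Et.
Qed.
End action.

Theorem proposition7p6 (R : realType) (c : scalars) (s r : smoothness)
  (hs : s = Infty \/ s = Omega) (hrs : smooth_le r s)
  (G : groupType) (aG : atlas R (baseK c) G) (hG : lie_group s aG)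
  (M : Type) (aM : atlas R (baseK c) M) (alpha : G -> M -> M)
  (hM : G_manifold r aG aM alpha)
  (F1 F2 : tvsType (Fld R (fibK c)))
  (E1 E2 : M -> lmodType (Fld R (fibK c)))
  (aE1 : atlas R (baseK c) (total_space E1)) (aE2 : atlas R (baseK c) (total_space E2))
  (beta1 : forall g x, E1 x -> E1 (alpha g x))
  (beta2 : forall g x, E2 x -> E2 (alpha g x))
  (hE1 : equivariant_bundle r aM F1 aE1 aG beta1)
  (hE2 : equivariant_bundle r aM F2 aE2 aG beta2)
  (n : nat) (e : 'I_n -> F1) (he : is_basis e) :
  let tens_trivs (aE : atlas R (baseK c) (total_space (tens_fibre E1 E2))) :=
    forall (U : set M) (psi1 : total_space E1 -> M * F1)
           (psi2 : total_space E2 -> M * F2),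
      local_triv r aM aE1 U psi1 -> local_triv r aM aE2 U psi2 ->
      local_triv r aM aE U (tens_triv he psi1 psi2) in
  exists aE : atlas R (baseK c) (total_space (tens_fibre E1 E2)),
    [/\ tens_trivs aE,
        equivariant_bundle r aM (tensorT he F2) aE aG (tens_action beta1 beta2)
      & forall aE' : atlas R (baseK c) (total_space (tens_fibre E1 E2)),
          vector_bundle r aM (tensorT he F2) aE' -> tens_trivs aE' ->
          Crdiffeo r aE aE' setT setT id].

Proof.
have [mG _ _] := hG; have [mM _ _] := hM.
have [b1 _ _ _] := hE1; have [b2 _ _ _] := hE2.
have [_ _ _ l1] := hE1; have [_ _ _ l2] := hE2.
have bE := tens_vector_bundle mM b1 b2 he.
have [_ mE _ tE _] := bE.
have cE : compatible r aM F2 aE1 aE2 he (tens_atlas r aM F2 aE1 aE2 he).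
  by move=> U psi1 psi2; exact: tens_local_triv.
exists (tens_atlas r aM F2 aE1 aE2 he); split => //.
  split; first exact: bE.
  - exact: (tens_action_left hM hE1 hE2).
  - exact: (Crmap_tens_action mG hM hE1 hE2).
  - by move=> g x; exact: tens_map_linear (l1 g x) (l2 g x).
move=> aE' [_ mE' _ tE' _] cE'; exists id; split => //.
  exact: (compatible_Crmap mM b1 b2 mE tE cE mE' cE').
exact: (compatible_Crmap mM b1 b2 mE' tE' cE' mE cE).
Qed.
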